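(* Let $F_3=\langle a,b,c\rangle$ be the free group of rank $3$, and let $\mathcal E$, $\mathcal Z$, $\mathcal S$, the subgroups $A_{\mathcal X}\le F_3$ ($\mathcal X\subseteq\mathcal E$) and the operations $\iota,\upsilon,\rho,\sigma,\tau,\theta,\zeta,\pi,\omega_m$ ($m=1,2,\ldots$) be as defined in the context. Let $\mathcal Y$ be a subset of $\mathcal E$ for which one of the following holds: 1. $\mathcal Y$ is one of the sets $\mathcal Z$ or $\mathcal S$; 2. $\mathcal Y$ is obtained from sets $\mathcal X_1,\mathcal X_2\subseteq\mathcal E$ by one of the operations $\iota$ or $\upsilon$, where $A_{\mathcal X_1}$ and $A_{\mathcal X_2}$ are benign in $F_3$; 3. $\mathcal Y$ is obtained from a set $\mathcal X\subseteq\mathcal E$ by one of the operations $\rho,\sigma,\tau,\theta,\zeta,\pi,\omega_m$, where $A_{\mathcal X}$ is benign in $F_3$. Then $A_{\mathcal Y}$ is benign in $F_3$. Moreover, denoting for a benign $A_{\mathcal X}$ by $K_{\mathcal X}\ge F_3$ a finitely presented group and by $L_{\mathcal X}\le K_{\mathcal X}$ a finitely generated subgroup with $F_3\cap L_{\mathcal X}=A_{\mathcal X}$: in case 1 the groups $K_{\mathcal Y}$ and $L_{\mathcal Y}$ can always be given explicitly; in case 2 they can be given explicitly if $K_{\mathcal X_1},K_{\mathcal X_2}$ and $L_{\mathcal X_1},L_{\mathcal X_2}$ are known explicitly; in case 3 they can be given explicitly if $K_{\mathcal X}$ and $L_{\mathcal X}$ are known explicitly.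
   Context: $\mathcal E$ is the set of all functions $f:\mathbb Z\to\mathbb Z$ with finite support. A function $f\in\mathcal E$ with $f(i)=0$ for all $i<0$ and all $i\ge m$ is written as $f=(j_0,\ldots,j_{m-1})$, where $f(i)=j_i$; $\mathcal E_m$ is the set of all such $f$. $\mathcal Z=\{(0)\}$ consists of the zero function only, and $\mathcal S=\{(n,n+1)\mid n\in\mathbb Z\}\subseteq\mathcal E_2$. Conjugation is $u^v=v^{-1}uv$. In $F_3=\langle a,b,c\rangle$ put $b_i=b^{c^i}$ for $i\in\mathbb Z$, and for $f\in\mathcal E$ put $b_f=\cdots b_{-1}^{f(-1)}b_0^{f(0)}b_1^{f(1)}\cdots$ (indices increasing from left to right) and $a_f=a^{b_f}$. For $\mathcal X\subseteq\mathcal E$ put $A_{\mathcal X}=\langle a_f\mid f\in\mathcal X\rangle\le F_3$. A subgroup $H$ of a finitely generated group $G$ is benign in $G$ if $G$ can be embedded into a finitely presented group $K$ having a finitely generated subgroup $L\le K$ with $G\cap L=H$. Higman operations on subsets of $\mathcal E$: $\iota(\mathcal X_1,\mathcal X_2)=\mathcal X_1\cap\mathcal X_2$; $\upsilon(\mathcal X_1,\mathcal X_2)=\mathcal X_1\cup\mathcal X_2$. For the unary operations, $f\in\mathcal E$ belongs to the following set if and only if there is $g\in\mathcal X$ with the stated property: $\rho\mathcal X$: $f(i)=g(-i)$ for all $i$; $\sigma\mathcal X$: $f(i)=g(i-1)$ for all $i$; $\tau\mathcal X$: $f(0)=g(1)$, $f(1)=g(0)$, $f(i)=g(i)$ for $i\ne0,1$;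 $\theta\mathcal X$: $f(i)=g(2i)$ for all $i$; $\zeta\mathcal X$: $f(i)=g(i)$ for all $i\neq 0$; $\pi\mathcal X$: $f(i)=g(i)$ for all $i\le 0$. Finally, for $m\ge1$, $\omega_m\mathcal X$ is the set of all $f\in\mathcal E$ such that for every $i\in\mathbb Z$ the function $(f(mi),f(mi+1),\ldots,f(mi+m-1))\in\mathcal E_m$ belongs to $\mathcal X$. The pair $K_{\mathcal X},L_{\mathcal X}$ is given (known) explicitly if a finite list of generators and defining relations of $K_{\mathcal X}$ is written down, together with words in these generators representing $a,b,c$ (defining the embedding $F_3\le K_{\mathcal X}$) and words representing a finite generating set of $L_{\mathcal X}$. ''Can be given explicitly if ... are known explicitly'' means that such data for $\mathcal Y$ can be effectively written down from such data for the given set(s). *)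

(* Defs.v *)
From HB Require Import structures.
From mathcomp Require Import all_boot all_order all_algebra.
From mathcomp Require Import generic_quotient finmap.
From mathcomp Require Import boolp classical_sets.

Set Implicit Arguments.
Unset Strict Implicit.
Unset Printing Implicit Defensive.

Import GRing.Theory.

Local Open Scope quotient_scope.
Local Open Scope classical_set_scope.
Local Open Scope group_scope.

Section Subgroups.
Variable G : groupType.
Implicit Types S H : set G.

Definition is_subgroup H : Prop :=
  H 1 /\ forall x y, H x -> H y -> H (x / y).

Definition subgen S : set G := smallest is_subgroup S.

Definition fin_generated H : Prop :=
  exists s : seq G, H = subgen [set` s].

Definition expz (x : G) (k : int) : G :=
  match k with Posz n => x ^+ n | Negz n => x ^- n.+1 end.

End Subgroups.

(* The letter (i, false) is the i-th generator, (i, true) is its inverse. *)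
Definition letter (n : nat) := ('I_n * bool)%type.
Definition word (n : nat) := seq (letter n).

Definition linv n (l : letter n) : letter n := (l.1, ~~ l.2).
Definition winv n (w : word n) : word n := rev (map (@linv n) w).

(* The finite presentation < x_0, ..., x_(n-1) | r = 1 for r in relators >. *)
Record presentation := Presentation {
  ngens : nat;
  relators : seq (word ngens)
}.

Section PresentedGroup.
Variable P : presentation.
Implicit Types (u v w : word (ngens P)).

Inductive weq : word (ngens P) -> word (ngens P) -> Prop :=
| weq_refl u : weq u u
| weq_sym u v : weq u v -> weq v u
| weq_trans u v w : weq u v -> weq v w -> weq u w
| weq_cat u u' v v' : weq u u' -> weq v v' -> weq (u ++ v) (u' ++ v')
| weq_cancel l : weq [:: l; linv l] [::]
| weq_relator r : r \in relators P -> weq r [::].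

Let weqb u v : bool := `[< weq u v >].

Let weqb_refl : reflexive weqb.
Proof. by move=> u; apply/asboolP; exact: weq_refl. Qed.

Let weqb_sym : symmetric weqb.
Proof. by move=> u v; apply/asboolP/asboolP => /weq_sym. Qed.

Let weqb_trans : transitive weqb.
Proof.
move=> v u w /asboolP uv /asboolP vw; apply/asboolP; exact: weq_trans uv vw.
Qed.

Canonical weq_equiv : equiv_rel (word (ngens P)) :=
  EquivRel weqb weqb_refl weqb_sym weqb_trans.

Definition presented := {eq_quot weq_equiv}.
HB.instance Definition _ := Choice.on presented.
HB.instance Definition _ := EqQuotient.on presented.

Definition wclass w : presented := \pi_presented w.

Lemma wclassP u v : wclass u = wclass v <-> weq u v.
Proof.
split; first by move=> /eqmodP/asboolP.
by move=> uv; apply/eqmodP/asboolP.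
Qed.

Lemma wclass_repr (x : presented) : wclass (repr x) = x.
Proof. exact: reprK. Qed.

Let linvK : involutive (@linv (ngens P)).
Proof. by case=> i b; rewrite /linv /= negbK. Qed.

Let winvK : involutive (@winv (ngens P)).
Proof.
by move=> w; rewrite /winv map_rev revK -map_comp map_id_in // => l _ /=.
Qed.

Let weq_mulV w : weq (w ++ winv w) [::].
Proof.
elim: w => [|l w IHw]; first exact: weq_refl.
have -> : (l :: w) ++ winv (l :: w) = [:: l] ++ ((w ++ winv w) ++ [:: linv l]).
  by rewrite /winv map_cons rev_cons -cats1 -!catA.
apply: weq_trans (weq_cancel l); rewrite -[in X in weq _ X]cat1s.
apply: weq_cat; first exact: weq_refl.
by rewrite -[X in weq _ X]cat0s; apply: weq_cat => //; exact: weq_refl.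
Qed.

Let weq_inv u v : weq u v -> weq (winv u) (winv v).
Proof.
move=> uv.
have e1 : weq (winv u) (winv u ++ (v ++ winv v)).
  rewrite -[X in weq X _]cats0; apply: weq_cat; first exact: weq_refl.
  exact/weq_sym/weq_mulV.
apply: weq_trans e1 _; rewrite catA -[X in weq _ X]cat0s.
apply: weq_cat; last exact: weq_refl.
apply: weq_trans (_ : weq (winv u ++ u) [::]).
  by apply: weq_cat; [exact: weq_refl | exact: weq_sym].
by rewrite -{2}(winvK u); exact: weq_mulV.
Qed.

Definition pmul (x y : presented) : presented := wclass (repr x ++ repr y).
Definition pinv (x : presented) : presented := wclass (winv (repr x)).
Definition pone : presented := wclass [::].

Let weq_repr w : weq (repr (wclass w)) w.
Proof. by apply/wclassP; rewrite wclass_repr. Qed.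

Lemma pmul_wclass u v : pmul (wclass u) (wclass v) = wclass (u ++ v).
Proof. by apply/wclassP; apply: weq_cat; exact: weq_repr. Qed.

Lemma pinv_wclass u : pinv (wclass u) = wclass (winv u).
Proof. by apply/wclassP; apply: weq_inv; exact: weq_repr. Qed.

Let pmulA : associative pmul.
Proof.
move=> x y z; rewrite -(wclass_repr x) -(wclass_repr y) -(wclass_repr z).
by rewrite !pmul_wclass catA.
Qed.

Let pmul1 : left_id pone pmul.
Proof. by move=> x; rewrite -(wclass_repr x) pmul_wclass. Qed.

Let pmulr1 : right_id pone pmul.
Proof. by move=> x; rewrite -(wclass_repr x) pmul_wclass cats0. Qed.

Let pmulrV : right_inverse pone pinv pmul.
Proof.
move=> x; rewrite -(wclass_repr x) pinv_wclass pmul_wclass.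
by apply/wclassP; exact: weq_mulV.
Qed.

Let pmulV : left_inverse pone pinv pmul.
Proof.
move=> x; rewrite -(wclass_repr x) pinv_wclass pmul_wclass.
by apply/wclassP; rewrite -{2}(winvK (repr x)); exact: weq_mulV.
Qed.

HB.instance Definition _ :=
  isGroup.Build presented pmulA pmul1 pmulr1 pmulV pmulrV.

Definition pgen (i : 'I_(ngens P)) : presented := wclass [:: (i, false)].

End PresentedGroup.

Definition fin_presented (K : groupType) : Prop :=
  exists (P : presentation) (f : {multiplicative presented P -> K}), bijective f.

Definition benign (G : groupType) (H : set G) : Prop :=
  exists (K : groupType) (f : {multiplicative G -> K}) (L : set K),
    [/\ fin_presented K, injective f, fin_generated L & f @^-1` L = H].

Definition free_pres (n : nat) : presentation := Presentation (ngens := n) [::].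

Definition F3 : groupType := presented (free_pres 3).
Definition a3 : F3 := pgen (P := free_pres 3) (@Ordinal 3 0 isT).
Definition b3 : F3 := pgen (P := free_pres 3) (@Ordinal 3 1 isT).
Definition c3 : F3 := pgen (P := free_pres 3) (@Ordinal 3 2 isT).

Definition calE := {fsfun int -> int with 0%R}.

(* The function (j_0, ..., j_(m-1)), given by the sequence of its values. *)
Definition etuple (s : seq int) : calE :=
  [fsfun k in [fset Posz i | i in iota 0 (size s)]%fset => (s`_(absz k))%R].

Lemma etupleE (s : seq int) (k : int) :
  etuple s k = if (0 <= k)%R then (s`_(absz k))%R else 0%R.
Proof.
rewrite fsfunE; case: k => [n|n] /=; case: imfsetP => //=; last by case.
move=> H; rewrite nth_default // leqNgt; apply/negP => lt_n.
by apply: H; exists n; rewrite //= mem_iota.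
Qed.

Definition bi (i : int) : F3 := b3 ^ expz c3 i.

Definition bf (f : calE) : F3 :=
  \prod_(i <- sort <=%O (finsupp f)) expz (bi i) (f i).

Definition af (f : calE) : F3 := a3 ^ bf f.

Definition A_of (X : set calE) : set F3 := subgen [set af f | f in X].

Definition Zset : set calE := [set etuple [:: 0%R]].
Definition Sset : set calE := [set etuple [:: n; (n + 1)%R] | n in [set: int]].

Section HigmanOperations.
Local Open Scope ring_scope.

Definition h_iota (X1 X2 : set calE) : set calE := X1 `&` X2.
Definition h_upsilon (X1 X2 : set calE) : set calE := X1 `|` X2.

Definition h_rho (X : set calE) : set calE :=
  [set f : calE | exists2 g, X g & forall i : int, f i = g (- i)].
Definition h_sigma (X : set calE) : set calE :=
  [set f : calE | exists2 g, X g & forall i : int, f i = g (i - 1)].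
Definition h_tau (X : set calE) : set calE :=
  [set f : calE | exists2 g, X g & [/\ f 0 = g 1, f 1 = g 0
    & forall i : int, i != 0 -> i != 1 -> f i = g i]].
Definition h_theta (X : set calE) : set calE :=
  [set f : calE | exists2 g, X g & forall i : int, f i = g (2 * i)].
Definition h_zeta (X : set calE) : set calE :=
  [set f : calE | exists2 g, X g & forall i : int, i != 0 -> f i = g i].
Definition h_pi (X : set calE) : set calE :=
  [set f : calE | exists2 g, X g & forall i : int, i <= 0 -> f i = g i].
Definition h_omega (m : nat) (X : set calE) : set calE :=
  [set f : calE | forall i : int,
    X (etuple [seq f (m%:Z * i + k%:Z) | k <- iota 0 m])].

End HigmanOperations.

(* A presentation of K, words for the images of a, b, c in K, and words for
   the generators of L. *)
Record bdata := BData {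
  dpres : presentation;
  d_a : word (ngens dpres);
  d_b : word (ngens dpres);
  d_c : word (ngens dpres);
  d_L : seq (word (ngens dpres))
}.

(* D gives explicitly a pair (K_X, L_X), with the embedding of F3 into K_X. *)
Definition explicit_for (D : bdata) (X : set calE) : Prop :=
  exists f : {multiplicative F3 -> presented (dpres D)},
    [/\ f a3 = wclass (d_a D), f b3 = wclass (d_b D), f c3 = wclass (d_c D),
        injective f
      & f @^-1` subgen [set` map (@wclass (dpres D)) (d_L D)] = A_of X].

(* Effectivity is expressed in a Turing-complete language of programs
   computing partial functions on binary trees: projections, pairing,
   composition, structural recursion, and while loops, whose guard is that the
   left subtree of the current state is not a leaf. *)
Inductive tree := Leaf | Node (l r : tree).

Inductive prog :=
| PLeaf
| PId
| PLeft
| PRight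
| PPair (p q : prog)
| PComp (q p : prog)
| PRec (p q : prog)
| PWhile (p : prog).

Inductive eval : prog -> tree -> tree -> Prop :=
| eval_leaf x : eval PLeaf x Leaf
| eval_id x : eval PId x x
| eval_left l r : eval PLeft (Node l r) l
| eval_right l r : eval PRight (Node l r) r
| eval_pair p q x y z :
    eval p x y -> eval q x z -> eval (PPair p q) x (Node y z)
| eval_comp p q x y z : eval p x y -> eval q y z -> eval (PComp q p) x z
| eval_rec_leaf p q x y : eval p x y -> eval (PRec p q) (Node x Leaf) y
| eval_rec_node p q x l r yl yr y :
    eval (PRec p q) (Node x l) yl -> eval (PRec p q) (Node x r) yr ->
    eval q (Node x (Node (Node l r) (Node yl yr))) y ->
    eval (PRec p q) (Node x (Node l r)) y
| eval_while_stop p x : eval (PWhile p) (Node Leaf x) (Node Leaf x)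
| eval_while_step p l r x y z :
    eval p (Node (Node l r) x) y -> eval (PWhile p) y z ->
    eval (PWhile p) (Node (Node l r) x) z.

Lemma eval_det p x y y' : eval p x y -> eval p x y' -> y = y'.
Proof.
move=> H; elim: H y' => {p x y}.
- by move=> x y' H; inversion H.
- by move=> x y' H; inversion H.
- by move=> l r y' H; inversion H.
- by move=> l r y' H; inversion H.
- move=> p q x y z _ IHp _ IHq y' H; inversion H; subst.
  by congr Node; [exact: IHp | exact: IHq].
- move=> p q x y z _ IHp _ IHq y' H; inversion H as [| | | | |? ? ? t ? Hp| | | |].
  by subst; apply: IHq; rewrite (IHp _ Hp).
- by move=> p q x y _ IH y' H; inversion H; subst; exact: IH.
- move=> p q x l r yl yr y _ IHl _ IHr _ IHq y' H.
  inversion H as [| | | | | | |? ? ? ? ? tl tr ? Hl Hr| |].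
  by subst; apply: IHq; rewrite (IHl _ Hl) (IHr _ Hr).
- by move=> p x y' H; inversion H.
- move=> p l r x y z _ IHp _ IHw y' H.
  inversion H as [| | | | | | | | |? ? ? ? t ? Hp].
  by subst; apply: IHw; rewrite (IHp _ Hp).
Qed.

Definition enc_seq T (e : T -> tree) (s : seq T) : tree :=
  foldr (fun x t => Node (e x) t) Leaf s.
Definition enc_nat (n : nat) : tree := iter n (Node Leaf) Leaf.
Definition enc_bool (x : bool) : tree := if x then Node Leaf Leaf else Leaf.
Definition enc_letter n (l : letter n) : tree :=
  Node (enc_nat l.1) (enc_bool l.2).
Definition enc_word n (w : word n) : tree := enc_seq (@enc_letter n) w.

Definition enc_bdata (D : bdata) : tree :=
  Node
    (Node (enc_nat (ngens (dpres D)))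
          (enc_seq (@enc_word _) (relators (dpres D))))
    (Node (Node (enc_word (d_a D)) (Node (enc_word (d_b D)) (enc_word (d_c D))))
          (enc_seq (@enc_word _) (d_L D))).

Definition effective1 (op : set calE -> set calE) : Prop :=
  exists p : prog, forall (X : set calE) (D : bdata),
    explicit_for D X ->
    exists2 D' : bdata, explicit_for D' (op X)
      & eval p (enc_bdata D) (enc_bdata D').

Definition effective2 (op : set calE -> set calE -> set calE) : Prop :=
  exists p : prog, forall (X1 X2 : set calE) (D1 D2 : bdata),
    explicit_for D1 X1 -> explicit_for D2 X2 ->
    exists2 D' : bdata, explicit_for D' (op X1 X2)
      & eval p (Node (enc_bdata D1) (enc_bdata D2)) (enc_bdata D').

(* Uniform in m: a single program, which also receives m, serves every m >= 1. *)
Definition effective1_family (op : nat -> set calE -> set calE) : Prop :=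
  exists p : prog, forall (m : nat) (X : set calE) (D : bdata),
    (0 < m)%N -> explicit_for D X ->
    exists2 D' : bdata, explicit_for D' (op m X)
      & eval p (Node (enc_nat m) (enc_bdata D)) (enc_bdata D').

(* Main.v *)
(** By permutations instead of normal forms, the base group survives the adjunction of
   stable letters. Let [M_i] be subgroups of a group [G], which acts on the left of
   [G * (option nat * lists)], and let sheet [i] consist of the points labelled [i] whose
   first component is in [M_i]. If a partial isomorphism [Phi] of [G] matches [M_i] with
   [M_j], a Cantor-Bernstein argument gives a permutation [t] with [t x = y t] for
   [Phi x y] that maps sheet [i] onto sheet [j]. Hence in the group presented with such
   letters an element of [G] that is a product of paths from sheet 0 to itself is in
   [M_0], and only the converse, generation, remains to be checked.

   In a free product of [<a>] and [Q] put [N(R) = <a^q | q in R>]. Then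
   [N(R) L /\ N(R') L' = N(R /\ R') (L /\ L')], because [Q] acts on [Q * S] with [a]
   acting arbitrarily on the fibres. The elements [b_f] are replaced by products of powers
   of [t ^ s ^ i] in the finitely presented group
   [B = <t, s, r | [r,s], [t,t^s], t^r = t t^s>], where these conjugates commute. An
   operation given by [u_g L = v_f L], with [L] a finitely generated subgroup of a
   finitely presented group [Q], maps [A_X] to the preimage of [<A_X, L>], cut down to the
   benign subgroup of all [a_f]; this covers all unary operations except [omega_m], for
   which stable letters compose a function of its blocks.

   All these constructions act on presentations and words by structural recursion. *)

Require Import Defs.
From HB Require Import structures.
From mathcomp Require Import all_boot all_order all_algebra.
From mathcomp Require Import finmap zify.
From mathcomp Require Import boolp classical_sets.

Set Implicit Arguments.
Unset Strict Implicit.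
Unset Printing Implicit Defensive.

Local Open Scope classical_set_scope.
Local Open Scope group_scope.

(** * Homomorphisms and generated subgroups *)

(** In [F3] the [b_i] do not commute, so changing a coordinate in the middle of [b_f] is no coset
    relation there. Commuting conjugates alone would give a wreath product of two infinite cyclic
    groups, which is not finitely presented; this is why [B] has a third generator. The price is
    that a homomorphism from [F3] that makes the [b_i] commute is not injective and can be undone
    only on the group of all [a_f]. Benignness of that group therefore enters every unary operation,
    and it has to be proved beforehand, inside [F3].

    The second obstacle is finiteness. A stable letter may carry only finitely many relators,
    whereas the subgroups to be compared are not finitely generated. A letter therefore compares two
    sheets only on a finitely generated subgroup of the base, and the subgroups of the two sheets
    need to agree only there. Labels let one presentation with several letters do the work of a
    tower of extensions, so that no intermediate embedding has to be proved. For [omega_m] the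
    number [m] enters only through a power of [s] in the relators, which makes one program serve all
    [m]. *)

Definition hom (G H : groupType) (f : G -> H) := forall x y, f (x * y) = f x * f y.

Section Hom.
Variables (G H : groupType) (f : G -> H).
Hypothesis fM : hom f.

Lemma hom1 : f 1 = 1.
Proof. by apply: (@mulgI _ (f 1)); rewrite -fM !mulg1. Qed.

Lemma homV x : f x^-1 = (f x)^-1.
Proof. by apply/esym/mulg1_eq; rewrite -fM mulgV hom1. Qed.

Lemma homX x n : f (x ^+ n) = f x ^+ n.
Proof. by elim: n => [|n IHn]; rewrite ?expg0 ?hom1 // !expgS fM IHn. Qed.

Lemma homXz x k : f (expz x k) = expz (f x) k.
Proof. by case: k => n; rewrite /= ?homV homX. Qed.

Lemma homJ x y : f (x ^ y) = f x ^ f y.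
Proof. by rewrite !conjgE !fM homV. Qed.

Lemma hom_prod I (r : seq I) (E : I -> G) :
  f (\prod_(i <- r) E i) = \prod_(i <- r) f (E i).
Proof. by apply: big_morph; [exact: fM | exact: hom1]. Qed.

End Hom.

Lemma hom_comp (G H K : groupType) (f : G -> H) (g : H -> K) :
  hom f -> hom g -> hom (g \o f).
Proof. by move=> fM gM x y /=; rewrite fM gM. Qed.

Lemma hom_id (G : groupType) : hom (@id G).
Proof. by []. Qed.

Section Subgroups.
Variable G : groupType.
Implicit Types S H : set G.

Lemma sg1 H : is_subgroup H -> H 1. Proof. by case. Qed.

Lemma sgV H x : is_subgroup H -> H x -> H x^-1.
Proof. by move=> [H1 Hd] Hx; rewrite -div1g; exact: Hd. Qed.

Lemma sgM H x y : is_subgroup H -> H x -> H y -> H (x * y).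
Proof. by move=> HS Hx Hy; rewrite -[y]invgK; apply: HS.2 => //; exact: (sgV HS). Qed.

Lemma sgVE H x : is_subgroup H -> H x^-1 <-> H x.
Proof. by move=> HS; split=> /(sgV HS) //; rewrite invgK. Qed.

Lemma sgMl H x y : is_subgroup H -> H x -> H (x * y) <-> H y.
Proof.
move=> HS Hx; split=> Hy; last exact: (sgM HS).
by rewrite -(mulKg x y); apply: (sgM HS) => //; exact: (sgV HS).
Qed.

Lemma sgJ H x y : is_subgroup H -> H x -> H y -> H (x ^ y).
Proof. by move=> HS Hx Hy; rewrite conjgE; apply: (sgM HS) => //; [exact: (sgV HS) | exact: (sgM HS)]. Qed.

Lemma sgX H x n : is_subgroup H -> H x -> H (x ^+ n).
Proof. by move=> HS Hx; elim: n => [|n IHn]; rewrite ?expg0 ?expgS; [exact: (sg1 HS) | exact: (sgM HS)]. Qed.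

Lemma sgXz H x k : is_subgroup H -> H x -> H (expz x k).
Proof. by move=> HS Hx; case: k => n /=; [|apply: (sgV HS) => //]; exact: (sgX _ HS). Qed.

Lemma sg_prod H I (r : seq I) (E : I -> G) :
  is_subgroup H -> (forall i, H (E i)) -> H (\prod_(i <- r) E i).
Proof.
move=> HS HE; elim: r => [|i r IHr]; rewrite ?big_nil ?big_cons; first exact: (sg1 HS).
exact: (sgM HS).
Qed.

Lemma is_subgroupM H : H 1 -> (forall x, H x -> H x^-1) ->
  (forall x y, H x -> H y -> H (x * y)) -> is_subgroup H.
Proof. by move=> H1 HV HM; split=> // x y Hx Hy; apply: HM => //; exact: HV. Qed.

Lemma is_subgroupI H1 H2 : is_subgroup H1 -> is_subgroup H2 -> is_subgroup (H1 `&` H2).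
Proof.
move=> S1 S2; split; first by split; [exact: (sg1 S1) | exact: (sg1 S2)].
by move=> x y [x1 x2] [y1 y2]; split; [case: S1 => _; apply | case: S2 => _; apply].
Qed.

Lemma is_subgroup1 : is_subgroup [set (1 : G)].
Proof. by split=> // x y -> ->; rewrite divg1. Qed.

Lemma is_subgroupT : is_subgroup [set: G].
Proof. by []. Qed.

Lemma subgenP S : is_subgroup (subgen S).
Proof.
split=> [H [[H1 _] _]|x y Sx Sy H HS]; first exact: H1.
by case: (HS) => -[_ Hd] SH; apply: Hd; [exact: Sx | exact: Sy].
Qed.

Lemma subgen_in S : S `<=` subgen S.
Proof. by move=> x Sx H [_]; apply. Qed.

Lemma subgen_min S H : is_subgroup H -> S `<=` H -> subgen S `<=` H.
Proof. by move=> HS SH x; apply. Qed.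

Lemma subgenS S1 S2 : S1 `<=` S2 -> subgen S1 `<=` subgen S2.
Proof. by move=> S12; apply: subgen_min; [exact: subgenP | exact: subset_trans (@subgen_in _)]. Qed.

End Subgroups.

Lemma is_subgroup_preim (G K : groupType) (f : G -> K) (H : set K) :
  hom f -> is_subgroup H -> is_subgroup (f @^-1` H).
Proof.
move=> fM HS; apply: is_subgroupM => [|x|x y]; rewrite /preimage /=.
- by rewrite (hom1 fM); exact: (sg1 HS).
- by rewrite (homV fM) => Hx; exact: (sgV HS).
- by rewrite fM => Hx Hy; exact: (sgM HS).
Qed.

Lemma is_subgroup_im (G K : groupType) (f : K -> G) (H : set K) :
  hom f -> is_subgroup H -> is_subgroup (f @` H).
Proof.
move=> fM HS; apply: is_subgroupM => [|x|x y].
- by exists 1; [exact: (sg1 HS) | exact: hom1].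
- by move=> [u Hu <-]; exists u^-1; [exact: (sgV HS) | exact: homV].
- by move=> [u Hu <-] [v Hv <-]; exists (u * v); [exact: (sgM HS) | exact: fM].
Qed.

#[global] Hint Resolve subgenP is_subgroup1 is_subgroupT : core.

Lemma hom_subgen (G H : groupType) (f : G -> H) (S : set G) (T : set H) x :
  hom f -> is_subgroup T -> (forall y, S y -> T (f y)) -> subgen S x -> T (f x).
Proof. by move=> fM TS ST; apply: (subgen_min (is_subgroup_preim fM TS)). Qed.

(** * Permutation groups *)

(** The inverse is part of the data, so the group operations are given by formulas; in a product the
    right factor acts first. *)
Record perms (T : Type) := Perms {
  pfun :> T -> T;
  pinv : T -> T;
  pfunK : cancel pfun pinv;
  pinvK : cancel pinv pfun
}.

Section Perms.
Variable T : Type.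
Implicit Types p q : perms T.

Lemma perms_eq p q : (forall w, p w = q w) -> p = q.
Proof.
case: p q => [f f' fK f'K] [g g' gK g'K] /= fg.
have Ef : f = g by apply: funext.
subst g; have Ef' : f' = g' by apply: funext => w; rewrite -{1}(g'K w) fK.
by subst g'; congr Perms; exact: Prop_irrelevance.
Qed.

HB.instance Definition _ := gen_eqMixin (perms T).
HB.instance Definition _ := gen_choiceMixin (perms T).

Definition perms1 : perms T := @Perms T id id (fun _ => erefl) (fun _ => erefl).
Definition permsM p q : perms T :=
  Perms (can_comp (pfunK p) (pfunK q)) (can_comp (pinvK q) (pinvK p)).
Definition permsV p : perms T := Perms (pinvK p) (pfunK p).

Let permsA : associative permsM. Proof. by move=> p q r; exact: perms_eq. Qed.
Let perms1M : left_id perms1 permsM. Proof. by move=> p; exact: perms_eq. Qed.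
Let permsM1 : right_id perms1 permsM. Proof. by move=> p; exact: perms_eq. Qed.
Let permsVM : left_inverse perms1 permsV permsM.
Proof. by move=> p; apply: perms_eq => w /=; rewrite pfunK. Qed.
Let permsMV : right_inverse perms1 permsV permsM.
Proof. by move=> p; apply: perms_eq => w /=; rewrite pinvK. Qed.

HB.instance Definition _ :=
  isGroup.Build (perms T) permsA perms1M permsM1 permsVM permsMV.

Lemma permsME p q w : (p * q) w = p (q w). Proof. by []. Qed.
Lemma perms1E w : (1 : perms T) w = w. Proof. by []. Qed.
Lemma permsVE p w : p^-1 w = pinv p w. Proof. by []. Qed.
Lemma pfun_inj p : injective p. Proof. exact: can_inj (pfunK p). Qed.

Lemma perms_of_bij (f : T -> T) :
  injective f -> (forall w, exists v, f v = w) -> exists p : perms T, forall w, p w = f w.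
Proof.
move=> fI fS; have [g gP] := choice fS.
have gK : cancel f g by move=> w; apply: fI.
by exists (Perms gK gP).
Qed.

End Perms.

Section Regular.
Variables (Z S : groupType) (T : Type) (K : Z -> perms T) (emb : S -> T).
Hypothesis KM : hom K.

(** An action that is left translation on the copy [emb] of [S] can be read off at [emb 1]; since
    the elements acting in this way form a subgroup, it is enough to test generators. *)
Lemma regular_subgroup (theta : Z -> S) : hom theta ->
  is_subgroup [set z | forall s, K z (emb s) = emb (theta z * s)].
Proof.
move=> tM; apply: is_subgroupM => /= [s|x E s|x y Ex Ey s].
- by rewrite (hom1 KM) (hom1 tM) mul1g.
- rewrite (homV KM) (homV tM); apply: (@pfun_inj _ (K x)).
  by rewrite -permsME mulgV E mulVKg.
- by rewrite KM permsME Ey Ex tM mulgA.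
Qed.

(** Here the translating element is only known to lie in [P]; comparison with an exact translation
    from [regular_subgroup] then puts a given element into [P]. *)
Lemma regular_in_subgroup (P : set S) : is_subgroup P ->
  is_subgroup [set z | exists2 w, P w & forall s, K z (emb s) = emb (w * s)].
Proof.
move=> PS; apply: is_subgroupM => /= [|x [w Pw E]|x y [w Pw Ew] [v Pv Ev]].
- by exists 1; [exact: sg1 PS | move=> s; rewrite (hom1 KM) mul1g].
- exists w^-1 => [|s]; first exact: (sgV PS).
  rewrite (homV KM); apply: (@pfun_inj _ (K x)).
  by rewrite -permsME mulgV E mulVKg.
- exists (w * v) => [|s]; first exact: (sgM PS).
  by rewrite KM permsME Ev Ew mulgA.
Qed.

End Regular.

(** * Stable letters *)

Section StableLetter.
Variable G : groupType.

(** A point is an element of [G], a label ([None] names no sheet), and a stack on which each half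
    letter stores what it would otherwise forget; this keeps the half letter injective. *)
Definition hnn_space : Type := G * (option nat * seq (option nat * G)).

Definition lmul (x : G) (w : hnn_space) : hnn_space := (x * w.1, w.2).

Let lmulK x : cancel (lmul x) (lmul x^-1).
Proof. by case=> g w; rewrite /lmul /= mulKg. Qed.
Let lmulVK x : cancel (lmul x^-1) (lmul x).
Proof. by case=> g w; rewrite /lmul /= mulVKg. Qed.

Definition plmul (x : G) : perms hnn_space := Perms (lmulK x) (lmulVK x).

Lemma plmul_hom : hom plmul.
Proof. by move=> x y; apply: perms_eq => -[g w]; rewrite permsME /= /lmul /= mulgA. Qed.

Variable M : nat -> set G.
Hypothesis MS : forall i, is_subgroup (M i).

Definition in_sheet (i : nat) (w : hnn_space) : Prop := w.2.1 = Some i /\ M i w.1.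

(** A subgroup of [G * G] that is the graph of an isomorphism between its projections. As a relation
    it is inverted without choosing functions, which the gluing of a letter with its inverse
    exploits. *)
Record matching (i j : nat) (Phi : G -> G -> Prop) : Prop := Matching {
  match1 : Phi 1 1;
  matchD : forall x y x' y', Phi x y -> Phi x' y' -> Phi (x / x') (y / y');
  match_inj : forall x y, Phi x y -> (x = 1 <-> y = 1);
  match_sheet : forall x y, Phi x y -> (M i x <-> M j y)
}.

Lemma matching_sym i j Phi : matching i j Phi -> matching j i (fun x y => Phi y x).
Proof.
move=> mP; split=> [|x y x' y'|x y|x y].
- exact: match1 mP.
- exact: matchD mP _ _ _ _.
- by move=> /(match_inj mP) [? ?]; split.
- by move=> /(match_sheet mP) [? ?]; split.
Qed.

Section HalfLetter.
Variables (i j : nat) (Phi : G -> G -> Prop).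
Hypothesis mP : matching i j Phi.

Let dom x := exists y, Phi x y.
Let phi x := xget 1 [set y | Phi x y].
(** The right coset of the domain of [Phi] through [g]. Its representative is taken in [M i]
    whenever the point is labelled [i] and the coset meets [M i]; then [g] is in [M i] exactly when
    the image under [phi] is in [M j]. *)
Let coset g : set G := [set r | dom (g / r)].
Let good l g := `[< l = Some i /\ exists r, coset g r /\ M i r >].
Let rep l g := if good l g then xget 1 (coset g `&` M i) else xget 1 (coset g).
Let step (w : hnn_space) : hnn_space :=
  (phi (w.1 / rep w.2.1 w.1),
   (if good w.2.1 w.1 then Some j else None, (w.2.1, rep w.2.1 w.1) :: w.2.2)).

Let phiP x : dom x -> Phi x (phi x).
Proof. by move=> [y xy]; rewrite /phi; case: xgetP => [z -> //|/(_ y)]. Qed.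

Let Phi_fun x y y' : Phi x y -> Phi x y' -> y = y'.
Proof.
move=> xy xy'; apply: divg1_eq; apply/(match_inj mP (matchD mP xy xy')).
exact: mulgV.
Qed.

Let Phi_inj x x' y : Phi x y -> Phi x' y -> x = x'.
Proof.
move=> xy xy'; apply: divg1_eq; apply/(match_inj mP (matchD mP xy xy')).
exact: mulgV.
Qed.

Let PhiM x y x' y' : Phi x y -> Phi x' y' -> Phi (x * x') (y * y').
Proof.
move=> xy xy'; rewrite -[x']invgK -[y']invgK; apply: (matchD mP) => //.
by rewrite -(div1g x') -(div1g y'); apply: (matchD mP) => //; exact: match1 mP.
Qed.

Let coset_refl g : coset g g.
Proof. by exists 1; rewrite mulgV; exact: match1 mP. Qed.

Let rep_coset l g : dom (g / rep l g).
Proof.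
rewrite /rep /good; case: asboolP => [[_ [r rP]]|_].
  by case: xgetP => [z _ []|/(_ r)].
by case: xgetP => [z _|/(_ g) []].
Qed.

Let rep_M l g : good l g -> M i (rep l g).
Proof.
rewrite /rep => gl; rewrite gl; move/asboolP: gl => [_ [r rP]].
by case: xgetP => [z _ []|/(_ r)].
Qed.

Let PhiV x y : Phi x y -> Phi x^-1 y^-1.
Proof. by rewrite -(div1g x) -(div1g y); apply: (matchD mP); exact: match1 mP. Qed.

Let coset_dom x g : dom x -> coset (x * g) = coset g.
Proof.
move=> [y xy]; apply/seteqP; split=> r [z]; rewrite /coset /= -?mulgA.
  by move=> /(PhiM (PhiV xy)); rewrite mulKg => rz; exists (y^-1 * z).
by move=> gr; exists (y * z); exact: PhiM.
Qed.

Let step_inj : injective step.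
Proof.
move=> [g [l s]] [g' [l' s']] /= [Ep _ El Er Es]; rewrite -{}El -{}Es in Er Ep *.
have P1 := phiP (rep_coset l g); have P2 := phiP (rep_coset l g').
rewrite -Er in P2 Ep; rewrite -Ep in P2.
by congr pair; apply: (@mulIg _ (rep l g)^-1); exact: Phi_inj P1 P2.
Qed.

Let step_equiv x y w : Phi x y -> step (lmul x w) = lmul y (step w).
Proof.
case: w => g [l s] xy; have Ec : coset (x * g) = coset g by apply: coset_dom; exists y.
have Eg : good l (x * g) = good l g by rewrite /good Ec.
have Er : rep l (x * g) = rep l g by rewrite /rep Eg Ec.
rewrite /step /lmul /= Eg Er -mulgA; congr pair.
have P1 := PhiM xy (phiP (rep_coset l g)).
have D : dom (x * (g / rep l g)) by eexists; exact: P1.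
exact: Phi_fun (phiP D) P1.
Qed.

Let step_sheet w : in_sheet i w <-> in_sheet j (step w).
Proof.
case: w => g [l s]; rewrite /in_sheet /step /=; split.
  move=> [El Mg]; have gl : good l g.
    by apply/asboolP; split=> //; exists g.
  rewrite gl; split=> //; apply/(match_sheet mP (phiP (rep_coset l g))).
  by apply: (MS i).2 => //; exact: rep_M.
case gl: (good l g) => -[//= _]; move/(match_sheet mP (phiP (rep_coset l g))).
move=> Mg; split; first by move/asboolP: gl => -[].
by rewrite -[g](@divgK _ (rep l g)); apply: (sgM (MS i)) => //; exact: rep_M.
Qed.

Lemma half_letter : exists f : hnn_space -> hnn_space,
  [/\ injective f, forall x y w, Phi x y -> f (lmul x w) = lmul y (f w)
    & forall w, in_sheet i w <-> in_sheet j (f w)].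
Proof. by exists step; split. Qed.

End HalfLetter.

(* The two injections obtained from [Phi] and its inverse are glued as in the
   Cantor-Bernstein theorem, which preserves equivariance. *)
Lemma stable_letter i j Phi : matching i j Phi -> exists t : perms hnn_space,
  (forall x y, Phi x y -> t * plmul x = plmul y * t) /\
  forall w, in_sheet i w <-> in_sheet j (t w).
Proof.
move=> mP; have [f [fI fE fS]] := half_letter mP.
have [g [gI gE gS]] := half_letter (matching_sym mP).
(* [C] consists of the points whose backward orbit under [g \o f] reaches a point outside the range
   of [g]. There [f] is used, elsewhere the inverse of [g]. *)
pose C w := exists n v, w = iter n (g \o f) v /\ ~ exists u, g u = v.
have ginv w : ~ C w -> exists u, g u = w.
  by move=> nC; apply: contrapT => nr; apply: nC; exists 0, w.
have CS w : C w -> C (g (f w)).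
  by move=> [n [v [-> nv]]]; exists n.+1, v.
have CSV w : C (g (f w)) -> C w.
  move=> [[|n] [v [E nv]]]; first by case: nv; exists (f w).
  by exists n, v; split=> //; apply: fI; apply: gI.
have [w|h hP] := @choice _ _ (fun w v => (C w -> v = f w) /\ (~ C w -> g v = w)).
  case: (pselect (C w)) => Cw; first by exists (f w); split.
  by have [u Eu] := ginv w Cw; exists u; split.
have hI : injective h.
  move=> v w E; case: (pselect (C v)) => Cv; case: (pselect (C w)) => Cw.
  - by apply: fI; rewrite -(hP v).1 // -(hP w).1.
  - by case: (Cw); rewrite -((hP w).2 Cw) -E (hP v).1 //; exact: CS.
  - by case: (Cv); rewrite -((hP v).2 Cv) E (hP w).1 //; exact: CS.
  - by rewrite -((hP v).2 Cv) -((hP w).2 Cw) E.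
have hS w : exists v, h v = w.
  case: (pselect (C (g w))) => Cw; last first.
    by exists (g w); apply: gI; rewrite (hP _).2.
  have [n [v [E nv]]] := Cw; case: n E => [E|n /= /gI E]; first by case: nv; exists w.
  exists (iter n (g \o f) v); rewrite (hP _).1 //; exists n, v; split=> //.
have [t tP] := perms_of_bij hI hS; exists t.
have iterE n x y v : Phi x y -> iter n (g \o f) (lmul x v) = lmul x (iter n (g \o f) v).
  by move=> xy; elim: n => //= n ->; rewrite (fE _ y) // (gE _ x).
have lK x v : lmul x (lmul x^-1 v) = v by exact: (pinvK (plmul x)).
have lVK x v : lmul x^-1 (lmul x v) = v by exact: (pfunK (plmul x)).
have PhiV x y : Phi x y -> Phi x^-1 y^-1.
  by rewrite -(div1g x) -(div1g y); apply: (matchD mP); exact: match1 mP.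
(* [C] is invariant under the domain of [Phi], hence the choice between [f] and the inverse of [g]
   is equivariant. *)
have CE x y w : Phi x y -> C w -> C (lmul x w).
  move=> xy [n [v [-> nv]]]; exists n, (lmul x v); rewrite (iterE _ _ y) //.
  split=> // -[u E]; apply: nv; exists (lmul y^-1 u).
  by rewrite (gE _ x^-1) ?E ?lVK //; exact: PhiV.
split=> [x y xy|w].
  apply: perms_eq => w; rewrite !permsME !tP /=; case: (pselect (C w)) => Cw.
    by rewrite (hP w).1 // (hP _).1 ?(fE _ y) //; exact: CE xy _.
  apply: gI; rewrite (gE _ x) // (hP w).2 // (hP _).2 // => Cx; apply: Cw.
  by rewrite -(lVK x w); apply: CE Cx; exact: PhiV xy.
rewrite tP; case: (pselect (C w)) => Cw; first by rewrite (hP w).1.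
by rewrite -{1}((hP w).2 Cw); apply: iff_sym; exact: gS.
Qed.

End StableLetter.

(** * Presentations over untyped words *)

(** Letters are plain numbers: words pass between presentations without casts, and the constructions
    become functions of first-order data that programs can compute. *)
Definition rword := seq (nat * bool).
Definition rpres := (nat * seq rword)%type.

Definition rinv (w : rword) : rword := rev [seq (l.1, ~~ l.2) | l <- w].
Definition shw k (w : rword) : rword := [seq (k + l.1, l.2) | l <- w].
Definition rgen (i : nat) : rword := [:: (i, false)].
Definition wf n (w : rword) := all (fun l => l.1 < n) w.
Definition wfp (p : rpres) := all (wf p.1) p.2.

Definition evalw (G : groupType) (nu : nat -> G) (w : rword) : G :=
  \prod_(l <- w) (if l.2 then (nu l.1)^-1 else nu l.1).

Section Evalw.
Variables (G : groupType) (nu : nat -> G).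

Lemma evalw_nil : evalw nu [::] = 1. Proof. by rewrite /evalw big_nil. Qed.

Lemma evalw_cons l w : evalw nu (l :: w) = (if l.2 then (nu l.1)^-1 else nu l.1) * evalw nu w.
Proof. by rewrite /evalw big_cons. Qed.

Lemma evalw_cat u v : evalw nu (u ++ v) = evalw nu u * evalw nu v.
Proof. by rewrite /evalw big_cat. Qed.

Lemma evalw_gen i : evalw nu (rgen i) = nu i.
Proof. by rewrite evalw_cons evalw_nil mulg1. Qed.

Lemma evalw_inv w : evalw nu (rinv w) = (evalw nu w)^-1.
Proof.
elim: w => [|[i b] w IHw]; first by rewrite evalw_nil invg1.
rewrite /rinv map_cons rev_cons -cats1 evalw_cat -/(rinv w) IHw.
by rewrite !evalw_cons evalw_nil mulg1 invgM /=; case: b; rewrite /= ?invgK.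
Qed.

Lemma evalw_shw k w : evalw nu (shw k w) = evalw (fun i => nu (k + i)) w.
Proof. by rewrite /evalw big_map. Qed.

Lemma hom_evalw (H : groupType) (f : G -> H) w :
  hom f -> f (evalw nu w) = evalw (f \o nu) w.
Proof.
move=> fM; rewrite /evalw (hom_prod fM); apply: eq_bigr => l _.
by case: l.2; rewrite ?(homV fM).
Qed.

Lemma evalw_subgen (T : set G) n w :
  is_subgroup T -> (forall i, i < n -> T (nu i)) -> wf n w -> T (evalw nu w).
Proof.
move=> TS Tn; elim: w => [|l w IHw] /=; first by rewrite evalw_nil => _; exact: sg1 TS.
move=> /andP[ln wn]; rewrite evalw_cons; apply: (sgM TS); last exact: IHw.
by case: l.2; [apply: (sgV TS)|]; exact: Tn.
Qed.

End Evalw.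

Lemma eq_evalw (G : groupType) (nu nu' : nat -> G) n w :
  (forall i, i < n -> nu i = nu' i) -> wf n w -> evalw nu w = evalw nu' w.
Proof.
move=> E; elim: w => [|l w IHw] /=; first by rewrite !evalw_nil.
by move=> /andP[ln wn]; rewrite !evalw_cons IHw // E.
Qed.

Lemma wf_cat n u v : wf n (u ++ v) = wf n u && wf n v.
Proof. exact: all_cat. Qed.

Lemma wf_rinv n w : wf n (rinv w) = wf n w.
Proof. by rewrite /wf /rinv all_rev all_map. Qed.

Lemma wf_shw k n w : wf (k + n) (shw k w) = wf n w.
Proof. by rewrite /wf /shw all_map; apply: eq_all => l /=; rewrite ltn_add2l. Qed.

Lemma wf_leq n m w : n <= m -> wf n w -> wf m w.
Proof. by move=> nm; apply: sub_all => l /= ln; exact: leq_trans ln nm. Qed.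

(** Letters out of range are dropped; on words satisfying [wf] nothing is lost. *)
Definition unw n (w : rword) : word n :=
  pmap (fun l => omap (fun i => (i, l.2)) (insub l.1 : option 'I_n)) w.

Definition rlet n (l : letter n) : nat * bool := (nat_of_ord l.1, l.2).

Lemma unw_raw n (w : word n) : unw n (map (@rlet n) w) = w.
Proof. by elim: w => //= -[i b] w IHw; rewrite /rlet /= valK /= IHw. Qed.

Lemma raw_unw n w : wf n w -> map (@rlet n) (unw n w) = w.
Proof.
elim: w => //= -[i b] w IHw /andP[/= ln wn].
by rewrite insubT /= IHw.
Qed.

Lemma wf_raw n (w : word n) : wf n (map (@rlet n) w).
Proof. by rewrite /wf all_map; apply/allP => -[[i ln] b] _. Qed.

Definition mkP (p : rpres) : presentation := Presentation (map (unw p.1) p.2).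
Definition grp (p : rpres) : groupType := presented (mkP p).
Definition gn (p : rpres) (i : nat) : grp p :=
  if (insub i : option 'I_(p.1)) is Some i then pgen (P := mkP p) i else 1.
Notation ev p := (evalw (gn p)).

Section Groups.
Variable p : rpres.
Implicit Types (G : groupType).

Lemma pmulE (u v : word p.1) : wclass (P := mkP p) (u ++ v) = wclass (P := mkP p) u * wclass (P := mkP p) v :> grp p.
Proof. exact: esym (pmul_wclass (P := mkP p) u v). Qed.

Lemma pinvE (u : word p.1) : wclass (P := mkP p) (winv u) = (wclass (P := mkP p) u)^-1 :> grp p.
Proof. exact: esym (pinv_wclass (P := mkP p) u). Qed.

Lemma ev_raw (w : word p.1) : ev p (map (@rlet _) w) = wclass (P := mkP p) w :> grp p.
Proof.
elim: w => [|[i b] w IHw]; first by rewrite evalw_nil.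
rewrite -cat1s pmulE -IHw /= evalw_cons /= /gn valK; congr (_ * _).
case: b => //; rewrite /pgen -pinvE //.
Qed.

Lemma ev_wclass w : wf p.1 w -> ev p w = wclass (P := mkP p) (unw p.1 w).
Proof. by move=> /raw_unw {1}<-; rewrite ev_raw. Qed.

Lemma ev_rel r : wfp p -> r \in p.2 -> ev p r = 1.
Proof.
move=> /allP pw rp; rewrite ev_wclass; last exact: pw.
by apply/(wclassP (P := mkP p)); apply: weq_relator; rewrite /= map_f.
Qed.

Lemma grp_word (x : grp p) : exists2 w, wf p.1 w & x = ev p w.
Proof.
exists (map (@rlet _) (repr x : word p.1)); first exact: wf_raw.
by rewrite ev_raw wclass_repr.
Qed.

(** Von Dyck's theorem: evaluation of words respects [weq], so it can be applied to any
    representative. *)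
Lemma grp_hom G (nu : nat -> G) : wfp p -> (forall r, r \in p.2 -> evalw nu r = 1) ->
  exists2 f : grp p -> G, hom f & forall i, i < p.1 -> f (gn p i) = nu i.
Proof.
move=> /allP pw rel; pose e (w : word p.1) := evalw nu (map (@rlet _) w).
have weqE u v : weq (P := mkP p) u v -> e u = e v.
  elim=> {u v} //=.
  - by move=> u v w _ -> _ ->.
  - by move=> u u' v v' _ E1 _ E2; rewrite /e !map_cat !evalw_cat -/(e u) -/(e v) E1 E2.
  - move=> [i b]; rewrite /e /= !evalw_cons !evalw_nil mulg1 /=.
    by case: b => /=; rewrite ?mulgV ?mulVg.
  - by move=> r /mapP[w wp ->]; rewrite /e raw_unw ?pw // rel ?evalw_nil.
have eE (w : word p.1) : e (repr (wclass (P := mkP p) w)) = e w.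
  by apply: weqE; apply/wclassP; rewrite wclass_repr.
exists (fun x : grp p => e (repr x)).
  move=> x y; rewrite -{1}(wclass_repr (P := mkP p) x) -{1}(wclass_repr (P := mkP p) y) -pmulE eE.
  by rewrite /e map_cat evalw_cat.
move=> i ip; rewrite /gn insubT /= eE /e /= -/(rgen i); exact: evalw_gen.
Qed.

Lemma grp_ind (T : set (grp p)) : is_subgroup T ->
  (forall i, i < p.1 -> T (gn p i)) -> forall x, T x.
Proof. by move=> TS Tg x; have [w ww ->] := grp_word x; exact: evalw_subgen TS Tg ww. Qed.

Lemma grp_hom_eq G (f g : grp p -> G) : hom f -> hom g ->
  (forall i, i < p.1 -> f (gn p i) = g (gn p i)) -> forall x, f x = g x.
Proof.
move=> fM gM E; apply: (grp_ind (T := [set x | f x = g x])) => //.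
apply: is_subgroupM => /= [|x|x y]; first by rewrite !hom1.
  by rewrite !homV // => ->.
by rewrite fM gM => -> ->.
Qed.

End Groups.

(** * Direct products *)

Definition comm_rel i j : rword := [:: (i, false); (j, false); (i, true); (j, true)].

Definition prodp (p q : rpres) : rpres :=
  (p.1 + q.1, p.2 ++ map (shw p.1) q.2 ++
     [seq comm_rel i (p.1 + j) | i <- iota 0 p.1, j <- iota 0 q.1]).

Lemma evalw_comm (G : groupType) (nu : nat -> G) i j :
  evalw nu (comm_rel i j) = 1 <-> nu i * nu j = nu j * nu i.
Proof.
rewrite !evalw_cons evalw_nil /= mulg1.
have -> : nu i * (nu j * ((nu i)^-1 * (nu j)^-1)) = (nu i * nu j) / (nu j * nu i).
  by rewrite invgM !mulgA.
by split=> [/divg1_eq //|->]; rewrite mulgV.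
Qed.

Lemma wfp_prodp p q : wfp p -> wfp q -> wfp (prodp p q).
Proof.
move=> pw qw; rewrite /wfp /prodp /= !all_cat; apply/and3P; split.
- by apply: sub_all pw => w; apply: wf_leq; exact: leq_addr.
- by rewrite all_map; apply: sub_all qw => w /= ?; rewrite wf_shw.
- apply/allP => w /allpairsP[[i j] /= [ip jq ->]].
  move: ip jq; rewrite !mem_iota /wf /= !add0n => ip jq.
  by rewrite ltn_add2l jq (leq_trans ip (leq_addr _ _)).
Qed.

(** Injections and projections of the direct product are packaged because each comes from a mere
    existence statement; later proofs open the package once. *)
Record prod_maps p q := ProdMaps {
  inj1 : grp p -> grp (prodp p q);
  inj2 : grp q -> grp (prodp p q);
  prj1 : grp (prodp p q) -> grp p;
  prj2 : grp (prodp p q) -> grp q;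
  inj1M : hom inj1; inj2M : hom inj2; prj1M : hom prj1; prj2M : hom prj2;
  inj1_gn : forall i, i < p.1 -> inj1 (gn p i) = gn (prodp p q) i;
  inj2_gn : forall i, i < q.1 -> inj2 (gn q i) = gn (prodp p q) (p.1 + i);
  inj_comm : forall x y, inj1 x * inj2 y = inj2 y * inj1 x;
  prj11 : forall x, prj1 (inj1 x) = x;
  prj12 : forall y, prj1 (inj2 y) = 1;
  prj21 : forall x, prj2 (inj1 x) = 1;
  prj22 : forall y, prj2 (inj2 y) = y;
  prodE : forall x, x = inj1 (prj1 x) * inj2 (prj2 x)
}.
Arguments ProdMaps {p q}.

Lemma prod_mapsP p q : wfp p -> wfp q -> inhabited (prod_maps p q).
Proof.
move=> pw qw; have pqw := wfp_prodp pw qw; set g := gn (prodp p q).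
have [i1 i1M i1g] : exists2 f : grp p -> grp (prodp p q), hom f &
    forall i, i < p.1 -> f (gn p i) = g i.
  by apply: grp_hom => // r rp; apply: ev_rel => //; rewrite /prodp /= mem_cat rp.
have [i2 i2M i2g] : exists2 f : grp q -> grp (prodp p q), hom f &
    forall i, i < q.1 -> f (gn q i) = g (p.1 + i).
  apply: grp_hom => // r rp; rewrite -evalw_shw; apply: ev_rel => //.
  by rewrite /prodp /= !mem_cat map_f ?orbT.
have gC i j : i < p.1 -> j < q.1 -> g i * g (p.1 + j) = g (p.1 + j) * g i.
  move=> ip jq; apply/evalw_comm; apply: ev_rel => //; rewrite /prodp /= !mem_cat.
  by apply/orP; right; apply/orP; right; apply/allpairsP; exists (i, j); rewrite /= !mem_iota.
have cS (G : groupType) (y : G) : is_subgroup [set x | x * y = y * x].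
  apply: is_subgroupM => [|x|x x'] /=; rewrite ?mulg1 ?mul1g // => E.
    by apply: (@mulgI _ x); rewrite mulVKg mulgA E mulgK.
  by move=> E'; rewrite -mulgA E' mulgA E mulgA.
have iC x y : i1 x * i2 y = i2 y * i1 x.
  apply: (grp_ind (p := p) (T := i1 @^-1` [set x | x * i2 y = i2 y * x])).
    exact: is_subgroup_preim.
  move=> i ip; rewrite /preimage /= i1g //; apply: esym.
  apply: (grp_ind (p := q) (T := i2 @^-1` [set y | y * g i = g i * y])).
    exact: is_subgroup_preim.
  by move=> j jq; rewrite /preimage /= i2g // gC.
pose nu1 i : grp p := if i < p.1 then gn p i else 1.
pose nu2 i : grp q := if i < p.1 then 1 else gn q (i - p.1).
have [p1 p1M p1g] : exists2 f : grp (prodp p q) -> grp p, hom f &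
    forall i, i < (prodp p q).1 -> f (g i) = nu1 i.
  apply: grp_hom => // r; rewrite /prodp /= !mem_cat => /or3P[rp|/mapP[s sq ->]|].
  - rewrite -(ev_rel pw rp); apply: (@eq_evalw _ _ _ p.1); last exact: (allP pw).
    by move=> i ip; rewrite /nu1 ip.
  - rewrite evalw_shw; apply: big1 => l _.
    by rewrite /nu1 ltnNge leq_addr /= invg1; case: l.2.
  - move=> /allpairsP[[i j] /= [ip jq ->]]; apply/evalw_comm.
    by rewrite /nu1 [p.1 + j < _]ltnNge leq_addr /= mulg1 mul1g.
have [p2 p2M p2g] : exists2 f : grp (prodp p q) -> grp q, hom f &
    forall i, i < (prodp p q).1 -> f (g i) = nu2 i.
  apply: grp_hom => // r; rewrite /prodp /= !mem_cat => /or3P[rp|/mapP[s sq ->]|].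
  - rewrite (eq_evalw (nu' := fun=> 1) _ (allP pw _ rp)); last by move=> i ip; rewrite /nu2 ip.
    by apply: big1 => l _; rewrite invg1; case: l.2.
  - rewrite evalw_shw -(ev_rel qw sq); apply: eq_evalw (allP qw _ sq) => i iq.
    by rewrite /nu2 ltnNge leq_addr /= addKn.
  - move=> /allpairsP[[i j] /= []]; rewrite !mem_iota add0n => /andP[_ ip] _ ->.
    by apply/evalw_comm; rewrite /nu2 ip mulg1 mul1g.
have lpq i : i < p.1 -> i < (prodp p q).1 by move=> ip; exact: leq_trans ip (leq_addr _ _).
have lqp i : i < q.1 -> p.1 + i < (prodp p q).1 by rewrite /= ltn_add2l.
have homc (G H : groupType) : hom (fun _ : G => 1 : H) by move=> x y; rewrite mulg1.
apply: inhabits; apply: (@ProdMaps p q i1 i2 p1 p2 i1M i2M p1M p2M i1g i2g iC).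
- apply: (grp_hom_eq (f := p1 \o i1)) => [|//|i ip]; first exact: hom_comp.
  by rewrite /= i1g // p1g ?lpq // /nu1 ip.
- apply: (grp_hom_eq (f := p1 \o i2)) => [|//|i ip]; first exact: hom_comp.
  by rewrite /= i2g // p1g ?lqp // /nu1 ltnNge leq_addr.
- apply: (grp_hom_eq (f := p2 \o i1)) => [|//|i ip]; first exact: hom_comp.
  by rewrite /= i1g // p2g ?lpq // /nu2 ip.
- apply: (grp_hom_eq (f := p2 \o i2)) => [|//|i ip]; first exact: hom_comp.
  by rewrite /= i2g // p2g ?lqp // /nu2 ltnNge leq_addr /= addKn.
- apply: (grp_hom_eq (f := id) (g := fun x => i1 (p1 x) * i2 (p2 x))) => //.
    by move=> x y; rewrite p1M p2M i1M i2M -!mulgA; congr (_ * _); rewrite !mulgA iC.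
  move=> i ipq; rewrite p1g // p2g // /nu1 /nu2; case: ltnP => ip.
    by rewrite i1g // hom1 // mulg1.
  by rewrite hom1 // mul1g i2g ?subnKC // ltn_subLR.
Qed.

(** * Presentations with stable letters *)

(** The relator of [t x = y t] for the generator [t] of number [n]: conjugation by the letter from
    the left carries [x] to [y]. *)
Definition hrel n (xy : rword * rword) : rword :=
  rgen n ++ xy.1 ++ rinv (rgen n) ++ rinv xy.2.

Fixpoint hrels n (ls : seq (seq (rword * rword))) : seq rword :=
  if ls is ps :: ls' then map (hrel n) ps ++ hrels n.+1 ls' else [::].

Definition hnnp (p : rpres) (ls : seq (seq (rword * rword))) : rpres :=
  (p.1 + size ls, p.2 ++ hrels p.1 ls).

Definition wfps n (ps : seq (rword * rword)) := all (fun xy => wf n xy.1 && wf n xy.2) ps.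

Lemma mem_hrels n ls r : r \in hrels n ls <->
  exists k xy, [/\ k < size ls, xy \in nth [::] ls k & r = hrel (n + k) xy].
Proof.
elim: ls n r => [|ps ls IHls] n r /=; first by split=> // -[k [xy []]].
rewrite mem_cat; split.
  move=> /orP[/mapP[xy xyp ->]|/IHls [k [xy [kl xyk ->]]]].
    by exists 0, xy; rewrite addn0.
  by exists k.+1, xy; rewrite addnS.
move=> [[|k] [xy [kl xyk ->]]]; apply/orP; [left|right].
  by rewrite addn0 map_f.
by apply/IHls; exists k, xy; rewrite addnS.
Qed.

Lemma evalw_hrel (G : groupType) (nu : nat -> G) n xy :
  evalw nu (hrel n xy) = 1 <-> nu n * evalw nu xy.1 = evalw nu xy.2 * nu n.
Proof.
rewrite /hrel !evalw_cat !evalw_inv evalw_gen.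
set t := nu n; set x := evalw nu _; set y := evalw nu _.
have -> : t * (x * (t^-1 * y^-1)) = (t * x) / (y * t) by rewrite invgM !mulgA.
by split=> [/divg1_eq //|->]; rewrite mulgV.
Qed.

Lemma wfp_hnnp p ls : wfp p -> all (wfps p.1) ls -> wfp (hnnp p ls).
Proof.
move=> pw lsw; rewrite /wfp /hnnp /= all_cat; apply/andP; split.
  by apply: sub_all pw => w; apply: wf_leq; exact: leq_addr.
apply/allP => w /mem_hrels[k [xy [kl xyk ->]]].
have /allP/(_ _ xyk)/andP[xw yw] := allP lsw _ (mem_nth [::] kl).
rewrite /hrel !wf_cat !wf_rinv /rgen /= ltn_add2l kl /=.
by rewrite !(wf_leq (leq_addr _ _)).
Qed.

Section Model.
Variables (p : rpres) (ls : seq (seq (rword * rword))) (M : nat -> set (grp p)).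
Variable lab : nat -> nat * nat.
Let q := hnnp p ls.

Record hnn_model := HnnModel {
  hbase : grp p -> grp q;
  hact : grp q -> perms (hnn_space (grp p));
  hbaseM : hom hbase;
  hactM : hom hact;
  hbase_gn : forall i, i < p.1 -> hbase (gn p i) = gn q i;
  hact_base : forall x, hact (hbase x) = plmul x;
  hact_letter : forall k, k < size ls -> forall w,
    in_sheet M (lab k).1 w <-> in_sheet M (lab k).2 (hact (gn q (p.1 + k)) w);
  hletter : forall k xy, k < size ls -> xy \in nth [::] ls k ->
    gn q (p.1 + k) * hbase (ev p xy.1) = hbase (ev p xy.2) * gn q (p.1 + k)
}.

Hypotheses (pw : wfp p) (lsw : all (wfps p.1) ls) (MS : forall i, is_subgroup (M i)).

(** Von Dyck's theorem for the permutations of [stable_letter]. The relators of a letter list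
    finitely many pairs, and [Phi] may be any matching that contains them. *)
Lemma hnn_modelP :
  (forall k, k < size ls -> exists2 Phi, matching M (lab k).1 (lab k).2 Phi &
     forall xy, xy \in nth [::] ls k -> Phi (ev p xy.1) (ev p xy.2)) ->
  inhabited hnn_model.
Proof.
move=> mP; have qw : wfp q by exact: wfp_hnnp.
have [t tP] : exists t : nat -> perms (hnn_space (grp p)), forall k, k < size ls ->
    (forall xy, xy \in nth [::] ls k ->
       t k * plmul (ev p xy.1) = plmul (ev p xy.2) * t k) /\
    forall w, in_sheet M (lab k).1 w <-> in_sheet M (lab k).2 (t k w).
  have [k|t tP] := @choice _ _ (fun k (t : perms (hnn_space (grp p))) => k < size ls ->
    (forall xy, xy \in nth [::] ls k ->
       t * plmul (ev p xy.1) = plmul (ev p xy.2) * t) /\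
    forall w, in_sheet M (lab k).1 w <-> in_sheet M (lab k).2 (t w)); last by exists t.
  case: (ltnP k (size ls)) => kl; last by exists 1.
  have [Phi mk Pk] := mP k kl; have [t [t1 t2]] := stable_letter MS mk.
  by exists t => _; split=> // xy /Pk; exact: t1.
have [j jM jg] : exists2 f : grp p -> grp q, hom f &
    forall i, i < p.1 -> f (gn p i) = gn q i.
  by apply: grp_hom => // r rp; apply: ev_rel; rewrite // /q /= mem_cat rp.
pose nu i := if i < p.1 then plmul (gn p i) else t (i - p.1).
have nuE w : wf p.1 w -> evalw nu w = plmul (ev p w).
  move=> ww; rewrite (hom_evalw _ _ (@plmul_hom _)); apply: eq_evalw ww => i ip.
  by rewrite /nu ip.
have nut k : nu (p.1 + k) = t k by rewrite /nu ltnNge leq_addr /= addKn.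
have [th thM thg] : exists2 f : grp q -> perms (hnn_space (grp p)), hom f &
    forall i, i < q.1 -> f (gn q i) = nu i.
  apply: grp_hom => // r; rewrite /q /= mem_cat => /orP[rp|].
    rewrite nuE ?(allP pw) // (ev_rel pw rp).
    exact: hom1 (@plmul_hom _).
  move=> /mem_hrels[k [xy [kl xyk ->]]].
  have /allP/(_ _ xyk)/andP[xw yw] := allP lsw _ (mem_nth [::] kl).
  by apply/evalw_hrel; rewrite nut !nuE // (tP k kl).1.
have lt_q k : k < size ls -> p.1 + k < q.1 by move=> kl; rewrite /q /= ltn_add2l.
apply: inhabits; apply: (@HnnModel j th jM thM jg).
- apply: (grp_hom_eq (f := th \o j)); first exact: hom_comp.
    exact: plmul_hom.
  by move=> i ip /=; rewrite jg // thg ?(leq_trans ip (leq_addr _ _)) // /nu ip.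
- by move=> k kl w; rewrite thg ?lt_q // nut; exact: (tP k kl).2.
- move=> k xy kl xyk.
  have /allP/(_ _ xyk)/andP[xw yw] := allP lsw _ (mem_nth [::] kl).
  have jE w : wf p.1 w -> j (ev p w) = ev q w.
    by move=> ww; rewrite (hom_evalw _ _ jM); apply: eq_evalw ww => i ip; exact: jg.
  rewrite !jE //; apply/evalw_hrel/ev_rel => //; rewrite /q /= mem_cat; apply/orP; right.
  by apply/mem_hrels; exists k, xy.
Qed.

Section Goes.
Variable m : hnn_model.

Lemma hbase_ev w : wf p.1 w -> hbase m (ev p w) = ev q w.
Proof.
move=> ww; rewrite (hom_evalw _ _ (hbaseM m)); apply: eq_evalw ww => i ip.
exact: hbase_gn.
Qed.

Lemma hbase_inj : injective (hbase m).
Proof.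
move=> x y /(congr1 (hact m)); rewrite !hact_base.
by move=> /(congr1 (fun f : perms (hnn_space (grp p)) => (f (1, (None, [::]))).1)); rewrite /= !mulg1.
Qed.

Definition goes i j x := forall w, in_sheet M i w <-> in_sheet M j (hact m x w).

Lemma goesM i j k x y : goes j k x -> goes i j y -> goes i k (x * y).
Proof. by move=> xP yP w; rewrite (hactM m) permsME -xP -yP. Qed.

Lemma goesV i j x : goes i j x -> goes j i x^-1.
Proof. by move=> xP w; rewrite (homV (hactM m)) xP permsVE pinvK. Qed.

Lemma goesJ i j x y : goes j j x -> goes i j y -> goes i i (y^-1 * (x * y)).
Proof. by move=> xP yP; apply: goesM (goesV yP) _; exact: goesM xP yP. Qed.

Lemma goes_loops i : is_subgroup (goes i i).
Proof.
apply: is_subgroupM => [w|x|x y]; first by rewrite (hom1 (hactM m)).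
  exact: goesV.
exact: goesM.
Qed.

(** A base element [x] moves the point [1] of sheet [i] to [x], which is on the sheet only if [x] is
    in [M i]. This bounds the generated subgroups of all later constructions from above. *)
Lemma goes_base i x : goes i i (hbase m x) <-> M i x.
Proof.
split=> [/(_ (1, (Some i, [::]))) P|Mx w].
  have /P : in_sheet M i (1, (Some i, [::])) by split=> //; exact: sg1 (MS i).
  by rewrite hact_base => -[_]; rewrite /= mulg1.
by rewrite hact_base /in_sheet /= (sgMl _ (MS i) Mx).
Qed.

Lemma goes_letter k : k < size ls -> goes (lab k).1 (lab k).2 (gn q (p.1 + k)).
Proof. by move=> kl; exact: hact_letter. Qed.

(** The relators give the commutation rule on generators; both sides are homomorphic in [z], which
    extends it to the generated subgroup. *)
Lemma hletter_gen k (Z : groupType) (S : set Z) (al be : Z -> grp p) : k < size ls -> hom al -> hom be ->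
  (forall z, S z -> exists2 xy, xy \in nth [::] ls k & al z = ev p xy.1 /\ be z = ev p xy.2) ->
  forall z, subgen S z ->
  gn q (p.1 + k) * hbase m (al z) = hbase m (be z) * gn q (p.1 + k).
Proof.
move=> kl alM beM SP z Sz; set t := gn q _.
suff : hbase m (al z) = hbase m (be z) ^ t by move=> ->; rewrite conjgE mulVKg.
apply: (@subgen_min _ S [set z | hbase m (al z) = hbase m (be z) ^ t]) Sz.
  have jM := hbaseM m; apply: is_subgroupM => /= [|x|x y].
  - by rewrite (hom1 alM) (hom1 beM) (hom1 jM) conj1g.
  - by rewrite (homV alM) (homV beM) !(homV jM) conjVg => ->.
  - by rewrite alM beM !jM conjMg => -> ->.
move=> x /SP[xy xyk [/= -> ->]]; rewrite conjgE -hletter // mulKg //.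
Qed.

End Goes.
End Model.

(** A letter commuting with [A] may join two sheets whose subgroups agree inside [A], however they
    differ elsewhere. *)
Lemma matching_id (G : groupType) (M : nat -> set G) i j (A : set G) :
  is_subgroup A -> (forall x, A x -> (M i x <-> M j x)) ->
  matching M i j (fun x y => x = y /\ A x).
Proof.
move=> AS E; split=> [|x y x' y'|x y|x y].
- by split=> //; exact: sg1 AS.
- by move=> [-> Ay] [-> Ay']; split=> //; exact: AS.2.
- by move=> [-> _].
- by move=> [-> /E].
Qed.

Definition diagp (s : seq rword) : seq (rword * rword) := [seq (x, x) | x <- s].

Lemma wfps_diagp n s : wfps n (diagp s) = all (wf n) s.
Proof. by rewrite /wfps all_map; apply: eq_all => w /=; rewrite andbb. Qed.

(** * Subgroups cut out by finitely generated subgroups of finitely presented groups *)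

(* A presentation, words for the images of given generators of a group [G], and
   words generating a subgroup; see [dfor]. *)
Definition datum := (rpres * (seq rword * seq rword))%type.

Definition dsub (d : datum) : set (grp d.1) :=
  subgen [set x | exists2 w, w \in d.2.2 & x = ev d.1 w].

Definition dwf (d : datum) : bool :=
  [&& wfp d.1, all (wf d.1.1) d.2.1 & all (wf d.1.1) d.2.2].

(** Injectivity of [f] is kept apart: data pulled back along a homomorphism that makes the [b_i]
    commute are not injective, and become so only after [interdP] with an injective datum. *)
Record dfor (G : groupType) (gg : seq G) (d : datum) (f : G -> grp d.1) (H : set G) : Prop :=
  Dfor {
    dfor_wf : dwf d;
    dfor_size : size d.2.1 = size gg;
    dforM : hom f;
    dfor_gen : forall i, i < size gg -> f (nth 1 gg i) = ev d.1 (nth [::] d.2.1 i);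
    dfor_sub : forall x, dsub (f x) <-> H x
  }.

Section Dfor.
Variables (G : groupType) (gg : seq G) (d : datum) (f : G -> grp d.1) (H : set G).
Hypothesis dP : dfor gg f H.

Lemma dfor_wfp : wfp d.1. Proof. by have /and3P[] := dfor_wf dP. Qed.
Lemma dfor_wfg : all (wf d.1.1) d.2.1. Proof. by have /and3P[] := dfor_wf dP. Qed.
Lemma dfor_wfL : all (wf d.1.1) d.2.2. Proof. by have /and3P[] := dfor_wf dP. Qed.

Lemma dfor_ker x : f x = 1 -> H x.
Proof. by move=> fx; apply/(dfor_sub dP); rewrite fx; exact: sg1 (subgenP _). Qed.

End Dfor.

Definition gens (p : rpres) : seq (grp p) := [seq gn p i | i <- iota 0 p.1].

Lemma size_gens p : size (gens p) = p.1.
Proof. by rewrite size_map size_iota. Qed.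

Lemma nth_gens p i : i < p.1 -> nth 1 (gens p) i = gn p i.
Proof. by move=> ip; rewrite (nth_map 0) ?size_iota // nth_iota. Qed.

Definition generates (G : groupType) (gg : seq G) := forall x, subgen [set` gg] x.

Lemma gens_generates p : generates (gens p).
Proof.
apply: grp_ind => // i ip; apply: subgen_in => /=.
by apply: map_f; rewrite mem_iota.
Qed.

Definition rgens n k : seq rword := [seq rgen (n + i) | i <- iota 0 k].

Lemma wf_rgens n k m : n + k <= m -> all (wf m) (rgens n k).
Proof.
move=> nkm; apply/allP => w /mapP[i]; rewrite mem_iota add0n => ik ->.
by rewrite /wf /= andbT; apply: leq_trans nkm; rewrite ltn_add2l.
Qed.

Section ProdEv.
Variables (p q : rpres) (m : prod_maps p q).

Lemma inj1_ev w : wf p.1 w -> inj1 m (ev p w) = ev (prodp p q) w.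
Proof.
by move=> ww; rewrite (hom_evalw _ _ (inj1M m)); apply: eq_evalw ww => i; exact: inj1_gn.
Qed.

Lemma inj2_ev w : wf q.1 w -> inj2 m (ev q w) = ev (prodp p q) (shw p.1 w).
Proof.
move=> ww; rewrite (hom_evalw _ _ (inj2M m)) evalw_shw; apply: eq_evalw ww => i.
exact: inj2_gn.
Qed.

Definition pairm (x : grp p) (y : grp q) := inj1 m x * inj2 m y.

Lemma pairmM x y x' y' : pairm x y * pairm x' y' = pairm (x * x') (y * y').
Proof.
by rewrite /pairm (inj1M m) (inj2M m) -!mulgA; congr (_ * _); rewrite !mulgA inj_comm.
Qed.

Lemma prj1_pair x y : prj1 m (pairm x y) = x.
Proof. by rewrite (prj1M m) prj11 prj12 mulg1. Qed.

Lemma prj2_pair x y : prj2 m (pairm x y) = y.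
Proof. by rewrite (prj2M m) prj21 prj22 mul1g. Qed.

Lemma pair_hom (G : groupType) (f : G -> grp p) (g : G -> grp q) :
  hom f -> hom g -> hom (fun x => pairm (f x) (g x)).
Proof. by move=> fM gM x y; rewrite fM gM pairmM. Qed.

Lemma pairm_prj x : pairm (prj1 m x) (prj2 m x) = x.
Proof. exact/esym/prodE. Qed.

End ProdEv.

(** Words for the diagonal map into a direct product whose second factor is numbered from [n] on. *)
Definition zipw n (u v : seq rword) : seq rword :=
  [seq nth [::] u i ++ shw n (nth [::] v i) | i <- iota 0 (size u)].

Lemma nth_zipw n u v i : i < size u ->
  nth [::] (zipw n u v) i = nth [::] u i ++ shw n (nth [::] v i).
Proof. by move=> iu; rewrite (nth_map 0) ?size_iota // nth_iota. Qed.

Lemma size_zipw n u v : size (zipw n u v) = size u.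
Proof. by rewrite size_map size_iota. Qed.

Lemma wf_nth n s i : all (wf n) s -> wf n (nth [::] s i).
Proof.
move=> sw; case: (ltnP i (size s)) => si; last by rewrite nth_default.
by apply: (allP sw); rewrite mem_nth.
Qed.

Lemma wf_zipw n k u v : all (wf n) u -> all (wf k) v -> all (wf (n + k)) (zipw n u v).
Proof.
move=> uw vw; rewrite all_map; apply/allP => i _ /=.
by rewrite wf_cat wf_shw (wf_leq (leq_addr _ _)) ?wf_nth.
Qed.

Section PairedGens.
Variables (p q : rpres) (m : prod_maps p q) (G : groupType) (gg : seq G).
Variables (f : G -> grp p) (g : G -> grp q) (u v : seq rword).
Hypotheses (fM : hom f) (gM : hom g) (su : size u = size gg) (sv : size v = size gg).
Hypotheses (uw : all (wf p.1) u) (vw : all (wf q.1) v).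
Hypothesis fE : forall i, i < size gg -> f (nth 1 gg i) = ev p (nth [::] u i).
Hypothesis gE : forall i, i < size gg -> g (nth 1 gg i) = ev q (nth [::] v i).

Lemma zipw_ev i : i < size gg ->
  pairm m (f (nth 1 gg i)) (g (nth 1 gg i)) = ev (prodp p q) (nth [::] (zipw p.1 u v) i).
Proof.
move=> ig; rewrite nth_zipw ?su ?sv // evalw_cat -(inj1_ev m) -?(inj2_ev m) ?fE ?gE //.
  by apply: (allP vw); rewrite mem_nth ?sv.
by apply: (allP uw); rewrite mem_nth ?su.
Qed.

Lemma zipw_mem w : w \in zipw p.1 u v -> exists2 x, x \in gg &
  ev (prodp p q) w = pairm m (f x) (g x).
Proof.
move=> /(nthP [::])[i]; rewrite size_zipw ?su ?sv // => ig <-.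
by exists (nth 1 gg i); rewrite ?mem_nth // zipw_ev.
Qed.

Lemma mem_zipw x : x \in gg -> exists2 w, w \in zipw p.1 u v &
  pairm m (f x) (g x) = ev (prodp p q) w.
Proof.
move=> /(nthP 1)[i ig <-]; exists (nth [::] (zipw p.1 u v) i); last by rewrite zipw_ev.
by rewrite mem_nth // size_zipw ?su ?sv.
Qed.

End PairedGens.

Definition interd (d1 d2 : datum) : datum :=
  (prodp d1.1 d2.1, (zipw d1.1.1 d1.2.1 d2.2.1, d1.2.2 ++ map (shw d1.1.1) d2.2.2)).

Section Inter.
Variables (G : groupType) (gg : seq G).
Variables (d1 d2 : datum) (f1 : G -> grp d1.1) (f2 : G -> grp d2.1) (H1 H2 : set G).
Hypotheses (D1 : dfor gg f1 H1) (D2 : dfor gg f2 H2).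

Lemma all_wf_shw n k s : all (wf k) s -> all (wf (n + k)) (map (shw n) s).
Proof. by move=> sw; rewrite all_map; apply: sub_all sw => w /=; rewrite wf_shw. Qed.

Lemma all_wf_leq n k s : n <= k -> all (wf n) s -> all (wf k) s.
Proof. by move=> nk; apply: sub_all => w; exact: wf_leq. Qed.

(** The diagonal of [K1 * K2] meets [L1 * L2] in the common part, and one injective component makes
    the diagonal map injective. *)
Lemma interdP : exists2 f : G -> grp (interd d1 d2).1,
  dfor gg f (H1 `&` H2) & injective f1 \/ injective f2 -> injective f.
Proof.
have [m] := prod_mapsP (dfor_wfp D1) (dfor_wfp D2).
exists (fun x => pairm m (f1 x) (f2 x)); last first.
  move=> fI x y E.
  have E1 := congr1 (prj1 m) E; have E2 := congr1 (prj2 m) E.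
  by rewrite !prj1_pair in E1; rewrite !prj2_pair in E2; case: fI; apply.
have s1 := dfor_size D1; have s2 := dfor_size D2.
split.
- apply/and3P; split; first by apply: wfp_prodp; [exact: dfor_wfp D1 | exact: dfor_wfp D2].
    by apply: wf_zipw; [exact: dfor_wfg D1 | exact: dfor_wfg D2].
  rewrite /= all_cat (all_wf_leq (leq_addr _ _) (dfor_wfL D1)) /=.
  exact: all_wf_shw (dfor_wfL D2).
- by rewrite /= size_zipw s1 ?s2.
- by apply: pair_hom; [exact: dforM D1 | exact: dforM D2].
- exact: (zipw_ev m s1 s2 (dfor_wfg D1) (dfor_wfg D2) (dfor_gen D1) (dfor_gen D2)).
- move=> x; split=> [Dx|[/(dfor_sub D1) x1 /(dfor_sub D2) x2]].
    have E w : w \in (interd d1 d2).2.2 ->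
        dsub (prj1 m (ev _ w)) /\ dsub (prj2 m (ev _ w)).
      rewrite mem_cat => /orP[wL|/mapP[v vL ->]].
        rewrite -(inj1_ev m) ?(allP (dfor_wfL D1)) // prj11 prj21; split; last exact: sg1 (subgenP _).
        by apply: subgen_in; exists w.
      rewrite -(inj2_ev m) ?(allP (dfor_wfL D2)) // prj12 prj22; split; first exact: sg1 (subgenP _).
      by apply: subgen_in; exists v.
    have [K1 K2] : dsub (prj1 m (pairm m (f1 x) (f2 x))) /\ dsub (prj2 m (pairm m (f1 x) (f2 x))).
      apply: (subgen_min _ _ Dx (H := [set z | dsub (prj1 m z) /\ dsub (prj2 m z)])).
        by apply: is_subgroupI; apply: is_subgroup_preim; rewrite ?/dsub //; [exact: prj1M | exact: prj2M].
      by move=> z [w wL ->]; exact: E.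
    by rewrite prj1_pair in K1; rewrite prj2_pair in K2; split; [apply/(dfor_sub D1)|apply/(dfor_sub D2)].
  apply: (sgM (subgenP _)).
    apply: (hom_subgen (inj1M m) (subgenP _) _ x1) => y [w wL ->].
    apply: subgen_in; exists w; rewrite ?mem_cat ?wL // inj1_ev //.
    exact: (allP (dfor_wfL D1)).
  apply: (hom_subgen (inj2M m) (subgenP _) _ x2) => y [w wL ->].
  apply: subgen_in; exists (shw d1.1.1 w); first by rewrite mem_cat map_f ?orbT.
  by rewrite inj2_ev //; exact: (allP (dfor_wfL D2)).
Qed.

End Inter.

(** * Images and joins *)

Definition ijd (q : rpres) (phi S : seq rword) (d : datum) : datum :=
  let n := d.1.1 in let b := prodp d.1 q in
  let gam := zipw n d.2.1 phi in
  let path := rgen (b.1 + 1) ++ rgen b.1 in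
  (hnnp b [:: diagp gam; diagp (d.2.2 ++ rgens n q.1)],
   (rgens n q.1,
    rgens 0 n ++ [seq rinv path ++ g ++ path | g <- gam] ++ map (shw n) S)).

Lemma mem_diagp xy s : xy \in diagp s -> xy.1 \in s /\ xy.2 = xy.1.
Proof. by move=> /mapP[w ws ->]. Qed.

Lemma diag_mem w s : w \in s -> (w, w) \in diagp s.
Proof. exact: map_f. Qed.

Lemma mem_rgens w n k : w \in rgens n k <-> exists2 i, i < k & w = rgen (n + i).
Proof.
split=> [/mapP[i]|[i ik ->]]; last by apply: map_f; rewrite mem_iota.
by rewrite mem_iota => /andP[_ ik] ->; exists i.
Qed.

(* With base [K * G'], where [K] and [L] come from a datum for [H], the letter of
   index 0 commutes with the graph of [(f, h)] and the letter of index 1 commutes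
   with [L * G']. *)
Section ImageJoin.
Variables (G : groupType) (gg : seq G) (d : datum) (f : G -> grp d.1) (H : set G).
Hypotheses (ggen : generates gg) (D : dfor gg f H).
Variables (q : rpres) (phi S : seq rword) (h : G -> grp q).
Hypotheses (qw : wfp q) (phiw : all (wf q.1) phi) (Sw : all (wf q.1) S).
Hypotheses (sphi : size phi = size gg) (hM : hom h).
Hypothesis hE : forall i, i < size gg -> h (nth 1 gg i) = ev q (nth [::] phi i).

Let J : set (grp q) := subgen ((h @` H) `|` [set x | exists2 w, w \in S & x = ev q w]).

(** For [x] in [H] the path [t1 t0] commutes with the graph point [gam x]; the conjugate is then
    [gam x] itself, and a factor from [K] leaves [h x]. For other [x] the conjugate is a new
    element, which the sheets keep from enlarging [J]. *)
Lemma ijdP : exists2 f' : grp q -> grp (ijd q phi S d).1,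
  dfor (gens q) f' J & injective f'.
Proof.
have pw := dfor_wfp D; have fM := dforM D; have s1 := dfor_size D; have gw := dfor_wfg D.
have Lw := dfor_wfL D.
have [m] := prod_mapsP pw qw; pose b := prodp d.1 q.
pose gam x := pairm m (f x) (h x); have gamM : hom gam by exact: pair_hom.
have JS : is_subgroup J by exact: subgenP.
(* Sheets 0 and 1 agree on the graph, on which [t0] acts; sheets 1 and 2 agree on [L * G'], on which
   [t1] acts, since a graph point there lies over [H] and has its second coordinate in [J]. *)
pose M i : set (grp b) := if i is 0 then [set g | J (prj2 m g)] else
  if i is 1 then [set g | J (prj2 m g) /\ range gam g] else
  if i is 2 then range gam else setT.
have MS i : is_subgroup (M i).
  case: i => [|[|[|i]]] //=.
  - by apply: is_subgroup_preim => //; exact: prj2M.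
  - apply: is_subgroupI; first by apply: is_subgroup_preim => //; exact: prj2M.
    exact: is_subgroup_im.
  - exact: is_subgroup_im.
pose ls := [:: diagp (zipw d.1.1 d.2.1 phi); diagp (d.2.2 ++ rgens d.1.1 q.1)].
have zw : all (wf b.1) (zipw d.1.1 d.2.1 phi) by exact: wf_zipw.
have rw : all (wf b.1) (rgens d.1.1 q.1) by apply: wf_rgens.
have lsw : all (wfps b.1) ls.
  by rewrite /= !wfps_diagp zw all_cat rw (all_wf_leq (leq_addr _ _) Lw).
have rE i : i < q.1 -> ev b (rgen (d.1.1 + i)) = inj2 m (gn q i).
  by move=> iq; rewrite evalw_gen inj2_gn.
pose A := [set g | dsub (prj1 m g)].
have AS : is_subgroup A by apply: is_subgroup_preim; [exact: prj1M | exact: subgenP].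
have LA w : w \in d.2.2 ++ rgens d.1.1 q.1 -> A (ev b w).
  rewrite mem_cat => /orP[wL|/mem_rgens[i iq ->]].
    rewrite /A /= -(inj1_ev m) ?(allP Lw) // prj11.
    by apply: subgen_in; exists w.
  by rewrite rE // /A /= prj12; exact: sg1 (subgenP _).
have [k kl|mo] := @hnn_modelP b ls M (fun k => (k, k.+1)) (wfp_prodp pw qw) lsw MS.
  case: k kl => [|[|//]] _ /=.
  - exists (fun x y => x = y /\ range gam x).
      by apply: matching_id => [|x rx]; [exact: is_subgroup_im | split=> // -[]].
    move=> xy /mem_diagp[zx ->]; split=> //.
    by have [x _ ->] := zipw_mem m s1 sphi gw phiw (dfor_gen D) hE zx; exists x.
  - exists (fun x y => x = y /\ A x).
      apply: matching_id => // x Ax; split=> [[]//|rx]; split=> //.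
      move: Ax rx => /[swap] -[y _ <-]; rewrite /A /= prj1_pair prj2_pair => /(dfor_sub D) Hy.
      by apply: subgen_in; left; exists y.
    by move=> xy /mem_diagp[/LA ? ->].
set q' := hnnp b ls in mo *.
pose j := hbase mo; have jM : hom j by exact: hbaseM.
pose f' y := j (inj2 m y); have f'M : hom f' by exact: hom_comp (inj2M m) jM.
have inj2_inj : injective (inj2 m) by move=> x y /(congr1 (prj2 m)); rewrite !prj22.
have f'I : injective f' by move=> x y /hbase_inj; exact: inj2_inj.
pose t0 := gn q' b.1; pose t1 := gn q' (b.1 + 1).
have jE w : wf b.1 w -> ev q' w = j (ev b w) by move=> ww; rewrite /j hbase_ev.
have jgE i : i < q.1 -> gn q' (d.1.1 + i) = f' (gn q i).
  by move=> iq; rewrite -(hbase_gn mo) ?ltn_add2l // /f' inj2_gn.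
pose T := @dsub (ijd q phi S d); have TS : is_subgroup T by exact: subgenP.
have [pth [LE b0 pathE]] : exists pth, [/\ (ijd q phi S d).2.2 = rgens 0 d.1.1 ++
    [seq rinv pth ++ g ++ pth | g <- zipw d.1.1 d.2.1 phi] ++ map (shw d.1.1) S,
    wf (b.1 + 2) pth & ev q' pth = t1 * t0].
  exists (rgen (b.1 + 1) ++ rgen b.1); split=> //; last by rewrite evalw_cat !evalw_gen.
  by rewrite /wf /= !andbT; lia.
exists f' => //; split.
- apply/and3P; split; first by apply: wfp_hnnp => //; exact: wfp_prodp.
    by apply: (all_wf_leq (leq_addr _ _)).
  rewrite LE !all_cat; apply/and3P; split.
  - by apply: wf_rgens; rewrite /=; lia.
  - rewrite all_map; apply: sub_all zw => w ww; rewrite /preim inE.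
    by rewrite !wf_cat wf_rinv b0 (wf_leq (leq_addr _ _) ww).
  - by apply: (all_wf_leq (leq_addr _ _)); exact: all_wf_shw.
- by rewrite size_gens size_map size_iota.
- exact: f'M.
- move=> i; rewrite size_gens => iq; rewrite nth_gens //= (nth_map 0) ?size_iota //.
  by rewrite nth_iota // evalw_gen -jgE.
move=> y; split=> [Ty|].
  have : M 0 (inj2 m y).
    apply/(goes_base MS mo); apply: (subgen_min (goes_loops mo 0) _ Ty) => z [w + ->].
    rewrite LE !mem_cat => /or3P[/mem_rgens[i ip ->]|/mapP[g gz ->]|/mapP[v vS ->]].
    - rewrite evalw_gen add0n -(hbase_gn mo) ?(leq_trans ip (leq_addr _ _)) //.
      apply/goes_base => //; rewrite -(inj1_gn m) // /M /= prj21; exact: sg1 JS.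
    - rewrite evalw_cat evalw_inv evalw_cat pathE; apply: (goesJ (j := 2)).
        rewrite jE ?(allP zw) //; apply/goes_base => //.
        by have [x _ ->] := zipw_mem m s1 sphi gw phiw (dfor_gen D) hE gz; exists x.
      apply: (goesM (j := 1)); first exact: (goes_letter mo (k := 1)).
      by have := goes_letter mo (k := 0) isT; rewrite addn0.
    - rewrite jE; last by apply: (allP (all_wf_shw _ Sw)); rewrite map_f.
      apply/goes_base => //; rewrite -(inj2_ev m) ?(allP Sw) // /M /= prj22.
      by apply: subgen_in; right; exists v.
  by rewrite /M /= prj22.
have c0 x : t0 * j (gam x) = j (gam x) * t0.
  rewrite /t0 -[b.1]addn0; apply: (hletter_gen mo (k := 0) isT gamM gamM _ (ggen x)) => z /= zg.
  have [w wz E] := mem_zipw m s1 sphi gw phiw (dfor_gen D) hE zg.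
  by exists (w, w); [exact: diag_mem | rewrite /= /gam E].
have c1 x : dsub x -> t1 * j (inj1 m x) = j (inj1 m x) * t1.
  move=> Lx; apply: (hletter_gen mo (k := 1) isT (inj1M m) (inj1M m) _ Lx) => z [w wL ->].
  exists (w, w); first by apply: diag_mem; rewrite mem_cat wL.
  by rewrite inj1_ev // (allP Lw).
have c2 x : t1 * j (inj2 m x) = j (inj2 m x) * t1.
  apply: (hletter_gen mo (k := 1) isT (inj2M m) (inj2M m) _ (@gens_generates q x)).
  move=> z /mapP[i]; rewrite mem_iota => iq ->.
  exists (rgen (d.1.1 + i), rgen (d.1.1 + i)); last by rewrite rE.
  apply: diag_mem; rewrite mem_cat; apply/orP; right.
  by apply/mem_rgens; exists i.
have T1 x : T (j (inj1 m x)).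
  apply: (grp_ind (T := (j \o inj1 m) @^-1` T)).
    by apply: is_subgroup_preim => //; exact: hom_comp (inj1M m) jM.
  move=> i ip; rewrite /preimage /= inj1_gn // /j hbase_gn ?(leq_trans ip (leq_addr _ _)) //.
  apply: subgen_in; exists (rgen i); last by rewrite evalw_gen.
  by rewrite LE !mem_cat; apply/orP; left; apply/mem_rgens; exists i.
have T2 x : T ((t1 * t0)^-1 * (j (gam x) * (t1 * t0))).
  have := @hom_subgen _ _ (fun x => j (gam x) ^ (t1 * t0)) [set` gg] T x.
  apply=> // [u v|u ug]; first by rewrite gamM jM conjMg.
  rewrite /= conjgE; have [w wz E] := mem_zipw m s1 sphi gw phiw (dfor_gen D) hE ug.
  apply: subgen_in; exists (rinv pth ++ w ++ pth).
    rewrite LE !mem_cat; apply/orP; right; apply/orP; left.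
    by apply/mapP; exists w.
  by rewrite evalw_cat evalw_inv evalw_cat pathE jE ?(allP zw) // -E.
apply: (hom_subgen f'M TS) => {}y [[x Hx <-]|[w wS ->]].
  have := T2 x; have -> : (t1 * t0)^-1 * (j (gam x) * (t1 * t0)) = j (gam x).
    have {}c1 := c1 _ (proj2 (dfor_sub D x) Hx).
    have c3 : t1 * j (gam x) = j (gam x) * t1.
      by rewrite /gam /pairm jM mulgA c1 -mulgA c2 mulgA.
    have -> : j (gam x) * (t1 * t0) = (t1 * t0) * j (gam x).
      by rewrite mulgA -c3 -mulgA -c0 mulgA.
    by rewrite mulKg.
  by rewrite /gam /pairm jM => /(sgMl _ TS (T1 (f x))).
apply: subgen_in; exists (shw d.1.1 w); first by rewrite LE !mem_cat map_f ?orbT.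
rewrite jE; last by apply: (allP (all_wf_shw _ Sw)); rewrite map_f.
by rewrite -(inj2_ev m) // (allP Sw).
Qed.

End ImageJoin.

Definition joind (d1 d2 : datum) : datum :=
  let n := d1.1.1 in let b := prodp d1.1 d2.1 in
  let gam := zipw n d1.2.1 d2.2.1 in
  (hnnp b [:: diagp (d1.2.2 ++ rgens n d2.1.1); diagp (rgens 0 n ++ map (shw n) d2.2.2)],
   (gam, [seq rinv (rgen b.1) ++ g ++ rgen b.1 | g <- gam] ++
         [seq rinv (rgen b.1.+1) ++ g ++ rgen b.1.+1 | g <- gam])).

(* In the base [K1 * K2] the two letters commute with [L1 * K2] and [K1 * L2];
   they conjugate the graph of the embeddings to subgroups meeting it in [H1], [H2]. *)
Section Join.
Variables (G : groupType) (gg : seq G).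
Variables (d1 d2 : datum) (f1 : G -> grp d1.1) (f2 : G -> grp d2.1) (H1 H2 : set G).
Hypotheses (ggen : generates gg) (D1 : dfor gg f1 H1) (D2 : dfor gg f2 H2).

Let J : set G := subgen (H1 `|` H2).

Lemma joindP : exists2 f : G -> grp (joind d1 d2).1,
  dfor gg f J & injective f1 \/ injective f2 -> injective f.
Proof.
have p1w := dfor_wfp D1; have p2w := dfor_wfp D2.
have s1 := dfor_size D1; have s2 := dfor_size D2.
have g1w := dfor_wfg D1; have g2w := dfor_wfg D2.
have L1w := dfor_wfL D1; have L2w := dfor_wfL D2.
have e1 := dfor_gen D1; have e2 := dfor_gen D2.
have [m] := prod_mapsP p1w p2w; set n := d1.1.1; set b := prodp d1.1 d2.1.
pose gam x := pairm m (f1 x) (f2 x).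
have gamM : hom gam by apply: pair_hom; [exact: dforM D1 | exact: dforM D2].
have JS : is_subgroup J by exact: subgenP.
(* Both letters lead from sheet 0 to sheet 1. On [L1 * K2] the graph reduces to points over [H1], on
   [K1 * L2] to points over [H2], and these belong to both sheets. *)
pose M i : set (grp b) := if i is 0 then gam @` J else
  if i is 1 then range gam else setT.
have MS i : is_subgroup (M i).
  by case: i => [|[|i]] //=; exact: is_subgroup_im.
pose ls := [:: diagp (d1.2.2 ++ rgens n d2.1.1); diagp (rgens 0 n ++ map (shw n) d2.2.2)].
have zw : all (wf b.1) (zipw n d1.2.1 d2.2.1) by exact: wf_zipw.
have r1w : all (wf b.1) (rgens n d2.1.1) by apply: wf_rgens.
have r0w : all (wf b.1) (rgens 0 n) by apply: wf_rgens; exact: leq_addr.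
have lsw : all (wfps b.1) ls.
  by rewrite /= !wfps_diagp !all_cat r1w r0w (all_wf_leq (leq_addr _ _) L1w) all_wf_shw.
have rE i : i < d2.1.1 -> ev b (rgen (n + i)) = inj2 m (gn d2.1 i).
  by move=> iq; rewrite evalw_gen inj2_gn.
have r0E i : i < n -> ev b (rgen (0 + i)) = inj1 m (gn d1.1 i).
  by move=> iq; rewrite evalw_gen inj1_gn.
pose A1 := [set g | dsub (prj1 m g)]; pose A2 := [set g | dsub (prj2 m g)].
have A1S : is_subgroup A1 by apply: is_subgroup_preim; [exact: prj1M | exact: subgenP].
have A2S : is_subgroup A2 by apply: is_subgroup_preim; [exact: prj2M | exact: subgenP].
have LA1 w : w \in d1.2.2 ++ rgens n d2.1.1 -> A1 (ev b w).
  rewrite mem_cat => /orP[wL|/mem_rgens[i iq ->]].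
    rewrite /A1 /= -(inj1_ev m) ?(allP L1w) // prj11.
    by apply: subgen_in; exists w.
  by rewrite rE // /A1 /= prj12; exact: sg1 (subgenP _).
have LA2 w : w \in rgens 0 n ++ map (shw n) d2.2.2 -> A2 (ev b w).
  rewrite mem_cat => /orP[/mem_rgens[i iq ->]|/mapP[v vL ->]].
    by rewrite r0E // /A2 /= prj21; exact: sg1 (subgenP _).
  rewrite /A2 /= -(inj2_ev m) ?(allP L2w) // prj22.
  by apply: subgen_in; exists v.
(* [gam] may fail to be injective, but two points with the same image differ by an element of the
   kernel of [f1], which lies in [H1]. *)
have Jgam x : M 0 (gam x) <-> J x.
  split=> [[y Jy E]|Jx]; last by exists x.
  have {E} : f1 x = f1 y.
    by have := congr1 (prj1 m) E; rewrite !prj1_pair.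
  move=> E; rewrite -[x](@divgK _ y); apply: (sgM JS) => //; apply: subgen_in; left.
  apply: (dfor_ker D1); rewrite (dforM D1) (homV (dforM D1)) E mulgV //.
have M0r x : M 0 x -> range gam x by move=> [y _ <-]; exists y.
have [k kl|mo] := @hnn_modelP b ls M (fun k => (0%N, 1%N)) (wfp_prodp p1w p2w) lsw MS.
  case: k kl => [|[|//]] _ /=.
  - exists (fun x y => x = y /\ A1 x).
      apply: matching_id => // x Ax; split=> [/M0r//|rx].
      move: Ax rx => /[swap] -[y _ <-]; rewrite /A1 /= prj1_pair => /(dfor_sub D1) Hy.
      by apply: (proj2 (Jgam y)); apply: subgen_in; left.
    by move=> xy /mem_diagp[/LA1 ? ->].
  - exists (fun x y => x = y /\ A2 x).
      apply: matching_id => // x Ax; split=> [/M0r//|rx].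
      move: Ax rx => /[swap] -[y _ <-]; rewrite /A2 /= prj2_pair => /(dfor_sub D2) Hy.
      by apply: (proj2 (Jgam y)); apply: subgen_in; right.
    by move=> xy /mem_diagp[/LA2 ? ->].
set q' := hnnp b ls in mo *.
pose j := hbase mo; have jM : hom j by exact: hbaseM.
pose f' x := j (gam x); have f'M : hom f' by exact: hom_comp gamM jM.
pose t k := gn q' (b.1 + k).
have jE w : wf b.1 w -> ev q' w = j (ev b w) by move=> ww; rewrite /j hbase_ev.
pose T := @dsub (joind d1 d2); have TS : is_subgroup T by exact: subgenP.
have LE : (joind d1 d2).2.2 =
    [seq rinv (rgen (b.1 + 0)) ++ g ++ rgen (b.1 + 0) | g <- zipw n d1.2.1 d2.2.1] ++
    [seq rinv (rgen (b.1 + 1)) ++ g ++ rgen (b.1 + 1) | g <- zipw n d1.2.1 d2.2.1].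
  by rewrite addn0 addn1.
have LP w : w \in (joind d1 d2).2.2 <-> exists k g, [/\ k < 2, g \in zipw n d1.2.1 d2.2.1
    & w = rinv (rgen (b.1 + k)) ++ g ++ rgen (b.1 + k)].
  rewrite LE mem_cat; split=> [/orP[] /mapP[g gz ->]|[k [g [k2 gz ->]]]].
  - by exists 0, g.
  - by exists 1%N, g.
  case: k k2 => [|[|//]] _.
    by rewrite (map_f (fun g => rinv (rgen (b.1 + 0)) ++ g ++ _)).
  by rewrite (map_f (fun g => rinv (rgen (b.1 + 1)) ++ g ++ _)) ?orbT.
exists f'; last first.
  move=> fI x y /hbase_inj E.
  have E1 := congr1 (prj1 m) E; have E2 := congr1 (prj2 m) E.
  by rewrite !prj1_pair in E1; rewrite !prj2_pair in E2; case: fI; apply.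
split.
- apply/and3P; split; first by apply: wfp_hnnp => //; exact: wfp_prodp.
    by apply: (all_wf_leq (leq_addr _ _)).
  apply/allP => w /LP[k [g [k2 gz ->]]]; rewrite !wf_cat wf_rinv /wf /= !andbT ltn_add2l k2 /= andbT.
  by apply: (wf_leq (leq_addr _ _)); exact: (allP zw).
- by rewrite /= size_zipw s1 ?s2.
- exact: f'M.
- move=> i ig; rewrite /f' /gam (zipw_ev m s1 s2 g1w g2w e1 e2) //.
  rewrite -jE //; apply: (allP zw); apply: mem_nth; by rewrite size_zipw s1 ?s2.
move=> x; split=> [Tx|].
  apply/Jgam/(goes_base MS mo); apply: (subgen_min (goes_loops mo 0) _ Tx).
  move=> z [w /LP[k [g [k2 gz ->]]] ->].
  rewrite evalw_cat evalw_inv evalw_cat evalw_gen; apply: (goesJ (j := 1)).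
    rewrite jE ?(allP zw) //; apply/goes_base => //.
    by have [y _ ->] := zipw_mem m s1 s2 g1w g2w e1 e2 gz; exists y.
  exact: (goes_letter mo (k := k)).
have Tt k y : k < 2 -> T ((t k)^-1 * (j (gam y) * t k)).
  move=> k2; have := @hom_subgen _ _ (fun x => j (gam x) ^ t k) [set` gg] T y.
  apply=> // [u v|u ug]; first by rewrite gamM jM conjMg.
  rewrite /= conjgE; have [w wz E] := mem_zipw m s1 s2 g1w g2w e1 e2 ug.
  apply: subgen_in; exists (rinv (rgen (b.1 + k)) ++ w ++ rgen (b.1 + k)).
    by apply/LP; exists k, w.
  by rewrite evalw_cat evalw_inv evalw_cat evalw_gen jE ?(allP zw) // -E.
have c1 y : dsub y -> t 0 * j (inj1 m y) = j (inj1 m y) * t 0.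
  move=> Ly; apply: (hletter_gen mo (k := 0) isT (inj1M m) (inj1M m) _ Ly) => z [w wL ->].
  exists (w, w); first by apply: diag_mem; rewrite mem_cat wL.
  by rewrite inj1_ev // (allP L1w).
have c2 y : t 0 * j (inj2 m y) = j (inj2 m y) * t 0.
  apply: (hletter_gen mo (k := 0) isT (inj2M m) (inj2M m) _ (@gens_generates _ y)).
  move=> z /mapP[i]; rewrite mem_iota => iq ->.
  exists (rgen (n + i), rgen (n + i)); last by rewrite rE.
  by apply: diag_mem; rewrite mem_cat; apply/orP; right; apply/mem_rgens; exists i.
have c3 y : t 1%N * j (inj1 m y) = j (inj1 m y) * t 1%N.
  apply: (hletter_gen mo (k := 1%N) isT (inj1M m) (inj1M m) _ (@gens_generates _ y)).
  move=> z /mapP[i]; rewrite mem_iota => iq ->.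
  exists (rgen (0 + i), rgen (0 + i)); last by rewrite r0E.
  by apply: diag_mem; rewrite mem_cat; apply/orP; left; apply/mem_rgens; exists i.
have c4 y : dsub y -> t 1%N * j (inj2 m y) = j (inj2 m y) * t 1%N.
  move=> Ly; apply: (hletter_gen mo (k := 1%N) isT (inj2M m) (inj2M m) _ Ly) => z [w wL ->].
  exists (shw n w, shw n w); first by apply: diag_mem; rewrite mem_cat map_f ?orbT.
  by rewrite inj2_ev // (allP L2w).
have Tk k y : k < 2 -> t k * j (inj1 m (f1 y)) = j (inj1 m (f1 y)) * t k ->
    t k * j (inj2 m (f2 y)) = j (inj2 m (f2 y)) * t k -> T (j (gam y)).
  move=> k2 cx cy; have := Tt k y k2.
  have -> : j (gam y) * t k = t k * j (gam y); last by rewrite mulKg.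
  by rewrite /gam /pairm jM mulgA cx -mulgA -cy mulgA.
apply: (hom_subgen f'M TS) => y [/(dfor_sub D1)|/(dfor_sub D2)] Hy.
  by apply: (Tk 0); [|exact: c1 | exact: c2].
by apply: (Tk 1%N); [|exact: c3 | exact: c4].
Qed.

End Join.

Definition substw (gs : seq rword) (w : rword) : rword :=
  flatten [seq if l.2 then rinv (nth [::] gs l.1) else nth [::] gs l.1 | l <- w].

Lemma evalw_substw (G : groupType) (nu : nat -> G) gs w :
  evalw nu (substw gs w) = evalw (fun i => evalw nu (nth [::] gs i)) w.
Proof.
elim: w => [|l w IHw]; first by rewrite !evalw_nil.
by rewrite /substw /= evalw_cat -/(substw gs w) IHw evalw_cons; case: l.2; rewrite ?evalw_inv.
Qed.

Lemma wf_substw n gs w : all (wf n) gs -> wf n (substw gs w).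
Proof.
move=> gw; elim: w => [|l w IHw] //; rewrite /substw /= wf_cat -/(substw gs w) IHw andbT.
have nw i : wf n (nth [::] gs i).
  by case: (ltnP i (size gs)) => ig; [exact: (allP gw _ (mem_nth _ ig)) | rewrite nth_default].
by case: l.2; rewrite ?wf_rinv.
Qed.

Definition pulld (ss : seq rword) (d : datum) : datum :=
  (d.1, ([seq substw d.2.1 w | w <- ss], d.2.2)).

Lemma pulldP (G G' : groupType) (gg : seq G) (gg' : seq G') (k : G' -> G) (ss : seq rword)
    d (f : G -> grp d.1) (H : set G) :
  dfor gg f H -> hom k -> size ss = size gg' ->
  (forall i, i < size gg' -> wf (size gg) (nth [::] ss i) /\
     k (nth 1 gg' i) = evalw (nth 1 gg) (nth [::] ss i)) ->
  @dfor G' gg' (pulld ss d) (f \o k) (k @^-1` H).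
Proof.
move=> D kM sss kE; have gw := dfor_wfg D; split.
- apply/and3P; split; [exact: dfor_wfp D | | exact: dfor_wfL D].
  by rewrite all_map; apply/allP => w _; exact: wf_substw.
- by rewrite /= size_map.
- exact: hom_comp (dforM D).
- move=> i ig; have [w1 w2] := kE i ig.
  rewrite /= (nth_map [::]) ?sss // w2 (hom_evalw _ _ (dforM D)) evalw_substw.
  by apply: eq_evalw w1 => l lg; exact: dfor_gen D _ lg.
- by move=> x; exact: dfor_sub D (k x).
Qed.

Import Order.TTheory GRing.Theory Num.Theory.

(** * Free products with an infinite cyclic group *)

(** The free product of [Q] and an infinite cyclic group through its mapping property: this covers
    both [F3] over the group of [b] and [c] and the presentations [freep]. *)
Definition free_with (Q G : groupType) (iota : Q -> G) (a : G) : Prop :=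
  hom iota /\ forall (H : groupType) (h : Q -> H) (x : H), hom h ->
    exists k : G -> H, [/\ hom k, k a = x & forall q, k (iota q) = h q].

Definition freep (q : rpres) : rpres := (q.1.+1, q.2).

Lemma wfp_freep q : wfp q -> wfp (freep q).
Proof. by apply: sub_all => w; apply: wf_leq; exact: leqnSn. Qed.

Lemma freep_free q : wfp q -> exists2 iota : grp q -> grp (freep q),
  free_with iota (gn (freep q) q.1) & forall i, i < q.1 -> iota (gn q i) = gn (freep q) i.
Proof.
move=> qw; have fw := wfp_freep qw.
have [i iM ig] : exists2 f : grp q -> grp (freep q), hom f &
    forall i, i < q.1 -> f (gn q i) = gn (freep q) i.
  by apply: grp_hom => // r rq; exact: ev_rel.
exists i => //; split=> // H h x hM.
have [r rq|k kM kg] := @grp_hom (freep q) H (fun j => if j < q.1 then h (gn q j) else x) fw.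
  rewrite (@eq_evalw _ _ (h \o gn q) q.1) ?(allP qw) //.
    by rewrite -(hom_evalw _ _ hM) (ev_rel qw rq) hom1.
  by move=> j ->.
exists k; split=> //; first by rewrite kg ?ltnn //=.
apply: (grp_hom_eq (f := k \o i)) => [|//|j jq]; first exact: hom_comp.
by rewrite /= ig // kg ?jq //= ltnS ltnW.
Qed.

Definition F2 : groupType := grp (2, [::]).
Definition fb : F2 := gn (2, [::]) 0.
Definition fc : F2 := gn (2, [::]) 1.

Lemma gn_F3 : [/\ gn (3, [::]) 0 = a3, gn (3, [::]) 1 = b3 & gn (3, [::]) 2 = c3].
Proof.
rewrite /gn; split; case: insubP => //= u _ Eu;
  by congr (wclass (P := free_pres 3) [:: (_, _)]); apply: val_inj.
Qed.

Lemma F3_hom (H : groupType) (x y z : H) :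
  exists k : F3 -> H, [/\ hom k, k a3 = x, k b3 = y & k c3 = z].
Proof.
have [ga gb gc] := gn_F3.
have [//|k kM kg] := @grp_hom (3, [::]) H (nth z [:: x; y]) isT.
by exists k; split=> //; rewrite -?ga -?gb -?gc kg.
Qed.

Lemma F3_ind (T : set F3) : is_subgroup T -> T a3 -> T b3 -> T c3 -> forall x, T x.
Proof.
have [ga gb gc] := gn_F3 => TS Ta Tb Tc.
by apply: (@grp_ind (3, [::])) => // -[|[|[|//]]] _; rewrite ?ga ?gb ?gc.
Qed.

Lemma F3_gen z : subgen [set` [:: a3; b3; c3]] z.
Proof. by move: z; apply: F3_ind => //; apply: subgen_in; rewrite /= !inE eqxx ?orbT. Qed.

Lemma F2_hom (H : groupType) (y z : H) :
  exists k : F2 -> H, [/\ hom k, k fb = y & k fc = z].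
Proof.
have [//|k kM kg] := @grp_hom (2, [::]) H (nth z [:: y]) isT.
by exists k; split=> //; rewrite kg.
Qed.

Lemma F2_ind (T : set F2) : is_subgroup T -> T fb -> T fc -> forall x, T x.
Proof. by move=> TS Tb Tc; apply: (@grp_ind (2, [::])) => // -[|[|//]] _. Qed.

Lemma F3_free : exists iota : F2 -> F3,
  [/\ free_with iota a3, iota fb = b3 & iota fc = c3].
Proof.
have [i [iM ib ic]] := F2_hom b3 c3; exists i; split=> //; split=> // H h x hM.
have [k [kM ka kb kc]] := F3_hom x (h fb) (h fc); exists k; split=> //.
move=> q; apply: (F2_ind (T := [set q | k (i q) = h q])); rewrite /= ?ib ?ic //.
apply: is_subgroupM => /= [|u|u v]; first by rewrite !hom1.
  by rewrite !homV // => ->.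
by rewrite iM kM hM => -> ->.
Qed.

Section FreeWith.
Variables (Q G : groupType) (iota : Q -> G) (a : G).
Hypothesis free : free_with iota a.
Let iM : hom iota := free.1.

Definition Nsub (R : set Q) : set G := subgen [set a ^ iota q | q in R].

Definition Msub (R Lam : set Q) : set G :=
  [set x | exists n lam, [/\ Nsub R n, Lam lam & x = n * iota lam]].

Lemma Nsub_in (R : set Q) q : R q -> Nsub R (a ^ iota q).
Proof. by move=> Rq; apply: subgen_in; exists q. Qed.

Lemma NsubS (R R' : set Q) : R `<=` R' -> Nsub R `<=` Nsub R'.
Proof. by move=> RR'; apply: subgenS => _ [q Rq <-]; exists q => //; exact: RR'. Qed.

Lemma Nsub_conj R n q : Nsub R n -> Nsub [set r | exists2 r', R r' & r = r' * q] (n ^ iota q).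
Proof.
apply: (@hom_subgen _ _ (conjg^~ (iota q))) => [x y||_ [r Rr <-]]; first exact: conjMg.
  exact: subgenP.
by rewrite -conjgM -iM; apply: Nsub_in; exists r.
Qed.

Lemma Nsub_Msub (R Lam : set Q) : Lam 1 -> Nsub R `<=` Msub R Lam.
Proof. by move=> L1 n Rn; exists n, 1; rewrite (hom1 iM) mulg1. Qed.

Lemma Msub_lam (R Lam : set Q) q : Lam q -> Msub R Lam (iota q).
Proof. by move=> Lq; exists 1, q; rewrite mul1g; split=> //; exact: sg1 (subgenP _). Qed.

(** Invariance of [R] under right translation by [Lam] makes [iota Lam] normalise [Nsub R]. *)
Lemma Msub_subgroup (R Lam : set Q) : is_subgroup Lam ->
  (forall r q, R r -> Lam q -> R (r * q)) -> is_subgroup (Msub R Lam).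
Proof.
move=> LS RL.
have cj n q : Nsub R n -> Lam q -> Nsub R (n ^ iota q).
  move=> Rn Lq; have := Nsub_conj (q := q) Rn.
  by apply: NsubS => _ [r Rr ->]; exact: RL.
have NS := subgenP [set a ^ iota q | q in R].
apply: is_subgroupM => [|_ [n [q [Rn Lq ->]]]|_ _ [n [q [Rn Lq ->]]] [n' [q' [Rn' Lq' ->]]]].
- by apply: Nsub_Msub; [exact: sg1 LS | exact: sg1 NS].
- exists (n^-1 ^ iota q), q^-1; split; [|exact: sgV|].
    by apply: cj => //; exact: sgV NS _.
  by rewrite invgM conjgE (homV iM) -!mulgA mulgV mulg1.
- exists (n * n' ^ iota q^-1), (q * q'); split; [|exact: sgM LS _ _|].
    by apply: (sgM NS) => //; apply: cj => //; exact: sgV.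
  by rewrite conjgE (homV iM) invgK iM -!mulgA; congr (_ * (_ * (_ * _))); rewrite mulKg.
Qed.

Lemma free_proj : exists k : G -> Q, [/\ hom k, k a = 1 & forall q, k (iota q) = q].
Proof. exact: free.2. Qed.

(* [Q] acts on the first factor of [Q * S] by translation, [a] on the fibres: thus a
   conjugate [a ^ iota q] acts on the fibre over [1] as [alpha q], and [alpha] is arbitrary. *)
Lemma fibre_action (S : groupType) (alpha : Q -> S) : exists K : G -> perms (Q * S),
  [/\ hom K, forall q0 q s, K (iota q0) (q, s) = (q0 * q, s)
    & forall q s, K a (q, s) = (q, alpha q * s)].
Proof.
pose f q0 (w : Q * S) := (q0 * w.1, w.2).
have fK q0 : cancel (f q0) (f q0^-1) by case=> q s; rewrite /f /= mulKg.
have fVK q0 : cancel (f q0^-1) (f q0) by case=> q s; rewrite /f /= mulVKg.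
pose g (w : Q * S) := (w.1, alpha w.1 * w.2).
pose g' (w : Q * S) := (w.1, (alpha w.1)^-1 * w.2).
have gK : cancel g g' by case=> q s; rewrite /g /g' /= mulKg.
have g'K : cancel g' g by case=> q s; rewrite /g /g' /= mulVKg.
have [|K [KM Ka Kq]] := free.2 _ (fun q0 => Perms (fK q0) (fVK q0)) (Perms gK g'K).
  by move=> x y; apply: perms_eq => -[q s]; rewrite permsME /= /f /= mulgA.
by exists K; split=> // *; rewrite ?Kq ?Ka.
Qed.

Lemma fibre_conj (S : groupType) (alpha : Q -> S) (K : G -> perms (Q * S)) :
  hom K -> (forall q0 q s, K (iota q0) (q, s) = (q0 * q, s)) ->
  (forall q s, K a (q, s) = (q, alpha q * s)) ->
  forall q s, K (a ^ iota q) (1, s) = (1, alpha q * s).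
Proof.
move=> KM Kq Ka q s; rewrite conjgE 2!KM !permsME Kq Ka mulg1.
by rewrite -(homV iM) Kq mulVg.
Qed.

(** Let [a ^ iota q] act on the fibre over 1 by itself if [q] is in [R], and trivially otherwise. As
    a member of [Nsub R] the element [n] acts as [n]; as a member of [Nsub R'] it acts through
    conjugates with [q] in both sets. *)
Lemma NsubI (R R' : set Q) n : Nsub R n -> Nsub R' n -> Nsub (R `&` R') n.
Proof.
move=> Rn R'n; pose alpha q := if `[< R q >] then a ^ iota q else 1.
have [K [KM Kq Ka]] := fibre_action alpha.
have E := fibre_conj KM Kq Ka.
have E1 : K n (1, 1) = (1, n).
  rewrite -[in RHS](mulg1 n).
  apply: (subgen_min (regular_subgroup (pair 1) KM (@hom_id G)) _ Rn) => _ [q Rq <-] s /=.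
  by rewrite E /alpha; case: asboolP.
have NS := subgenP [set a ^ iota q | q in R `&` R'].
have [k Nk /(_ 1) E2] : exists2 k, Nsub (R `&` R') k & forall s, K n (1, s) = (1, k * s).
  apply: (subgen_min (regular_in_subgroup (pair 1) KM NS) _ R'n) => _ [q R'q <-].
  exists (alpha q) => [|s]; last exact: E.
  rewrite /alpha; case: asboolP => Rq; last exact: sg1 NS.
  exact: Nsub_in.
by move: E2; rewrite E1 mulg1 => -[->].
Qed.

Lemma Nsub_proj (k : G -> Q) R n : hom k -> k a = 1 -> Nsub R n -> k n = 1.
Proof.
move=> kM ka Rn; apply: (subgen_min (H := [set n | k n = 1]) _ _ Rn).
  apply: (@is_subgroup_preim _ _ k [set 1]) => //.
by move=> _ [q _ <-] /=; rewrite (homJ kM) ka conj1g.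
Qed.

(** The projection that kills [a] recovers the factor in [L], so the two decompositions of [x]
    coincide and [NsubI] applies. *)
Lemma MsubI (R R' L L' : set Q) x : Msub R L x -> Msub R' L' x -> Msub (R `&` R') (L `&` L') x.
Proof.
move=> [n [q [Rn Lq ->]]] [n' [q' [Rn' Lq' E]]].
have [k [kM ka kq]] := free_proj.
have Eq : q = q'.
  by have := congr1 k E; rewrite !kM !kq (Nsub_proj kM ka Rn) (Nsub_proj kM ka Rn') !mul1g.
subst q'; have En : n = n' by apply: mulIg E.
by subst n'; exists n, q; split=> //; exact: NsubI.
Qed.

Lemma MsubS (R R' L L' : set Q) : R `<=` R' -> L `<=` L' -> Msub R L `<=` Msub R' L'.
Proof. by move=> RR LL _ [n [q [Rn Lq ->]]]; exists n, q; split; [exact: NsubS Rn | exact: LL |]. Qed.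

Lemma Msub1 (R : set Q) : Msub R [set 1] = Nsub R.
Proof.
apply/predeqP => x; split=> [[n [_ [Rn -> ->]]]|]; first by rewrite (hom1 iM) mulg1.
exact: Nsub_Msub.
Qed.

End FreeWith.

(** * Integer powers and the elements [b_f] *)

Section Expz.
Variable G : groupType.
Implicit Types x y : G.

Lemma expz1 x : expz x 1%R = x. Proof. by []. Qed.

Lemma expzS x (k : int) : expz x (k + 1)%R = expz x k * x.
Proof.
case: k => [n|[|n]].
- have -> : (Posz n + 1 = Posz n.+1)%R by lia.
  by rewrite /= expgSr.
- by rewrite /= expg1 mulVg.
have -> : (Negz n.+1 + 1 = Negz n)%R by lia.
by rewrite /= [x ^+ n.+2]expgS invgM mulgVK.
Qed.

Lemma expzP x (k : int) : expz x (k - 1)%R = expz x k / x.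
Proof. by rewrite -[in RHS](subrK 1%R k) expzS mulgK. Qed.

Lemma expzD x (k l : int) : expz x (k + l)%R = expz x k * expz x l.
Proof.
elim/int_rect: l => [|n IHn|n IHn]; first by rewrite addr0 mulg1.
  by rewrite -addn1 PoszD addrA !expzS IHn mulgA.
by rewrite -addn1 PoszD opprD addrA !expzP IHn mulgA.
Qed.

Lemma expzN x (k : int) : expz x (- k)%R = (expz x k)^-1.
Proof. by apply/esym/mulg1_eq; rewrite -expzD subrr. Qed.

Lemma expzJ x y k : expz x k ^ y = expz (x ^ y) k.
Proof. by case: k => n /=; rewrite ?conjVg conjXg. Qed.

Lemma commute_expz x y k : commute x y -> commute x (expz y k).
Proof. by move=> xy; case: k => n /=; [|apply: commuteV]; exact: commuteX. Qed.

Lemma expzV x k : expz x^-1 k = (expz x k)^-1.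
Proof. by case: k => n /=; rewrite expVgn. Qed.

Lemma expzM x (k l : int) : expz (expz x k) l = expz x (k * l)%R.
Proof.
elim/int_rect: l => [|n IHn|n IHn]; first by rewrite mulr0.
  by rewrite -addn1 PoszD expzS mulrDr mulr1 expzD IHn.
by rewrite -addn1 PoszD opprD expzP mulrDr mulrN1 expzD IHn expzN.
Qed.

End Expz.

(** With [b3] and [c3] this is [bf]; the same ordered product is formed in several groups. *)
Definition tf (G : groupType) (t s : G) (f : calE) : G :=
  \prod_(i <- sort <=%O (finsupp f)) expz (t ^ expz s i) (f i).

Lemma hom_tf (G H : groupType) (h : G -> H) t s f : hom h -> h (tf t s f) = tf (h t) (h s) f.
Proof.
move=> hM; rewrite /tf (hom_prod hM); apply: eq_bigr => i _.
by rewrite (homXz hM) (homJ hM) (homXz hM).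
Qed.

Definition supp_in (f : calE) (lo : int) (n : nat) : Prop :=
  forall i : int, f i != 0%R -> (lo <= i < lo + n%:Z)%R.

Lemma supp_bound (f : calE) : exists N : nat, forall i : int, f i != 0%R -> (`|i| < N)%N.
Proof.
exists (\max_(i <- finsupp f) `|i|%N).+1 => i fi; rewrite ltnS.
by apply: (@leq_bigmax_seq _ (enum_fset (finsupp f)) predT (fun i : int => `|i|%N)) => //;
  rewrite -mem_finsupp in fi.
Qed.

Lemma supp_window (f : calE) : exists N : nat, supp_in f (- N%:Z)%R (N + N).
Proof.
have [N fN] := supp_bound f; exists N => i /fN; lia.
Qed.

Lemma mkE (h : int -> int) (N : nat) : (forall i : int, h i != 0%R -> (`|i| < N)%N) ->
  exists f : calE, forall i, f i = h i.
Proof.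
move=> hN; pose r := [seq (- N%:Z + k%:Z)%R | k <- iota 0 (N + N)].
exists [fsfun k in [fset x in r]%fset => h k] => i; rewrite fsfunE inE /=.
case: ifPn => // ir; apply/esym/eqP; apply: contraNT ir => /hN iN.
by apply/mapP; exists (absz (i + N%:Z)%R); rewrite ?mem_iota; lia.
Qed.

Lemma calE_eq (f g : calE) : (forall i, f i = g i) -> f = g.
Proof. by move=> E; apply/fsfunP. Qed.

Definition zrange (lo : int) n : seq int := [seq (lo + k%:Z)%R | k <- iota 0 n].

Lemma mem_zrange lo n i : (i \in zrange lo n) = (lo <= i < lo + n%:Z)%R.
Proof.
apply/mapP/idP => [[k]|ir]; first by rewrite mem_iota => /andP[_ kn] ->; lia.
by exists (absz (i - lo)%R); rewrite ?mem_iota; lia.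
Qed.

Lemma zrange_sorted lo n : sorted <%O (zrange lo n).
Proof.
rewrite /zrange sorted_map; apply: sub_sorted (iota_ltn_sorted 0 n) => i j /=.
by rewrite /relpre /=; lia.
Qed.

Section Tf.
Variables (G : groupType) (t s : G).

Definition tz (i : int) : G := t ^ expz s i.

Lemma tz_shift i j : tz i ^ expz s j = tz (i + j)%R.
Proof. by rewrite /tz -conjgM expzD. Qed.

(** A common interval of indices replaces the sorted support, which changes under addition and
    shift. *)
Lemma tf_window f lo n : supp_in f lo n ->
  tf t s f = \prod_(i <- zrange lo n) expz (tz i) (f i).
Proof.
move=> fr; rewrite /tf; have -> : sort <=%O (finsupp f) = [seq i <- zrange lo n | i \in finsupp f].
  apply: lt_sorted_eq.
  - by rewrite sort_lt_sorted fset_uniq.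
  - by apply: sorted_filter (zrange_sorted lo n); exact: lt_trans.
  move=> i; rewrite mem_sort mem_filter; case fi: (i \in finsupp f) => //=.
  by rewrite mem_zrange fr //; rewrite mem_finsupp in fi.
rewrite big_filter big_mkcond; apply: eq_bigr => i _; case: ifPn => //.
by rewrite memNfinsupp => /eqP ->.
Qed.

Lemma tf_in (T : set G) (f : calE) : is_subgroup T -> (forall i, f i != 0%R -> T (tz i)) -> T (tf t s f).
Proof.
move=> TS Tt; rewrite /tf big_seq; elim/big_ind: _ => [||i].
- exact: sg1 TS.
- by move=> x y; exact: sgM.
- rewrite mem_sort mem_finsupp => /Tt Ti.
  exact: (sgXz _ TS).
Qed.

Lemma tf_shift (f g : calE) (k : int) : (forall i, f i = g (i - k)%R) ->
  tf t s g ^ expz s k = tf t s f.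
Proof.
move=> E; have [N gN] := supp_window g.
have fN : supp_in f (- N%:Z + k)%R (N + N) by move=> i; rewrite E => /gN; lia.
rewrite (tf_window gN) (tf_window fN) conjg_prod /zrange !big_map; apply: eq_bigr => j _.
by rewrite expzJ tz_shift E; congr (expz (tz _) (g _)); lia.
Qed.

(** Indices increase from left to right, so functions with consecutive supports multiply even where
    the conjugates do not commute. *)
Lemma tf_append (f g h : calE) (k : int) : (forall i, f i != 0%R -> (i < k)%R) ->
  (forall i, g i != 0%R -> (k <= i)%R) -> (forall i, h i = f i + g i)%R ->
  tf t s h = tf t s f * tf t s g.
Proof.
move=> fk gk E.
have [N1 fN] := supp_bound f; have [N2 gN] := supp_bound g.
pose N := (N1 + N2 + `|k|)%N; pose n1 := absz (k + N%:Z)%R; pose n2 := absz (N%:Z - k)%R.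
have zE : zrange (- N%:Z)%R (n1 + n2) = zrange (- N%:Z)%R n1 ++ zrange k n2.
  rewrite /zrange iotaD map_cat add0n -[in iota n1 n2](addn0 n1) iotaDl -map_comp.
  by congr (_ ++ _); apply: eq_map => j /=; rewrite /n1 /N; lia.
have f0 i : (k <= i)%R -> f i = 0%R.
  by move=> ki; apply/eqP; apply: contraLR ki => /fk; rewrite ltNge.
have g0 i : (i < k)%R -> g i = 0%R.
  by move=> ki; apply/eqP; apply: contraLR ki => /gk; rewrite leNgt.
have fw : supp_in f (- N%:Z)%R n1.
  by move=> i fi; move: (fN _ fi) (fk _ fi); rewrite /n1 /N; lia.
have gw : supp_in g k n2.
  by move=> i gi; move: (gN _ gi) (gk _ gi); rewrite /n2 /N; lia.
have hw : supp_in h (- N%:Z)%R (n1 + n2).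
  move=> i; rewrite E => hi; case: (ltP i k) => ki.
    by move: hi; rewrite (g0 _ ki) addr0 => /fw; lia.
  by move: hi; rewrite (f0 _ ki) add0r => /gw; rewrite /n1 /n2 /N; lia.
rewrite (tf_window hw) zE big_cat (tf_window fw) (tf_window gw) /=; congr (_ * _).
  apply: eq_big_seq => i; rewrite mem_zrange => ir; rewrite E g0 ?addr0 //.
  by move: ir; rewrite /n1 /N; lia.
apply: eq_big_seq => i; rewrite mem_zrange => /andP[ir _]; by rewrite E f0 ?add0r.
Qed.

Lemma tf0 (f : calE) : (forall i, f i = 0%R) -> tf t s f = 1.
Proof.
move=> f0; have fw : supp_in f 0%R 0 by move=> i; rewrite f0 eqxx.
by rewrite (tf_window fw) big_nil.
Qed.

Lemma tf1 (f : calE) k n : (forall i, f i = if i == k then n else 0%R) -> tf t s f = expz (tz k) n.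
Proof.
move=> E; have fw : supp_in f k 1 by move=> i; rewrite E; case: (eqVneq i k) => [->|_]; rewrite ?eqxx //; lia.
by rewrite (tf_window fw) /zrange /= big_seq1 addr0 E eqxx.
Qed.

Section Commuting.
Hypothesis tzC : forall i j, commute (tz i) (tz j).

Lemma tfD (f g h : calE) : (forall i, h i = f i + g i)%R -> tf t s h = tf t s f * tf t s g.
Proof.
move=> E; have [N1 fN] := supp_bound f; have [N2 gN] := supp_bound g.
pose N := (N1 + N2)%N.
have fw : supp_in f (- N%:Z)%R (N + N) by move=> i fi; move: (fN _ fi); rewrite /N; lia.
have gw : supp_in g (- N%:Z)%R (N + N) by move=> i gi; move: (gN _ gi); rewrite /N; lia.
have hw : supp_in h (- N%:Z)%R (N + N).
  move=> i; rewrite E => hi; case: (eqVneq (f i) 0%R) => [f0|/fw //].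
  by apply: gw; move: hi; rewrite f0 add0r.
rewrite (tf_window fw) (tf_window gw) (tf_window hw).
rewrite -prodgM_commute; last first.
  move=> i j *; apply: commute_expz; apply: commute_sym; apply: commute_expz.
  exact: tzC.
by apply: eq_bigr => i _; rewrite E expzD.
Qed.

Lemma tfN (f g : calE) : (forall i, g i = - f i)%R -> tf t s g = (tf t s f)^-1.
Proof.
move=> E; have [z z0] := @mkE (fun=> 0%R) 0 (fun i h => ltac:(by rewrite eqxx in h)).
apply/esym/mulg1_eq; rewrite -(tfD (h := z)) ?tf0 // => i.
by rewrite E subrr.
Qed.

Lemma tz_span x : subgen (range tz) x -> exists f, x = tf t s f.
Proof.
apply: (subgen_min (H := [set x | exists f, x = tf t s f])).
  apply: is_subgroupM => [|_ [f ->]|_ _ [f ->] [g ->]].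
  - have [z z0] := @mkE (fun=> 0%R) 0 (fun i h => ltac:(by rewrite eqxx in h)).
    by exists z; rewrite tf0.
  - have [N fN] := supp_bound f.
    have [|g gE] := @mkE (fun i => - f i)%R N; last by exists g; rewrite (tfN gE).
    by move=> i; rewrite oppr_eq0 => /fN.
  - have [N1 fN] := supp_bound f; have [N2 gN] := supp_bound g.
    have [|h hE] := @mkE (fun i => f i + g i)%R (N1 + N2)%N; last by exists h; rewrite (tfD hE).
    move=> i hi; case: (eqVneq (f i) 0%R) => [f0|/fN]; last by lia.
    by move: hi; rewrite f0 add0r => /gN; lia.
move=> _ [k _ <-].
have [|f fE] := @mkE (fun i => if i == k then 1 else 0)%R `|k|.+1.
  by move=> i; case: (eqVneq i k) => [->|_]; rewrite ?eqxx.
by exists f; rewrite (tf1 fE).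
Qed.

End Commuting.
End Tf.

Lemma bfE f : bf f = tf b3 c3 f. Proof. by []. Qed.

(** * A finitely presented group with commuting conjugates [t ^ s ^ i] *)

Section CommutingConjugates.
Variables (G : groupType) (t s r : G).
Hypotheses (rs : commute r s) (tts : commute t (t ^ s)) (tr : t ^ r = t * t ^ s).

Lemma tz_conj_r i : tz t s i ^ r = tz t s i * tz t s (i + 1)%R.
Proof.
rewrite /tz -conjgM; have -> : expz s i * r = r * expz s i.
  by apply: commute_sym; exact: commute_expz.
have -> : expz s (i + 1)%R = s * expz s i by rewrite addrC expzD.
by rewrite conjgM tr conjMg -conjgM.
Qed.

Lemma tz_commute_shift i j k : commute (tz t s i) (tz t s j) ->
  commute (tz t s (i + k)%R) (tz t s (j + k)%R).
Proof. by rewrite /commute -!tz_shift -2!conjMg => ->. Qed.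

(** Write [x_i] for [tz t s i]. Conjugating [[x_0, x_(n+1)] = 1] by [r] gives
    [[x_0 x_1, x_(n+1) x_(n+2)] = 1], where all commutators except [[x_0, x_(n+2)]] vanish already,
    up to a shift. This is an induction on the distance of the indices. *)
Lemma tz_commute i j : commute (tz t s i) (tz t s j).
Proof.
have c1 : commute (tz t s 0%R) (tz t s 1%R) by rewrite /tz /= conjg1.
have c0 n : forall m, (m <= n)%N -> commute (tz t s 0%R) (tz t s m%:Z).
  elim: n => [|n IHn] m; first by rewrite leqn0 => /eqP ->; exact: commute_refl.
  rewrite leq_eqVlt => /orP[/eqP ->|]; last by rewrite ltnS; exact: IHn.
  case: n IHn => [|n] IHn; first exact: c1.
  have cn := IHn _ (leqnn n.+1); have cn1 := IHn _ (leqnSn n).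
  have : (tz t s 0%R * tz t s n.+1%:Z) ^ r = (tz t s n.+1%:Z * tz t s 0%R) ^ r by rewrite cn.
  rewrite [LHS]conjMg [RHS]conjMg !tz_conj_r add0r.
  have cn' : commute (tz t s 1%R) (tz t s n.+1%:Z).
    by have := tz_commute_shift 1%R cn1; rewrite add0r -PoszD addn1.
  have cn2 : commute (tz t s 1%R) (tz t s (n.+1%:Z + 1)%R).
    by have := tz_commute_shift 1%R cn; rewrite add0r.
  set x0 := tz t s 0%R in cn *; set x1 := tz t s 1%R in cn' cn2 *.
  set y := tz t s n.+1%:Z in cn cn' *.
  have -> : tz t s n.+2%:Z = tz t s (n.+1%:Z + 1)%R by rewrite -PoszD addn1.
  set z := tz t s _ in cn2 *; clearbody x0 x1 y z.
  rewrite !mulgA -[x0 * x1 * y]mulgA cn' [x0 * (y * x1)]mulgA cn -[y * x0 * x1 * z]mulgA cn2.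
  rewrite -[y * z * x0 * x1]mulgA -!mulgA => /mulgI; rewrite !mulgA => /mulIg.
  by [].
wlog ij : i j / (i <= j)%R.
  by move=> H; case: (lerP i j) => [/H //|/ltW /H]; exact: commute_sym.
have := @tz_commute_shift 0%R (absz (j - i)%R)%:Z i (c0 _ _ (leqnn _)).
by rewrite add0r; congr (commute _ (tz _ _ _)); lia.
Qed.

End CommutingConjugates.

Definition wconj (u v : rword) : rword := rinv v ++ u ++ v.

Lemma evalw_conj (G : groupType) (nu : nat -> G) u v : evalw nu (wconj u v) = evalw nu u ^ evalw nu v.
Proof. by rewrite /wconj !evalw_cat evalw_inv conjgE. Qed.

(** Baumslag's finitely presented metabelian group, in which [t] and [s] generate the wreath product
    of two infinite cyclic groups. *)
Definition pB : rpres :=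
  (3, [:: rinv (rgen 2 ++ rgen 1) ++ rgen 1 ++ rgen 2;
          rinv (rgen 0 ++ wconj (rgen 0) (rgen 1)) ++ wconj (rgen 0) (rgen 1) ++ rgen 0;
          rinv (wconj (rgen 0) (rgen 2)) ++ rgen 0 ++ wconj (rgen 0) (rgen 1)]).

Lemma wfp_pB : wfp pB. Proof. by []. Qed.

Lemma evalw_eq (G : groupType) (nu : nat -> G) u v :
  evalw nu (rinv u ++ v) = 1 <-> evalw nu u = evalw nu v.
Proof.
rewrite evalw_cat evalw_inv; split=> [/mulg1_eq|->]; last exact: mulVg.
by rewrite invgK.
Qed.

Section RelationsB.
Variables (G : groupType) (nu : nat -> G).
Let t := nu 0. Let s := nu 1%N. Let r := nu 2.

Lemma pB_rels : (forall w, w \in pB.2 -> evalw nu w = 1) <->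
  [/\ commute r s, commute t (t ^ s) & t ^ r = t * t ^ s].
Proof.
split=> [H|[c1 c2 c3] w].
  have e u v (uv : rinv u ++ v \in pB.2) : evalw nu u = evalw nu v.
    exact: (proj1 (evalw_eq nu u v) (H _ uv)).
  have e1 := e (rgen 2 ++ rgen 1) (rgen 1 ++ rgen 2) isT.
  have e2 := e (rgen 0 ++ wconj (rgen 0) (rgen 1)) (wconj (rgen 0) (rgen 1) ++ rgen 0) isT.
  have e3 := e (wconj (rgen 0) (rgen 2)) (rgen 0 ++ wconj (rgen 0) (rgen 1)) isT.
  by move: e1 e2 e3; rewrite !(evalw_conj, evalw_cat, evalw_gen) => e1 e2 e3; split.
rewrite !inE => /or3P[] /eqP ->; apply/evalw_eq.
all: by rewrite !(evalw_conj, evalw_cat, evalw_gen).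
Qed.

End RelationsB.

Lemma B_hom (G : groupType) (t s r : G) :
  commute r s -> commute t (t ^ s) -> t ^ r = t * t ^ s ->
  exists k : grp pB -> G, [/\ hom k, k (gn pB 0) = t, k (gn pB 1) = s & k (gn pB 2) = r].
Proof.
move=> c1 c2 c3; have [|k kM kg] := @grp_hom pB G (nth r [:: t; s]) wfp_pB.
  by apply/pB_rels.
by exists k; split=> //; rewrite kg.
Qed.

Lemma B_tzC i j : commute (tz (gn pB 0) (gn pB 1) i) (tz (gn pB 0) (gn pB 1) j).
Proof.
have [c1 c2 c3] : [/\ commute (gn pB 2) (gn pB 1), commute (gn pB 0) (gn pB 0 ^ gn pB 1)
    & gn pB 0 ^ gn pB 2 = gn pB 0 * gn pB 0 ^ gn pB 1].
  by apply/(@pB_rels _ (gn pB)) => w wp; exact: ev_rel.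
exact: tz_commute c1 c2 c3 i j.
Qed.

(** * Its action on functions with support bounded below *)

(** Formal Laurent series with integer coefficients: [t] adds 1, [s] divides by the variable, and
    one plus the variable is invertible. *)
Record lser := LSer { lval :> int -> int; lbound : exists N : int, forall i, (i < N)%R -> lval i = 0%R }.

Lemma lser_eq (g h : lser) : (forall i, g i = h i) -> g = h.
Proof.
case: g h => [g gb] [h hb] /= /funext E; subst h; congr LSer; exact: Prop_irrelevance.
Qed.

Definition ladd (c : int) (k : int) (h : lser) : lser.
Proof.
exists (fun i => h i + (if i == k then c else 0))%R.
have [N hN] := lbound h; exists (Num.min N k)%R => i iN.
rewrite hN ?add0r; last by lia.
by case: eqP => // ik; lia.
Defined.

Definition lshift (c : int) (h : lser) : lser.
Proof.
exists (fun i => h (i + c)%R); have [N hN] := lbound h; exists (N - c)%R => i iN.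
by apply: hN; lia.
Defined.

Lemma laddK c k : cancel (ladd c k) (ladd (- c) k).
Proof. by move=> h; apply: lser_eq => i /=; case: eqP => _; lia. Qed.
Lemma laddNK c k : cancel (ladd (- c) k) (ladd c k).
Proof. by move=> h; apply: lser_eq => i /=; case: eqP => _; lia. Qed.
Lemma lshiftK c : cancel (lshift c) (lshift (- c)).
Proof. by move=> h; apply: lser_eq => i /=; congr (h _); lia. Qed.
Lemma lshiftNK c : cancel (lshift (- c)) (lshift c).
Proof. by move=> h; apply: lser_eq => i /=; congr (h _); lia. Qed.

Definition pt : perms lser := Perms (laddK 1%R 0%R) (laddNK 1%R 0%R).
Definition ps : perms lser := Perms (lshiftK 1%R) (lshiftNK 1%R).

(* This is the inverse of the action of [r]; it is bijective because the functions vanish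
   far to the left. *)
Definition one_plus_shift (h : lser) : lser.
Proof.
exists (fun i => h i + h (i - 1))%R; have [N hN] := lbound h; exists N => i iN.
by rewrite !hN ?addr0; lia.
Defined.

Lemma one_plus_shift_perm : exists p : perms lser, forall h, p h = one_plus_shift h.
Proof.
apply: perms_of_bij => [g h E|h].
  have Ei i : (g i + g (i - 1) = h i + h (i - 1))%R.
    exact: (congr1 (fun u : lser => u i) E).
  have [N gN] := lbound g; have [N' hN] := lbound h; apply: lser_eq => i.
  pose m := Num.min N N'.
  have gh k : g (m - 1 + k%:Z)%R = h (m - 1 + k%:Z)%R.
    elim: k => [|k IHk]; first by rewrite gN ?hN //; lia.
    have := Ei (m - 1 + k.+1%:Z)%R.
    have -> : (m - 1 + k.+1%:Z - 1 = m - 1 + k%:Z)%R by lia.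
    by rewrite IHk => /addIr.
  case: (ltrP i (m - 1)%R) => im; first by rewrite gN ?hN //; lia.
  have := gh (absz (i - (m - 1))%R).
  by have -> : (m - 1 + (absz (i - (m - 1))%R)%:Z = i)%R by lia.
have [N hN] := lbound h.
(* Division by one plus the variable, coefficient by coefficient from the lower bound [N]; [u 0 = 0]
   stands for the coefficient just before it. *)
pose fix u k : int := if k is k'.+1 then (h (N + k'%:Z) - u k')%R else 0%R.
pose g (i : int) : int := if (i < N)%R then 0%R else u (absz (i - N)%R).+1.
have gb : exists M : int, forall i, (i < M)%R -> g i = 0%R.
  by exists N => i iN; rewrite /g iN.
exists (LSer gb); apply: lser_eq => i /=; rewrite /g.
case: (ltrP i N) => iN; first by rewrite ifT ?hN //; lia.
case: (ltrP (i - 1)%R N) => iN1.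
  have -> : i = N by lia.
  by rewrite subrr /= addr0 subr0 addr0.
have -> : absz (i - N)%R = (absz (i - 1 - N)%R).+1 by lia.
set k := absz _; rewrite [u k.+2]/= -/(u k.+1) subrK; congr (h _); lia.
Qed.

Lemma expz_ps i h j : expz ps i h j = h (j + i)%R.
Proof.
elim/int_rect: i h j => [|n IHn|n IHn] h j; first by rewrite addr0.
  by rewrite -addn1 PoszD expzS permsME IHn /=; congr (h _); lia.
by rewrite -addn1 PoszD opprD expzP permsME IHn /=; congr (h _); lia.
Qed.

Lemma tz_ps i h j : tz pt ps i h j = (h j + (j == i)%:Z)%R.
Proof.
rewrite /tz conjgE permsME permsME -expzN expz_ps /=.
rewrite expz_ps; congr (_ + _)%R; first by congr (h _); lia.
by case: eqP => [E|/eqP E]; case: eqP => //; lia.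
Qed.

Lemma lser_model : exists k : grp pB -> perms lser,
  [/\ hom k, k (gn pB 0) = pt & k (gn pB 1) = ps].
Proof.
have [p pE] := one_plus_shift_perm.
have cps : commute p ps.
  apply: perms_eq => h; rewrite !permsME !pE; apply: lser_eq => i /=.
  by congr (_ + h _)%R; lia.
have tz1 : pt ^ ps = tz pt ps 1%R by [].
have ptE h i : pt h i = (h i + (i == 0)%:Z)%R by rewrite /=; case: eqP.
have [||| k [kM k0 k1 k2]] := @B_hom (perms lser) pt ps p^-1; last by exists k.
- by apply: commute_sym; apply: commuteV; exact: commute_sym.
- rewrite tz1; apply: perms_eq => h; apply: lser_eq => i.
  by rewrite -[LHS]/(pt (tz pt ps 1%R h) i) -[RHS]/(tz pt ps 1%R (pt h) i) ptE !tz_ps ptE addrAC.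
- rewrite conjgE invgK tz1; apply: (@mulIg _ p); rewrite -!mulgA mulVg mulg1.
  apply: perms_eq => h; rewrite -[LHS]/(p (pt h)) -[RHS]/(pt (tz pt ps 1%R (p h))) !pE.
  apply: lser_eq => i; rewrite -[LHS]/(pt h i + pt h (i - 1))%R !ptE tz_ps.
  rewrite -[one_plus_shift h i]/(h i + h (i - 1))%R.
  have -> : (i - 1 == 0)%R = (i == 1)%R by lia.
  by lia.
Qed.

Lemma tf_act (p q : perms lser) (idx : int -> int) (f : calE) :
  (forall i h j, tz p q i h j = (h j + (j == idx i)%:Z)%R) ->
  forall h j, tf p q f h j = (h j + \sum_(i <- finsupp f) f i * (j == idx i)%:Z)%R.
Proof.
move=> tzE h j.
have tzV i g k : (tz p q i)^-1 g k = (g k - (k == idx i)%:Z)%R.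
  have := tzE i ((tz p q i)^-1 g) k; rewrite -permsME mulgV perms1E => ->.
  by rewrite addrK.
have tzX i n g k : expz (tz p q i) n g k = (g k + n * (k == idx i)%:Z)%R.
  elim/int_rect: n g k => [|n IHn|n IHn] g k; first by rewrite mul0r addr0.
    by rewrite -addn1 PoszD expzS permsME IHn tzE; lia.
  by rewrite -addn1 PoszD opprD expzP permsME IHn tzV; lia.
have -> : (\sum_(i <- finsupp f) f i * (j == idx i)%:Z =
           \sum_(i <- sort <=%O (finsupp f)) f i * (j == idx i)%:Z)%R.
  by apply: perm_big; rewrite perm_sym perm_sort.
rewrite /tf; elim: (sort _ _) h => [|i r IHr] h; first by rewrite !big_nil addr0.
by rewrite !big_cons permsME tzX IHr addrAC addrA.
Qed.

(** [idx] is the identity for the standard conjugates; other index maps arise when [t] and [s] are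
    replaced by conjugates and powers. *)
Lemma tf_act_inj (p q : perms lser) (idx : int -> int) (f : calE) : injective idx ->
  (forall i h j, tz p q i h j = (h j + (j == idx i)%:Z)%R) ->
  forall h, (forall i, tf p q f h (idx i) = h (idx i) + f i)%R /\
    forall j, (forall i, j != idx i) -> tf p q f h j = h j.
Proof.
move=> idxI tzE h; split=> [i|j jr]; rewrite (tf_act _ tzE).
  congr (_ + _)%R; case fi: (i \in finsupp f).
    rewrite (bigD1_seq i) ?fset_uniq //= eqxx mulr1 big1 ?addr0 // => k ki.
    by rewrite (inj_eq idxI) eq_sym (negbTE ki) mulr0.
  have f0 : f i = 0%R by apply/eqP; rewrite -memNfinsupp fi.
  rewrite f0 big_seq big1 // => k kf; rewrite (inj_eq idxI).
  case: (eqVneq i k) => [ik|]; last by rewrite mulr0.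
  by rewrite -ik fi in kf.
by rewrite big1 ?addr0 // => i _; rewrite (negbTE (jr i)) mulr0.
Qed.

Lemma tf_ps f h i : tf pt ps f h i = (h i + f i)%R.
Proof. by have [/(_ i)] := tf_act_inj f (@inj_id _) tz_ps h. Qed.

(** * The subgroup generated by [a] and the [b_i] with [i < 0] *)

Definition Hset (I : set int) : set F3 := subgen ([set a3] `|` [set bi i | i in I]).

Lemma Hset_a I : Hset I a3. Proof. by apply: subgen_in; left. Qed.
Lemma Hset_b (I : set int) i : I i -> Hset I (bi i). Proof. by move=> Ii; apply: subgen_in; right; exists i. Qed.

(** Doubling maps: [b_i] goes to [b_(2 i + k)], so each integer index is hit for exactly one of the
    two [k]. *)
Definition is_eps (k : bool) (eps : F3 -> F3) : Prop :=
  [/\ hom eps, eps a3 = a3, eps b3 = bi k%:Z & eps c3 = c3 ^+ 2].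

Lemma expz_double (G : groupType) (x : G) i : expz (x ^+ 2) i = expz x (2 * i)%R.
Proof. exact: (expzM x 2%:Z i). Qed.

Lemma eps_bi k eps i : is_eps k eps -> eps (bi i) = bi (2 * i + k%:Z)%R.
Proof.
move=> [eM _ eb ec]; rewrite /bi (homJ eM) (homXz eM) eb ec expz_double /bi.
by rewrite -conjgM -expzD addrC.
Qed.

Lemma Hset_eps k eps (I J : set int) x : is_eps k eps -> (forall i, I i -> J (2 * i + k%:Z)%R) ->
  Hset I x -> Hset J (eps x).
Proof.
move=> eP IJ; have [eM ea _ _] := eP.
apply: (hom_subgen eM (subgenP _)) => y [->|[i /IJ Ji <-]].
  by rewrite ea; exact: Hset_a.
by rewrite (eps_bi _ eP); exact: Hset_b.
Qed.

(* [c] acts on two sheets as a square root of the translation by [c], [a] on one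
   sheet and [b] on the sheet [k]; this inverts [eps]. *)
Lemma sheets_action k eps : is_eps k eps -> exists K : F3 -> perms (F3 * bool),
  [/\ hom K, forall x y, K (eps x) (y, false) = (x * y, false)
    & forall j, exists2 w, forall y, K (bi j) (y, false) = (w * y, false)
      & w = 1 \/ exists2 i, w = bi i & j = (2 * i + k%:Z)%R].
Proof.
move=> [eM ea eb ec].
pose fs (l : bool) (z : F3) (u : F3 * bool) := (if u.2 == l then z * u.1 else u.1, u.2).
have fsK l z : cancel (fs l z) (fs l z^-1) by case=> y r; rewrite /fs /=; case: eqP => _; rewrite ?mulKg.
have fsVK l z : cancel (fs l z^-1) (fs l z) by case=> y r; rewrite /fs /=; case: eqP => _; rewrite ?mulVKg.
pose g (u : F3 * bool) := (if u.2 then c3 * u.1 else u.1, ~~ u.2).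
pose g' (u : F3 * bool) := (if u.2 then u.1 else c3^-1 * u.1, ~~ u.2).
have gK : cancel g g' by case=> y []; rewrite /g /g' /= ?mulKg.
have g'K : cancel g' g by case=> y []; rewrite /g /g' /= ?mulVKg.
pose pa := Perms (fsK false a3) (fsVK false a3); pose pb := Perms (fsK k b3) (fsVK k b3).
pose pc := Perms gK g'K.
have [K [KM Ka Kb Kc]] := F3_hom pa pb pc.
have c2 : forall y l, (pc ^+ 2) (y, l) = (c3 * y, l).
  by move=> y []; rewrite expg2 permsME.
have cz i y l : expz pc (2 * i)%R (y, l) = (expz c3 i * y, l).
  rewrite -expz_double; move: (pc ^+ 2) c2 => p2 c2; elim/int_rect: i y => [|n IHn|n IHn] y; first by rewrite mul1g.
    by rewrite -addn1 PoszD !expzS permsME c2 IHn mulgA.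
  rewrite -addn1 PoszD opprD !expzP permsME.
  have -> : p2^-1 (y, l) = (c3^-1 * y, l).
    by apply: (@pfun_inj _ p2); rewrite -permsME mulgV c2 mulVKg.
  by rewrite IHn mulgA.
have Kbj i (l : bool) y : K (bi (2 * i + l%:Z)%R) (y, false) = (if l == k then bi i * y else y, false).
  rewrite /bi (homJ KM) (homXz KM) Kb Kc conjgE 2!permsME addrC expzD permsME cz.
  have -> : expz pc l%:Z (expz c3 i * y, false) = (expz c3 i * y, l).
    by case: l; rewrite //= expg1.
  have -> : pb (expz c3 i * y, l) = (if l == k then b3 * (expz c3 i * y) else expz c3 i * y, l).
    by [].
  apply: (@pfun_inj _ (expz pc l%:Z * expz pc (2 * i)%R)).
  rewrite -permsME mulgV perms1E permsME cz.
  have -> z : expz pc l%:Z (z, false) = (z, l) by case: l; rewrite //= expg1.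
  by case: eqP => _ //; rewrite conjgE !mulgA mulgV mul1g.
exists K; split=> // [x y|j].
  move: x y; apply: (@F3_ind [set x | forall y, K (eps x) (y, false) = (x * y, false)]) => /=.
  - exact: (regular_subgroup (fun y => (y, false)) (hom_comp eM KM) (@hom_id F3)).
  - by move=> y; rewrite ea Ka.
  - move=> y; have := Kbj 0%R k y; rewrite eqxx mulr0 add0r -eb => ->.
    by rewrite /bi /= conjg1.
  - by move=> y; rewrite ec (homX KM) Kc c2.
pose i := (j %/ 2)%Z; have ji : (j = 2 * i + (odd (absz (j %% 2)%Z))%:Z)%R by rewrite /i; lia.
rewrite {}ji; set l := odd _; rewrite -/(nat_of_bool l).
exists (if l == k then bi i else 1) => [y|].
  by rewrite Kbj; case: eqP; rewrite ?mul1g.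
by case: eqP => [->|_]; [right; exists i | left].
Qed.

Lemma eps_inj k eps : is_eps k eps -> injective eps.
Proof.
move=> /sheets_action[K [_ KE _]] x y E.
by have := KE x 1; rewrite E KE => -[]; rewrite !mulg1.
Qed.

(** On the sheet [false] the element [eps x] translates by [x]; as a product of [a] and of [b_j]
    with [j] in [J] it also translates by a product of [a] and of [b_i] with [2 i + k] in [J]. *)
Lemma Hset_eps_inv k eps (I J : set int) x : is_eps k eps -> (forall i, J (2 * i + k%:Z)%R -> I i) ->
  Hset J (eps x) -> Hset I x.
Proof.
move=> eP JI; have [K [KM KE KB]] := sheets_action eP.
have [_ ea _ _] := eP => Jx.
have [w Iw E] : exists2 w, Hset I w & forall s, K (eps x) (s, false) = (w * s, false).
  apply: (subgen_min (regular_in_subgroup (fun s => (s, false)) KM (subgenP _)) _ Jx) => y.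
  move=> [->|[j Jj <-]].
    by exists a3; [exact: Hset_a | move=> s; rewrite -{1}ea KE].
  have [w wE wI] := KB j; exists w => //.
  case: wI => [->|[i -> ji]]; first exact: sg1 (subgenP _).
  by apply: Hset_b; apply: JI; rewrite -ji.
by have := E 1; rewrite KE => -[]; rewrite !mulg1 => ->.
Qed.

Definition gens3 : seq F3 := [:: a3; b3; c3].

Definition negs : set int := [set i | (i < 0)%R].

(** Translation of indices does not preserve negativity, but [i < 0] holds exactly when
    [2 i + k < 0]. All negative indices arise from [-1] by the two maps, as in binary notation;
    hence [a], [b_(-1)] and two letters realising the maps [eps] suffice. *)
Lemma Hset_neg_datum : exists2 d : datum, True &
  exists2 f : F3 -> grp d.1, dfor gens3 f (Hset negs) & injective f.
Proof.
have [eps epsP] : exists eps : bool -> F3 -> F3, forall k, is_eps k (eps k).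
  have [|eps epsP] := @choice _ _ (fun k eps => is_eps k eps).
    by move=> k; have [e [? ? ? ?]] := F3_hom a3 (bi k%:Z) (c3 ^+ 2); exists e.
  by exists eps.
pose p : rpres := (3, [::]); have [ga gb gc] := gn_F3.
pose wb (k : bool) := if k then wconj (rgen 1) (rgen 2) else rgen 1.
pose dbl k := [:: (rgen 0, rgen 0); (rgen 1, wb k); (rgen 2, rgen 2 ++ rgen 2)].
pose ls := [:: dbl false; dbl true].
pose M := fun _ : nat => Hset negs.
have MS i : @is_subgroup (grp p) (M i) by exact: subgenP.
have wbE k : ev p (wb k) = bi k%:Z.
  by case: k; rewrite /wb ?evalw_conj !evalw_gen gb ?gc /bi ?expz1 ?conjg1.
have dblP k xy : xy \in dbl k -> ev p xy.2 = eps k (ev p xy.1).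
  have [_ ea eb ec] := epsP k.
  rewrite !inE => /or3P[] /eqP ->.
  - by rewrite !evalw_gen ga ea.
  - by rewrite wbE !evalw_gen gb eb.
  - by rewrite evalw_cat !evalw_gen gc ec expg2.
have lsE k : k < 2 -> nth [::] ls k = dbl (k == 1%N) by case: k => [|[]].
have [k kl|m] := @hnn_modelP p ls M (fun=> (0%N, 0%N)) isT isT MS.
  have eP := epsP (k == 1%N); have [eM _ _ _] := eP.
  exists (fun x y => y = eps (k == 1%N) x) => [|xy].
    split=> [|x y x' y' -> ->|x y ->|x y ->].
    - by rewrite (hom1 eM).
    - by rewrite eM (homV eM).
    - split=> [->|E]; first exact: hom1.
      by apply: (eps_inj eP); rewrite E (hom1 eM).
    - split; first by apply: (Hset_eps eP); rewrite /negs /=; lia.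
      by apply: (Hset_eps_inv eP); rewrite /negs /=; lia.
  by rewrite lsE //; exact: dblP.
pose d : datum := (hnnp p ls, ([:: rgen 0; rgen 1; rgen 2],
  [:: rgen 0; wconj (rgen 1) (rinv (rgen 2)); rgen 3; rgen 4])).
have jM := hbaseM m; have jI := @hbase_inj _ _ _ _ m.
have jE w : wf p.1 w -> ev d.1 w = hbase m (ev p w) by move=> ww; rewrite hbase_ev.
pose T := @dsub d; have TS : is_subgroup T by exact: subgenP.
have Tw w : w \in d.2.2 -> T (ev d.1 w) by move=> wL; apply: subgen_in; exists w.
have bm1 : ev p (wconj (rgen 1) (rinv (rgen 2))) = bi (-1)%R.
  by rewrite evalw_conj evalw_inv !evalw_gen gb gc /bi /= expg1.
exists d => //; exists (hbase m) => //; split=> //.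
  by case=> [|[|[|//]]] _ /=; rewrite evalw_gen -(hbase_gn m) ?ga ?gb ?gc.
move=> x; split=> [Tx|].
  apply/(goes_base MS m 0 x); apply: (subgen_min (goes_loops m 0) _ Tx) => y [w + ->].
  rewrite !inE => /or4P[] /eqP ->.
  - by rewrite jE //; apply/goes_base => //; rewrite evalw_gen ga; exact: Hset_a.
  - by rewrite jE //; apply/goes_base => //; rewrite bm1; apply: Hset_b; rewrite /negs.
  - by rewrite evalw_gen; exact: (goes_letter m (k := 0)).
  - by rewrite evalw_gen; exact: (goes_letter m (k := 1%N)).
have tT (k : bool) : T (gn d.1 (3 + k)).
  by rewrite -evalw_gen; apply: Tw; rewrite !inE; case: k.
have tE (k : bool) z : gn d.1 (3 + k) * hbase m z = hbase m (eps k z) * gn d.1 (3 + k).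
  have kl : k < 2 by case: k.
  have lk : nth [::] ls k = dbl k by case: k {kl}.
  have [eM ea eb ec] := epsP k.
  apply: (@hletter_gen p ls M _ m k F3 [set` gens p] id (eps k) kl (@hom_id _) eM _ z (gens_generates z)).
  move=> y yg; rewrite lk; have [xy xyd yE] : exists2 xy, xy \in dbl k & y = ev p xy.1.
    move: yg; rewrite /= => /mapP[[|[|[|//]]] _ ->].
    - by exists (rgen 0, rgen 0); rewrite ?evalw_gen // !inE eqxx.
    - by exists (rgen 1, wb k); rewrite ?evalw_gen // !inE eqxx ?orbT.
    - by exists (rgen 2, rgen 2 ++ rgen 2); rewrite ?evalw_gen // !inE eqxx ?orbT.
  by exists xy; rewrite // (dblP k) // yE.
(* Halving decreases the absolute value of a negative [i] except at [-1], the fixed point of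
   [2 i + 1]. *)
have bT n : forall i : int, (i < 0)%R -> (absz i <= n)%N -> T (hbase m (bi i)).
  elim: n => [|n IHn] i i0 iN; first by lia.
  case: (eqVneq i (-1)%R) => [->|i1].
    by rewrite -bm1 -jE //; apply: Tw; rewrite !inE eqxx orbT.
  pose k := odd (absz (i %% 2)%Z); pose i' := (i %/ 2)%Z.
  have Ei : (i = 2 * i' + k%:Z)%R by rewrite /i' /k; lia.
  rewrite Ei -(eps_bi _ (epsP k)) -(mulgK (gn d.1 (3 + k)) (hbase m _)) -tE.
  apply: (sgM TS); last exact: (sgV TS).
  by apply: (sgM TS) => //; apply: IHn; rewrite /i'; lia.
apply: (hom_subgen jM TS) => y [->|[i i0 <-]]; last exact: bT (leqnn _).
by rewrite -ga -(evalw_gen (gn p) 0) -jE //; exact: Tw.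
Qed.

(** * The subgroups [A_X] *)

Definition iota3 : F2 -> F3 := sval (cid F3_free).

Lemma iota3_free : free_with iota3 a3. Proof. by have [] := svalP (cid F3_free). Qed.
Lemma iota3M : hom iota3. Proof. exact: iota3_free.1. Qed.
Lemma iota3b : iota3 fb = b3. Proof. by have [] := svalP (cid F3_free). Qed.
Lemma iota3c : iota3 fc = c3. Proof. by have [] := svalP (cid F3_free). Qed.

Lemma iota3_bf f : iota3 (tf fb fc f) = bf f.
Proof. by rewrite (hom_tf _ _ _ iota3M) iota3b iota3c. Qed.

Lemma F2_model : exists k : F2 -> perms lser, [/\ hom k, k fb = pt & k fc = ps].
Proof. exact: F2_hom. Qed.

Definition lzero : lser.
Proof. by exists (fun=> 0%R); exists 0%R. Defined.

Lemma tf_model_inj (G : groupType) (k : G -> perms lser) t s f g :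
  hom k -> k t = pt -> k s = ps -> tf t s f = tf t s g -> f = g.
Proof.
move=> kM kt ks E; apply: calE_eq => i.
have := congr1 (fun p : perms lser => p lzero i) (congr1 k E).
by rewrite !(hom_tf _ _ _ kM) kt ks !tf_ps !add0r.
Qed.

Lemma fbc_inj f g : tf fb fc f = tf fb fc g -> f = g.
Proof. by have [k [kM kb kc]] := F2_model; exact: tf_model_inj kM kb kc. Qed.

Definition zsupp (f : calE) (I : set int) := forall i, f i != 0%R -> I i.

(** Conjugates with index in [I] fix the coefficients outside [I], and so does the group that they
    generate. *)
Lemma tf_model_supp (G : groupType) (k : G -> perms lser) t s (I : set int) f :
  hom k -> k t = pt -> k s = ps -> subgen [set tz t s i | i in I] (tf t s f) -> zsupp f I.
Proof.
move=> kM kt ks Sf i fi.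
pose T : set (perms lser) := [set p : perms lser | forall (h : lser) (j : int), ~ I j -> p h j = h j].
have TS : is_subgroup T.
  apply: is_subgroupM => [h j _|p Tp h j Ij|p q Tp Tq h j Ij] //.
    by rewrite -[in RHS](pinvK p h) -permsVE Tp.
  by rewrite permsME Tp // Tq.
have Tf : T (k (tf t s f)).
  apply: (hom_subgen kM TS _ Sf) => _ [j Ij <-] h l Il.
  rewrite (homJ kM) (homXz kM) kt ks tz_ps; case: eqP => [lj|_]; last exact: addr0.
  by case: Il; rewrite lj.
apply: contrapT => Ii; move: (Tf lzero i Ii); rewrite (hom_tf _ _ _ kM) kt ks tf_ps add0r.
by move/eqP; rewrite (negbTE fi).
Qed.

Lemma A_ofE X : A_of X = Nsub iota3 a3 [set tf fb fc f | f in X].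
Proof.
rewrite /A_of /Nsub; congr subgen; apply/seteqP; split=> x.
  by move=> [f Xf <-]; exists (tf fb fc f); [exists f | rewrite iota3_bf].
by move=> [_ [f Xf <-] <-]; exists f; rewrite // iota3_bf.
Qed.

Lemma A_of_in (X : set calE) f : X f -> A_of X (af f).
Proof. by move=> Xf; apply: subgen_in; exists f. Qed.

Lemma A_ofS (X Y : set calE) : X `<=` Y -> A_of X `<=` A_of Y.
Proof. by move=> XY; apply: subgenS => _ [f Xf <-]; exists f => //; exact: XY. Qed.

(** Since [f] is determined by its element of [F2], the intersection of conjugators in [NsubI] is
    again indexed by the functions common to [X] and [Y]. *)
Lemma A_ofI (X Y : set calE) : A_of (X `&` Y) = A_of X `&` A_of Y.
Proof.
apply/seteqP; split=> [x xXY|x []].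
  by split; apply: A_ofS xXY => f [].
rewrite !A_ofE => xX xY; apply: NsubS (NsubI iota3_free xX xY).
by move=> _ [[f Xf <-] [g Yg /fbc_inj E]]; exists f; rewrite // -E; split=> //; rewrite E.
Qed.

Lemma A_ofU (X Y : set calE) : A_of (X `|` Y) = subgen (A_of X `|` A_of Y).
Proof.
apply/seteqP; split; last first.
  apply: subgen_min; first exact: subgenP.
  by move=> x [] Hx; apply: A_ofS Hx => f Hf; [left|right].
apply: subgen_min; first exact: subgenP.
by move=> _ [f [] Hf <-]; apply: subgen_in; [left|right]; exact: A_of_in.
Qed.

(** Moving all [b_i] to the right leaves conjugates of [a] times an element of [P]; in this form
    [MsubI] applies to [Hset I]. *)
Lemma Hset_Msub (I : set int) (P := subgen [set tz fb fc i | i in I]) :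
  Hset I `<=` Msub iota3 a3 P P.
Proof.
have PS : is_subgroup P by exact: subgenP.
apply: subgen_min; first by apply: (Msub_subgroup iota3_free) => // r q; exact: (sgM PS).
move=> x [->|[i Ii <-]].
  apply: (Nsub_Msub iota3_free); first exact: sg1 PS.
  by have := @Nsub_in _ _ iota3 a3 P 1 (sg1 PS); rewrite (hom1 iota3M) conjg1.
have -> : bi i = iota3 (tz fb fc i) by rewrite (homJ iota3M) (homXz iota3M) iota3b iota3c.
by apply: Msub_lam; apply: subgen_in; exists i.
Qed.

(** Intersecting with [Hset I] restricts supports to [I]: both groups have the form [Msub], that of
    [A_of X] with trivial second factor. *)
Lemma A_of_Hset (X : set calE) (I : set int) x : A_of X x -> Hset I x ->
  A_of (X `&` [set f | zsupp f I]) x.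
Proof.
rewrite !A_ofE -(Msub1 iota3_free) => Ax /Hset_Msub Hx.
have := MsubI iota3_free Ax Hx.
have [k [kM kb kc]] := F2_model.
move=> Mx; rewrite -(Msub1 iota3_free); apply: MsubS Mx => [q [[f Xf <-] Pf]|q []//].
by exists f => //; split=> //; exact: tf_model_supp kM kb kc Pf.
Qed.

Lemma af_Hset (I : set int) f : zsupp f I -> Hset I (af f).
Proof.
move=> fI; apply: (sgJ (subgenP _)); first exact: Hset_a.
by apply: tf_in; [exact: subgenP | move=> i /fI; exact: Hset_b].
Qed.

Lemma matching_hom (Z G : groupType) (al be : Z -> G) (D : set Z) (M : nat -> set G) i j :
  is_subgroup D -> hom al -> hom be -> (forall z, al z = 1 <-> be z = 1) ->
  (forall z, D z -> (M i (al z) <-> M j (be z))) ->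
  matching M i j (fun x y => exists z, [/\ D z, x = al z & y = be z]).
Proof.
move=> DS alM beM E1 EM; split=> [|_ _ _ _ [z [Dz -> ->]] [z' [Dz' -> ->]]|_ _ [z [_ -> ->]]|_ _ [z [Dz -> ->]]].
- by exists 1; rewrite (hom1 alM) (hom1 beM); split=> //; exact: sg1 DS.
- exists (z / z'); rewrite alM beM (homV alM) (homV beM); split=> //; exact: DS.2.
- exact: E1.
- exact: EM.
Qed.

Lemma hom_inj1 (G H : groupType) (f : G -> H) : hom f -> injective f -> forall z, f z = 1 <-> z = 1.
Proof. by move=> fM fI z; split=> [E|->]; [apply: fI; rewrite E hom1 | exact: hom1]. Qed.

(** Conjugation by [c] would move [a] as well; a map fixing [a] and [c] shifts the function inside
    [af g] only. *)
Lemma shift_hom : exists2 sg : F3 -> F3, hom sg /\ injective sg & [/\ sg a3 = a3, sg b3 = b3 ^ c3,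
  sg c3 = c3 & forall f g : calE, (forall i, f i = g (i - 1)%R) -> sg (af g) = af f].
Proof.
have [s [sM sa sb sc]] := F3_hom a3 (b3 ^ c3) c3.
have [r [rM ra rb rc]] := F3_hom a3 (b3 ^ c3^-1) c3.
exists s; split=> //.
  apply: (can_inj (g := r)); apply: F3_ind; last by rewrite sc rc.
  - apply: is_subgroupM => /= [|x E|x y Ex Ey]; first by rewrite (hom1 sM) (hom1 rM).
      by rewrite (homV sM) (homV rM) E.
    by rewrite sM rM Ex Ey.
  - by rewrite /= sa ra.
  - by rewrite /= sb (homJ rM) rb rc conjgKV.
move=> f g E; rewrite /af (homJ sM) sa bfE (hom_tf _ _ _ sM) sb sc.
rewrite bfE -(tf_shift b3 c3 E) expz1 /=; congr (_ ^ _).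
have -> : tf b3 c3 g ^ c3 = tf (b3 ^ c3) (c3 ^ c3) g.
  by rewrite -(hom_tf b3 c3 g (h := conjg^~ c3)) // => x y; exact: conjMg.
by congr (tf _ _ _); rewrite conjgE mulKg.
Qed.

(** * Finitely supported functions, and the group of all [a_f] *)

Definition restrict (f : calE) (P : pred int) : calE := [fsfun i in finsupp f => if P i then f i else 0%R].

Lemma restrictE f P i : restrict f P i = if P i then f i else 0%R.
Proof.
by rewrite fsfunE; case: ifPn => //; rewrite memNfinsupp => /eqP ->; rewrite if_same.
Qed.

Definition delta (k n : int) : calE := [fsfun i in [fset k]%fset => n].

Lemma deltaE k n i : delta k n i = if i == k then n else 0%R.
Proof. by rewrite fsfunE inE. Qed.

Lemma af0 : af (delta 0 0) = a3.
Proof. by rewrite /af bfE tf0 ?conjg1 // => i; rewrite deltaE if_same. Qed.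

Lemma shiftE (f : calE) (k : int) : exists g : calE, forall i, g i = f (i - k)%R.
Proof.
have [N fN] := supp_bound f; apply: (@mkE _ (N + absz k)%N) => i /fN; lia.
Qed.

Lemma addE (f g : calE) : exists h : calE, forall i, h i = (f i + g i)%R.
Proof.
have [N1 fN] := supp_bound f; have [N2 gN] := supp_bound g.
apply: (@mkE _ (N1 + N2)%N) => i hi; case: (eqVneq (f i) 0%R) => [f0|/fN]; last by lia.
by move: hi; rewrite f0 add0r => /gN; lia.
Qed.

(** No index of the support exceeds [k], so the new power is appended at the right end of the
    product. *)
Lemma tf_delta (G : groupType) (t s : G) (f g : calE) k n : (forall i, f i != 0%R -> (i <= k)%R) ->
  (forall i, g i = f i + delta k n i)%R -> tf t s g = tf t s f * expz (tz t s k) n.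
Proof.
move=> fk E; pose f1 := restrict f (fun i => (i < k)%R).
have f1k i : f1 i != 0%R -> (i < k)%R by rewrite restrictE; case: ltrP.
have dk c i : delta k c i != 0%R -> (k <= i)%R.
  by rewrite deltaE; case: (eqVneq i k) => [->//|_]; rewrite eqxx.
have fE i : f i = (f1 i + delta k (f k) i)%R.
  rewrite restrictE deltaE; case: (ltgtP i k) => [_|ki|->]; rewrite ?addr0 ?add0r //.
  by apply/eqP; apply: contraTT ki => /fk; rewrite -leNgt.
have gE i : g i = (f1 i + delta k (f k + n) i)%R.
  by rewrite E fE -addrA; congr (_ + _)%R; rewrite !deltaE; case: eqP => // _; rewrite addr0.
have td c : tf t s (delta k c) = expz (tz t s k) c by apply: tf1; exact: deltaE.
rewrite (tf_append t s f1k (dk _) gE) (tf_append t s f1k (dk _) fE) !td expzD.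
by rewrite mulgA.
Qed.

Lemma af_delta (f g : calE) k n : (forall i, f i != 0%R -> (i <= k)%R) ->
  (forall i, g i = f i + delta k n i)%R -> af g = af f ^ expz (bi k) n.
Proof. by move=> fk E; rewrite /af -conjgM !bfE (tf_delta b3 c3 fk E). Qed.

Definition Eneg : set calE := [set f | zsupp f negs].
Definition Enonpos : set calE := [set f | zsupp f [set i | (i <= 0)%R]].

(* Sheets 0, 2 and 3 carry [A_X] for [X] the set of all functions, of those supported on
   the negative and on the nonpositive indices. The letters of index 2 and 3 shift
   sheet 2 onto sheet 3 and conjugate sheet 3 by [b_0]; that of index 1 compares the two
   sheets on [Hset negs], so that all functions with negative support are reached. *)
Lemma A_E_datum : exists2 d : datum, True &
  exists2 f : F3 -> grp d.1, dfor gens3 f (A_of setT) & injective f.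
Proof.
have [d0 _ [f0 D0 f0I]] := Hset_neg_datum.
have pw := dfor_wfp D0; have gw := dfor_wfg D0; have Lw := dfor_wfL D0.
have f0M := dforM D0; have sz := dfor_size D0.
pose p := d0.1; pose W i := nth [::] d0.2.1 i.
have Ww i : i < 3 -> wf p.1 (W i) by move=> i3; apply: (allP gw); rewrite mem_nth ?sz.
have Wa : ev p (W 0) = f0 a3 by rewrite -(dfor_gen D0 (i := 0)).
have Wb : ev p (W 1%N) = f0 b3 by rewrite -(dfor_gen D0 (i := 1)).
have Wc : ev p (W 2) = f0 c3 by rewrite -(dfor_gen D0 (i := 2)).
have [sg [sghM sgI] [sga sgb sgc sgE]] := shift_hom.
pose psg := [:: (W 0, W 0); (W 1%N, wconj (W 1%N) (W 2)); (W 2, W 2)].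
pose pbe := [seq (W i, wconj (W i) (W 1%N)) | i <- iota 0 3].
pose ls := [:: diagp d0.2.2; diagp d0.2.2; psg; pbe; psg].
pose lab k := nth (0%N, 0%N) [:: (2, 0%N); (2, 3); (2, 3); (3, 3); (0%N, 0%N)] k.
pose S i : set F3 := nth setT [:: A_of setT; setT; A_of Eneg; A_of Enonpos] i.
have SS i : is_subgroup (S i) by case: i => [|[|[|[|i]]]]; rewrite /S /= ?nth_nil; first [exact: subgenP | exact: is_subgroupT].
pose M i : set (grp p) := f0 @` (S i).
have MS i : is_subgroup (M i) by exact: is_subgroup_im.
have Mf i z : M i (f0 z) <-> S i z by split=> [[z' Sz /f0I <-]//|Sz]; exists z.
have psgw : wfps p.1 psg by rewrite /wfps /= /wconj !wf_cat wf_rinv !Ww.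
have pbew : wfps p.1 pbe by rewrite /wfps /= /wconj !wf_cat wf_rinv !Ww.
have Lw' : wfps p.1 (diagp d0.2.2) by rewrite wfps_diagp.
have lsw : all (wfps p.1) ls by apply/and5P; split=> //; rewrite psgw.
have bM : hom (conjg^~ b3) by move=> x y; exact: conjMg.
have psgE xy : xy \in psg -> exists z, [/\ True, ev p xy.1 = f0 z & ev p xy.2 = f0 (sg z)].
  rewrite !inE => /or3P[] /eqP ->.
  - by exists a3; rewrite sga.
  - by exists b3; rewrite evalw_conj Wb Wc sgb (homJ f0M).
  - by exists c3; rewrite sgc.
have pbeE xy : xy \in pbe -> exists z, [/\ True, ev p xy.1 = f0 z & ev p xy.2 = f0 (z ^ b3)].
  rewrite !inE => /or3P[] /eqP ->; rewrite evalw_conj Wb.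
  - by exists a3; rewrite Wa (homJ f0M).
  - by exists b3; rewrite (homJ f0M).
  - by exists c3; rewrite Wc (homJ f0M).
have inter_neg X z : A_of X z -> Hset negs z -> A_of (X `&` Eneg) z by exact: A_of_Hset.
have sub_neg X z : A_of Eneg z -> Eneg `<=` X -> A_of X z by move=> + EX; exact: A_ofS.
have im_inj (th : F3 -> F3) X Y : hom th -> injective th ->
    (forall f, X f -> exists2 g, Y g & th (af f) = af g) ->
    (forall g, Y g -> exists2 f, X f & th (af f) = af g) ->
    forall z, A_of X z <-> A_of Y (th z).
  move=> thM thI XY YX z; split.
    by apply: (hom_subgen thM (subgenP _)) => _ [f Xf <-]; have [g Yg ->] := XY f Xf; exact: A_of_in.
  have : A_of Y `<=` th @` (A_of X).
    apply: subgen_min; first exact: (is_subgroup_im thM (subgenP _)).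
    by move=> _ [g /YX[f Xf <-] <-]; exists (af f) => //; exact: A_of_in.
  by move=> + Yz => /(_ _ Yz)[z' Xz' /thI <-].
have sgEx (f : calE) (k : int) : exists g : calE, forall i, g i = f (i - k)%R by exact: shiftE.
have [k kl|m] := @hnn_modelP p ls M lab pw lsw MS.
  have idP i j : (forall z, Hset negs z -> (S i z <-> S j z)) ->
      matching M i j (fun x y => x = y /\ dsub x).
    move=> H; apply: matching_id; first exact: subgenP.
    move=> x Dx; split=> -[z Sz E]; rewrite -E in Dx *; have Hz := proj1 (dfor_sub D0 z) Dx.
      by apply/Mf/(H z Hz).
    by apply/Mf/(H z Hz).
  have idE xy : xy \in diagp d0.2.2 -> ev p xy.1 = ev p xy.2 /\ dsub (ev p xy.1).
    by move=> /mem_diagp[xL ->]; split=> //; apply: subgen_in; exists xy.1.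
  have homP th i j : hom th -> injective th -> (forall z, S i z <-> S j (th z)) ->
      matching M i j (fun x y => exists z, [/\ setT z, x = f0 z & y = f0 (th z)]).
    move=> thM thI H; apply: matching_hom => //; first exact: hom_comp thM f0M.
      move=> z; rewrite (hom_inj1 f0M f0I) -(hom_inj1 thM thI) -(hom_inj1 f0M f0I) //.
    by move=> z _; rewrite !Mf.
  case: k kl => [|[|[|[|[|//]]]]] _.
  - exists (fun x y => x = y /\ dsub x); last exact: idE.
     apply: idP => z Hz; split; first by move=> /sub_neg; apply.
    by move=> /inter_neg/(_ Hz); apply: A_ofS => f [].
  - exists (fun x y => x = y /\ dsub x); last exact: idE.
     apply: idP => z Hz; split.
      by move=> /sub_neg; apply=> f fn i /fn; rewrite /negs /=; lia.
    by move=> /inter_neg/(_ Hz); apply: A_ofS => f [].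
  - exists (fun x y => exists z, [/\ setT z, x = f0 z & y = f0 (sg z)]); last exact: psgE.
     apply: homP => //; apply: im_inj => // f fn.
      have [g gE] := sgEx f 1%R; exists g; last exact: sgE.
      by move=> i; rewrite gE => /fn; rewrite /negs /=; lia.
    have [g gE] := sgEx f (-1)%R; exists g.
      by move=> i; rewrite gE => /fn; rewrite /negs /=; lia.
    by apply: sgE => i; rewrite gE; congr (f _); lia.
  - exists (fun x y => exists z, [/\ setT z, x = f0 z & y = f0 (z ^ b3)]); last exact: pbeE.
     apply: homP => //; first exact: conjg_inj.
    have beE n (f g : calE) : Enonpos f -> (forall i, g i = f i + delta 0 n i)%R ->
        Enonpos g /\ af g = af f ^ expz b3 n.
      move=> fn E; split.
        move=> i; rewrite E deltaE; case: (eqVneq i 0%R) => [->|_]; first by rewrite /=.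
        by rewrite addr0 => /fn.
      have b0 : bi 0%R = b3 by rewrite /bi conjg1.
      by rewrite (af_delta (k := 0%R) fn E) b0.
    apply: im_inj => //; first exact: conjg_inj.
      move=> f fn; have [g gE] := addE f (delta 0%R 1%R); exists g.
        exact: (beE _ _ _ fn gE).1.
      by rewrite (beE _ _ _ fn gE).2.
    move=> g gn; have [f fE] := addE g (delta 0%R (-1)%R); exists f.
      exact: (beE _ _ _ gn fE).1.
    by rewrite (beE _ _ _ gn fE).2 /= expg1 conjgKV.
  - exists (fun x y => exists z, [/\ setT z, x = f0 z & y = f0 (sg z)]); last exact: psgE.
     apply: homP => //; apply: im_inj => // f _.
      have [g gE] := sgEx f 1%R; exists g => //; exact: sgE.
    have [g gE] := sgEx f (-1)%R; exists g => //.
    by apply: sgE => i; rewrite gE; congr (f _); lia.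
pose q := hnnp p ls; pose j := hbase m; have jM : hom j by exact: hbaseM.
have jE w : wf p.1 w -> ev q w = j (ev p w) by move=> ww; rewrite /j hbase_ev.
pose t k := gn q (p.1 + k); pose wt k := rgen (p.1 + k).
have tE k : ev q (wt k) = t k by rewrite evalw_gen.
pose cw (u : rword) v := v ++ u ++ rinv v.
have cwE u v : ev q (cw u v) = ev q v * ev q u * (ev q v)^-1.
  by rewrite !evalw_cat evalw_inv mulgA.
(* Loops at sheet 0, reached from sheet 2 by letter 0. The third word brings the conjugation letter
   of sheet 3 back through the shift letter; the fourth goes from sheet 2 to 3 by letter 1 and
   returns by the inverse shift. *)
pose L := [:: W 0; wt 4; cw (cw (wt 3) (rinv (wt 2))) (wt 0); cw (rinv (wt 2) ++ wt 1%N) (wt 0)].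
pose d : datum := (q, (d0.2.1, L)).
pose T := @dsub d; have TS : is_subgroup T by exact: subgenP.
have Tw w : w \in L -> T (ev q w) by move=> wL; apply: subgen_in; exists w.
have f'M : hom (j \o f0) by exact: hom_comp f0M jM.
have gt k : k < 5 -> goes m (lab k).1 (lab k).2 (t k) by exact: (goes_letter m (k := k)).
exists d => //; exists (j \o f0); last first.
  by apply: inj_comp => //; exact: hbase_inj.
split => //.
- apply/and3P; split; first exact: wfp_hnnp.
    by apply: (all_wf_leq (leq_addr _ _)).
  have wtw k : k < 5 -> wf q.1 (wt k) by move=> k5; rewrite /wf /= ltn_add2l k5.
  have Waw : wf q.1 (W 0) by apply: (wf_leq (leq_addr _ _)); exact: Ww.
  by apply/and5P; split=> //; rewrite ?/cw ?(wf_cat, wf_rinv) ?wtw.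
- by move=> i ig; rewrite /d /= (dfor_gen D0) // jE // Ww.
move=> x; split=> [Tx|Ax].
  apply/(Mf 0)/(goes_base MS m 0); apply: (subgen_min (goes_loops m 0) _ Tx) => y [w + ->].
  rewrite !inE => /or4P[] /eqP ->.
  - by rewrite jE ?Ww //; apply/goes_base => //; rewrite Wa; apply/Mf;
      rewrite -af0; exact: A_of_in.
  - by rewrite tE; exact: (gt 4).
  - rewrite !cwE !evalw_inv !tE invgK.
    apply: goesM (goesV (gt 0 isT)); apply: goesM (gt 0 isT) _.
    by apply: goesM (gt 2 isT); apply: goesM (goesV (gt 2 isT)) (gt 3 isT).
  - rewrite cwE evalw_cat evalw_inv !tE.
    apply: goesM (goesV (gt 0 isT)); apply: goesM (gt 0 isT) _.
    by apply: goesM (goesV (gt 2 isT)) (gt 1%N isT).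
pose f' z := j (f0 z).
(* [T2] and [T3] are the subgroup [T] as seen from sheets 2 and 3. *)
pose T2 := [set z | T (t 0 * z * (t 0)^-1)]; pose T3 := [set z | T2 ((t 2)^-1 * z * t 2)].
have mulJ u v w : u * (v * w) * u^-1 = (u * v * u^-1) * (u * w * u^-1) :> grp q.
  by rewrite !mulgA mulgVK.
have T2S : is_subgroup T2.
  apply: (is_subgroup_preim (f := fun z => t 0 * z * (t 0)^-1)) => // u v; exact: mulJ.
have T3S : is_subgroup T3.
  apply: (is_subgroup_preim (f := fun z => (t 2)^-1 * z * t 2)) => // u v.
  by rewrite -{2 4 6}[t 2]invgK; exact: mulJ.
have Tbe : T3 (t 3).
  have := @Tw (cw (cw (wt 3) (rinv (wt 2))) (wt 0)).
  by rewrite !cwE !evalw_inv !tE invgK; apply; rewrite !inE eqxx !orbT.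
have Tv : T2 ((t 2)^-1 * t 1%N).
  have := @Tw (cw (rinv (wt 2) ++ wt 1%N) (wt 0)).
  by rewrite cwE evalw_cat evalw_inv !tE; apply; rewrite !inE eqxx !orbT.
have Tsh : T (t 4) by rewrite -tE; apply: Tw; rewrite !inE eqxx ?orbT.
have idC k z : k < 2 -> Hset negs z -> t k * f' z = f' z * t k.
  move=> k2 /(dfor_sub D0) Dz.
  apply: (@hletter_gen p ls M lab m k _ _ id id _ (@hom_id _) (@hom_id _) _ _ Dz).
    by case: k k2 => [|[]].
  move=> y [w wL ->]; exists (w, w) => //; have -> : nth [::] ls k = diagp d0.2.2.
    by case: k k2 => [|[]].
  exact: diag_mem.
have sgC k z : k \in [:: 2; 4] -> t k * f' z = f' (sg z) * t k.
  move=> k24; apply: (@hletter_gen p ls M lab m k F3 [set` gens3] f0 (f0 \o sg)) => //.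
  - by move: k24; rewrite !inE => /orP[] /eqP ->.
  - exact: hom_comp sghM f0M.
  - have -> : nth [::] ls k = psg by move: k24; rewrite !inE => /orP[] /eqP ->.
    move=> y /=; rewrite !inE => /or3P[] /eqP ->.
    + by exists (W 0, W 0); rewrite ?inE ?eqxx //= Wa sga.
    + exists (W 1%N, wconj (W 1%N) (W 2)); rewrite ?inE ?eqxx ?orbT //=.
      by rewrite evalw_conj Wb Wc sgb (homJ f0M).
    + by exists (W 2, W 2); rewrite ?inE ?eqxx ?orbT //= Wc sgc.
  - exact: F3_gen.
have beC z : t 3 * f' z = f' (z ^ b3) * t 3.
  apply: (@hletter_gen p ls M lab m 3 F3 [set` gens3] f0 (f0 \o conjg^~ b3)) => //.
  - exact: hom_comp bM f0M.
  - move=> y /=; rewrite !inE => /or3P[] /eqP ->.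
    + by exists (W 0, wconj (W 0) (W 1%N)); rewrite ?inE ?eqxx //= evalw_conj Wa Wb (homJ f0M).
    + by exists (W 1%N, wconj (W 1%N) (W 1%N)); rewrite ?inE ?eqxx ?orbT //= evalw_conj Wb (homJ f0M).
    + by exists (W 2, wconj (W 2) (W 1%N)); rewrite ?inE ?eqxx ?orbT //= evalw_conj Wc Wb (homJ f0M).
  - exact: F3_gen.
have conjC (u v w : grp q) : u * v = w * u -> u * v * u^-1 = w by move=> ->; rewrite mulgK.
have T2T z : Hset negs z -> T2 (f' z) <-> T (f' z).
  by move=> Hz; rewrite /T2 /= (conjC _ _ (f' z)) //; exact: idC.
have T23 z : Hset negs z -> T2 (f' z) -> T3 (f' z).
  move=> Hz Tz; rewrite /T3 /=.
  have : T2 (((t 2)^-1 * t 1%N) * f' z * ((t 2)^-1 * t 1%N)^-1).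
    by apply: (sgM T2S); [apply: (sgM T2S) | exact: (sgV T2S)].
  have -> // : (t 2)^-1 * t 1%N * f' z * ((t 2)^-1 * t 1%N)^-1 = (t 2)^-1 * f' z * t 2.
  by rewrite invgM invgK -!mulgA [t 1%N * _]mulgA idC // -!mulgA mulVKg.
have T3s z : T3 (f' (sg z)) <-> T2 (f' z).
  rewrite /T3 /=; have -> // : (t 2)^-1 * f' (sg z) * t 2 = f' z.
  by rewrite -mulgA -(sgC 2) // mulKg.
have T3b z n : T3 (f' z) -> T3 (f' (z ^ expz b3 n)).
  have E y k : T3 (t 3 * f' y * (t 3)^-1) <-> T3 (f' (y ^ b3)) /\ k = k :> nat.
    by rewrite (conjC _ _ (f' (y ^ b3))) //; split=> [|[]].
  move=> Tz; elim/int_rect: n => [|n IHn|n IHn]; first by rewrite conjg1.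
    rewrite -addn1 PoszD expzS conjgM; apply: (proj1 (proj1 (E _ 0) _)).
    by apply: (sgM T3S); [apply: (sgM T3S) | exact: (sgV T3S)].
  rewrite -addn1 PoszD opprD expzP conjgM.
  have -> : f' ((z ^ expz b3 (- n%:Z)%R) ^ b3^-1) = (t 3)^-1 * f' (z ^ expz b3 (- n%:Z)%R) * t 3.
    by rewrite -{2}[z ^ _](conjgKV b3) -mulgA -beC mulKg.
  by apply: (sgM T3S) => //; apply: (sgM T3S) => //; exact: (sgV T3S).
have Ta : T (f' a3) by rewrite /f' -Wa -jE ?Ww //; apply: Tw; rewrite inE eqxx.
(* Induction on the length of the support: a shift by one puts the last value at index 0, where a
   power of the conjugation letter produces it; the rest [h] is negative again. *)
have Tneg N : forall f : calE, Eneg f -> (forall i, f i != 0%R -> (- N%:Z <= i)%R) -> T2 (f' (af f)).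
  elim: N => [|N IHN] f fn fN.
    have f0' i : f i = 0%R.
      apply/eqP; apply: contraT => fi; move: (fN _ fi) (fn _ fi); rewrite /negs /=; lia.
    rewrite /af bfE tf0 // conjg1; apply/T2T => //; exact: Hset_a.
  have [g gE] := sgEx f 1%R; apply/T3s; rewrite (sgE _ _ gE).
  pose h := restrict g (fun i => (i < 0)%R).
  have hn : Eneg h by move=> i; rewrite restrictE /negs /=; case: ifP.
  have Th : T2 (f' (af h)).
    apply: IHN => // i; rewrite restrictE; case: ifP => // i0.
    by rewrite gE => /fN; lia.
  have -> : af g = af h ^ expz b3 (g 0%R).
    have b0 : bi 0%R = b3 by rewrite /bi conjg1.
    rewrite -b0; apply: af_delta => i; first by move=> /hn; rewrite /negs /=; lia.
    rewrite restrictE deltaE; case: (ltgtP i 0%R) => [_|i0|->]; rewrite ?addr0 ?add0r //.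
    apply/eqP; apply: contraTT i0 => gi; rewrite -leNgt.
    by move: gi; rewrite gE => /fn; rewrite /negs /=; lia.
  by apply: T3b; apply: T23 Th; exact: af_Hset hn.
have Tsg z : T (f' (sg z)) <-> T (f' z).
  rewrite -[f' (sg z)](mulgK (t 4)) -sgC //.
  split=> [Tz|Tz]; last by apply: (sgM TS); [apply: (sgM TS) | exact: (sgV TS)].
  have -> : f' z = (t 4)^-1 * (t 4 * f' z * (t 4)^-1) * t 4.
    by rewrite !mulgA mulVg mul1g mulgVK.
  by apply: (sgM TS) => //; apply: (sgM TS) => //; exact: (sgV TS).
(* Letter 4 shifts sheet 0 to itself, so the support can be moved to the left until it is
   negative. *)
have Tn n : forall f : calE, (forall i, f i != 0%R -> (i < n%:Z)%R) -> T (f' (af f)).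
  elim: n => [|n IHn] f fn.
    have [N fN] := supp_bound f.
    apply/T2T; first by apply: af_Hset => i /fn.
    by apply: (Tneg N) => [i /fn //|i /fN]; lia.
  have [g gE] := sgEx f (-1)%R.
  rewrite -(sgE f g) => [|i]; last by rewrite gE; congr (f _); lia.
  by apply/Tsg; apply: IHn => i; rewrite gE => /fn; lia.
have AT : A_of setT `<=` f' @^-1` T.
  apply: subgen_min; first exact: is_subgroup_preim.
  move=> _ [f _ <-]; have [N fN] := supp_bound f.
  by apply: (Tn N) => i /fN; lia.
exact: AT Ax.
Qed.

(** * Operations given by a double coset relation *)

Section PullBack.
Variables (Q G : groupType) (iota : Q -> G) (a : G) (vb vc : Q) (psi : F3 -> G).
Hypotheses (free : free_with iota a) (pM : hom psi).
Hypotheses (pa : psi a3 = a) (pb : psi b3 = iota vb) (pc : psi c3 = iota vc).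
Hypothesis vI : forall f g, tf vb vc f = tf vb vc g -> f = g.

Lemma psi_af f : psi (af f) = a ^ iota (tf vb vc f).
Proof. by rewrite /af (homJ pM) bfE (hom_tf _ _ _ pM) pa pb pc -(hom_tf _ _ _ free.1). Qed.

(** Although [psi] may identify elements of [F3], on the group of all [a_f] it is undone by an
    action in which the conjugate of [a] by [v_f] multiplies the fibre over 1 by [a_f]. *)
Lemma pull_back (Y : set calE) x : A_of setT x ->
  Nsub iota a [set tf vb vc f | f in Y] (psi x) -> A_of Y x.
Proof.
move=> Ax Nx.
pose alpha q : F3 := if pselect (exists f, tf vb vc f = q) is left P then af (sval (cid P)) else 1.
have alphaE f : alpha (tf vb vc f) = af f.
  rewrite /alpha; case: pselect => [P|[]]; last by exists f.
  by congr af; apply: vI; exact: svalP (cid P).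
have [K [KM Kq Ka]] := fibre_action free alpha.
have KE := fibre_conj free KM Kq Ka.
have E1 : forall s, K (psi x) (1, s) = (1, x * s).
  apply: (subgen_min (regular_subgroup (pair 1) (hom_comp pM KM) (@hom_id F3)) _ Ax).
  by move=> _ [f _ <-] s; rewrite /= psi_af KE alphaE.
have [w Yw E2] : exists2 w, A_of Y w & forall s, K (psi x) (1, s) = (1, w * s).
  apply: (subgen_min (regular_in_subgroup (pair 1) KM (subgenP _)) _ Nx).
  move=> _ [_ [f Yf <-] <-]; exists (af f) => [|s]; first exact: A_of_in.
  by rewrite KE alphaE.
by have := E1 1; rewrite E2 !mulg1 => -[<-].
Qed.

End PullBack.

Definition linop (q : rpres) (ub uc vb vc : rword) (S : seq rword) (dE d : datum) : datum :=
  interd (pulld [:: rgen q.1; vb; vc] (ijd (freep q) [:: rgen q.1; ub; uc] S d)) dE.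

(* With [u_g = tf ub uc g], [v_f = tf vb vc f] and [Lam] generated by [gS], the relation
   [R g f] says that [u_g * Lam = v_f * Lam]. *)
Record gadget (R : calE -> calE -> Prop) := Gadget {
  gq : rpres; gub : rword; guc : rword; gvb : rword; gvc : rword; gS : seq rword;
  gqw : wfp gq;
  gww : all (wf gq.1) [:: gub, guc, gvb, gvc & gS];
  gvI : forall f g, tf (ev gq gvb) (ev gq gvc) f = tf (ev gq gvb) (ev gq gvc) g -> f = g;
  gR : forall g f, R g f <->
    subgen [set x | exists2 w, w \in gS & x = ev gq w]
      ((tf (ev gq gub) (ev gq guc) g)^-1 * tf (ev gq gvb) (ev gq gvc) f)
}.

Lemma gens3_generates : generates gens3. Proof. exact: F3_gen. Qed.

Section Linop.
Variables (R : calE -> calE -> Prop) (gd : gadget R).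
Variables (dE : datum) (fE : F3 -> grp dE.1).
Hypotheses (DE : dfor gens3 fE (A_of setT)) (fEI : injective fE).

Let q := gq gd.

Lemma ev_freep w (iota : grp q -> grp (freep q)) : hom iota ->
  (forall i, i < q.1 -> iota (gn q i) = gn (freep q) i) -> wf q.1 w ->
  ev (freep q) w = iota (ev q w).
Proof. by move=> iM iE ww; rewrite (hom_evalw _ _ iM); apply/esym; exact: eq_evalw ww. Qed.

(** The join lies in [Msub R0 Lam] with [R0] the union of the cosets [u_g Lam], and [psi] maps the
    group of all [a_f] to conjugates by the [v_h]. By [MsubI] only those [v_h] survive that lie in
    some [u_g Lam], which is the relation [R g h]. *)
Lemma linopP (X : set calE) d (f : F3 -> grp d.1) : dfor gens3 f (A_of X) ->
  exists2 f' : F3 -> grp (linop q (gub gd) (guc gd) (gvb gd) (gvc gd) (gS gd) dE d).1,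
    dfor gens3 f' (A_of [set f | exists2 g, X g & R g f]) & injective f'.
Proof.
move=> D; have qw := gqw gd; have fqw := wfp_freep qw.
have [iota free iE] := freep_free qw; have iM := free.1.
have /and5P[ubw ucw vbw vcw Sw] := gww gd.
set a := gn (freep q) q.1 in free.
have evE w : wf q.1 w -> ev (freep q) w = iota (ev q w) by exact: ev_freep.
have up w : wf q.1 w -> wf (freep q).1 w by apply: wf_leq.
have [phi [phM pha phb phc]] := F3_hom a (iota (ev q (gub gd))) (iota (ev q (guc gd))).
have [psi [psM psa psb psc]] := F3_hom a (iota (ev q (gvb gd))) (iota (ev q (gvc gd))).
have aw : wf (freep q).1 (rgen q.1) by rewrite /wf /= ltnSn.
pose Y := [set f | exists2 g, X g & R g f].
have [|||||f1 D1 _] := @ijdP F3 gens3 d f (A_of X) gens3_generates D (freep q)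
    [:: rgen q.1; gub gd; guc gd] (gS gd) phi fqw.
- by apply/and4P; split=> //; exact: up.
- by apply: sub_all Sw => w; exact: up.
- by [].
- exact: phM.
- case=> [|[|[|//]]] _; rewrite ?[nth 1 _ _]/= ?[nth [::] _ _]/=.
  + by rewrite evalw_gen.
  + by rewrite phb evE.
  + by rewrite phc evE.
have [|i ig|w1 s1 M1 g1 S1] := @pulldP _ F3 _ gens3 psi [:: rgen q.1; gvb gd; gvc gd] _ f1 _ D1 psM.
- by [].
- rewrite size_gens.
  have e w : wf (freep q).1 w -> evalw (nth 1 (gens (freep q))) w = ev (freep q) w.
    by apply: eq_evalw => l lq; exact: nth_gens.
  case: i ig => [|[|[|//]]] _; rewrite ?[nth 1 _ _]/= ?[nth [::] _ _]/=; split.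
  + exact: aw.
  + by rewrite e // evalw_gen.
  + exact: up.
  + by rewrite e ?up // psb evE.
  + exact: up.
  + by rewrite e ?up // psc evE.
have D2 := Dfor w1 s1 M1 g1 S1.
have [f3 D3 f3I] := interdP D2 DE; exists f3; last by apply: f3I; right.
have -> : A_of Y = psi @^-1` subgen (phi @` A_of X `|`
    [set x | exists2 w, w \in gS gd & x = ev (freep q) w]) `&` A_of setT; last exact: D3.
set J := subgen (_ `|` _); have JS : is_subgroup J by exact: subgenP.
pose u g := tf (ev q (gub gd)) (ev q (guc gd)) g.
pose v g := tf (ev q (gvb gd)) (ev q (gvc gd)) g.
pose Lam : set (grp q) := subgen [set x | exists2 w, w \in gS gd & x = ev q w].
have LS : is_subgroup Lam by exact: subgenP.
have phE g : phi (af g) = a ^ iota (u g) by exact: (psi_af free phM pha phb phc).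
have psE g : psi (af g) = a ^ iota (v g) by exact: (psi_af free psM psa psb psc).
apply/seteqP; split=> x.
  move=> Yx; split; last by apply: A_ofS Yx.
  apply: (hom_subgen psM JS _ Yx) => _ [h [g Xg Rgh] <-].
  rewrite psE; have -> : v h = u g * ((u g)^-1 * v h) by rewrite mulVKg.
  move/(gR gd): Rgh; rewrite -/(u g) -/(v h); set lam := _ * v h => Ll.
  rewrite iM conjgM -phE; apply: (sgJ JS).
    by apply: subgen_in; left; exists (af g) => //; exact: A_of_in.
  apply: (hom_subgen iM JS _ Ll) => _ [w wS ->].
  by apply: subgen_in; right; exists w; rewrite // evE // (allP Sw).
move=> [Jx Ax]; apply: (pull_back free psM psa psb psc (@gvI _ gd)) => //.
pose R0 : set (grp q) := [set r | exists g lam, [/\ X g, Lam lam & r = u g * lam]].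
have JM : J `<=` Msub iota a R0 Lam.
  apply: subgen_min.
    apply: (Msub_subgroup free) => // r l [g [lam [Xg Ll ->]]] Ll'.
    by exists g, (lam * l); rewrite mulgA; split=> //; exact: (sgM LS).
  move=> _ [[y Xy <-]|[w wS ->]].
    apply: (Nsub_Msub free); first exact: sg1 LS.
    apply: (hom_subgen phM (subgenP _) _ Xy) => _ [g Xg <-].
    rewrite phE; apply: Nsub_in; exists g, 1; rewrite mulg1; split=> //; exact: sg1 LS.
  rewrite evE ?(allP Sw) //; apply: Msub_lam; apply: subgen_in; by exists w.
have Nx : Msub iota a [set v h | h in setT] [set 1] (psi x).
  rewrite (Msub1 free); apply: (hom_subgen psM (subgenP _) _ Ax) => _ [h _ <-].
  by rewrite psE; apply: Nsub_in; exists h.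
have := MsubI free (JM _ Jx) Nx.
move=> Mx; rewrite -(Msub1 free); apply: MsubS Mx => [_ [[g [lam [Xg Ll ->]]] [h _ E]]|l []//].
exists h => //; exists g => //; apply/(gR gd); rewrite -/(u g) -/(v h) E mulKg //.
Qed.

End Linop.

(** A benign [L] is cut out by a finitely generated group in the larger group of its datum, so that
    group can take the place of [q]. *)
Lemma gadget_of_datum (R : calE -> calE -> Prop) (q : rpres) (ub uc vb vc : rword) (L : set (grp q))
    d (h : grp q -> grp d.1) :
  wfp q -> all (wf q.1) [:: ub; uc; vb; vc] -> dfor (gens q) h L -> injective h ->
  (forall f g, tf (ev q vb) (ev q vc) f = tf (ev q vb) (ev q vc) g -> f = g) ->
  (forall g f, R g f <-> L ((tf (ev q ub) (ev q uc) g)^-1 * tf (ev q vb) (ev q vc) f)) ->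
  inhabited (gadget R).
Proof.
move=> qw /and5P[ubw ucw vbw vcw _] D hI vI RE; have hM := dforM D.
have hev w : wf q.1 w -> ev d.1 (substw d.2.1 w) = h (ev q w).
  move=> ww; rewrite evalw_substw (hom_evalw _ _ hM); apply: eq_evalw ww => i iq.
  by rewrite -(dfor_gen D) ?size_gens //= nth_gens.
have htf y z f : wf q.1 y -> wf q.1 z ->
    tf (ev d.1 (substw d.2.1 y)) (ev d.1 (substw d.2.1 z)) f = h (tf (ev q y) (ev q z) f).
  by move=> yw zw; rewrite !hev // (hom_tf _ _ _ hM).
constructor; apply: (@Gadget R d.1 (substw d.2.1 ub) (substw d.2.1 uc) (substw d.2.1 vb)
  (substw d.2.1 vc) d.2.2 (dfor_wfp D)).
- by have gw := dfor_wfg D; apply/and5P; split; rewrite ?wf_substw //; exact: dfor_wfL D.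
- by move=> f g; rewrite !htf // => /hI /vI.
- by move=> g f; rewrite !htf // RE -(dfor_sub D) hM (homV hM).
Qed.

(** * Coordinates in [pB] and the operations with explicit [Lam] *)

Definition Bt : grp pB := gn pB 0.
Definition Bs : grp pB := gn pB 1.
Definition tB : calE -> grp pB := tf Bt Bs.
Definition EB : set (grp pB) := subgen (range (tz Bt Bs)).

Definition kB : grp pB -> perms lser := sval (cid lser_model).
Lemma kBM : hom kB. Proof. by have [] := svalP (cid lser_model). Qed.
Lemma kBt : kB Bt = pt. Proof. by have [] := svalP (cid lser_model). Qed.
Lemma kBs : kB Bs = ps. Proof. by have [] := svalP (cid lser_model). Qed.

(** The [i]-th coefficient of the series that [x] makes of zero; on [EB] it is additive, and the
    coefficients determine the element. *)
Definition val0 (x : grp pB) (i : int) : int := kB x lzero i.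

Lemma kB_tz i h j : kB (tz Bt Bs i) h j = (h j + (j == i)%:Z)%R.
Proof. by rewrite (homJ kBM) (homXz kBM) kBt kBs tz_ps. Qed.

Lemma kB_tB f h i : kB (tB f) h i = (h i + f i)%R.
Proof. by rewrite (hom_tf _ _ _ kBM) kBt kBs tf_ps. Qed.

Lemma val0_tB f i : val0 (tB f) i = f i.
Proof. by rewrite /val0 kB_tB add0r. Qed.

Lemma tB_EB f : EB (tB f).
Proof. by apply: tf_in; [exact: subgenP | move=> i _; apply: subgen_in; exists i]. Qed.

Lemma EB_tB x : EB x -> exists f, x = tB f.
Proof. exact: (tz_span B_tzC). Qed.

Lemma EB_eq x y : EB x -> EB y -> (forall i, val0 x i = val0 y i) -> x = y.
Proof.
move=> /EB_tB[f ->] /EB_tB[g ->] E; congr tB; apply: calE_eq => i.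
by rewrite -!val0_tB E.
Qed.

Lemma tB_inj f g : tB f = tB g -> f = g.
Proof. by move=> E; apply: calE_eq => i; rewrite -!val0_tB E. Qed.

Definition PB (I : set int) : set (grp pB) := subgen [set tz Bt Bs i | i in I].

Lemma EB_supp (I : set int) x : EB x -> (forall i, val0 x i != 0%R -> I i) -> PB I x.
Proof.
move=> /EB_tB[f ->] fI; apply: tf_in; first exact: subgenP.
by move=> i fi; apply: subgen_in; exists i => //; apply: fI; rewrite val0_tB.
Qed.

Lemma PB_supp (I : set int) f : PB I (tB f) -> zsupp f I.
Proof. exact: tf_model_supp kBM kBt kBs. Qed.

Lemma val0_diff g x i : EB x -> val0 ((tB g)^-1 * x) i = (val0 x i - g i)%R.
Proof.
move=> /EB_tB[f ->]; rewrite val0_tB /val0 kBM permsME (homV kBM).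
have := kB_tB g ((kB (tB g))^-1 (kB (tB f) lzero)) i.
by rewrite -permsME mulgV perms1E kB_tB add0r => ->; rewrite addrK.
Qed.

Lemma EB_diff g x : EB x -> EB ((tB g)^-1 * x).
Proof. by move=> Ex; apply: (sgM (subgenP _)) => //; apply: (sgV (subgenP _)); exact: tB_EB. Qed.

Section TwistedB.
Variables (v s : grp pB) (idx : int -> int).
Hypotheses (vE : forall i, tz v s i = tz Bt Bs (idx i)) (idxI : injective idx).

Lemma tf_twist_EB f : EB (tf v s f).
Proof.
apply: tf_in => [|i _]; first exact: subgenP.
by rewrite vE; apply: subgen_in; exists (idx i).
Qed.

Lemma tf_twist_val0 f : (forall i, val0 (tf v s f) (idx i) = f i) /\
  forall j, (forall i, j != idx i) -> val0 (tf v s f) j = 0%R.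
Proof.
have tzE i (h : lser) j : tz (kB v) (kB s) i h j = (h j + (j == idx i)%:Z)%R.
  by rewrite -[tz _ _ i]/(kB v ^ expz (kB s) i) -(homXz kBM) -(homJ kBM) -/(tz v s i) vE kB_tz.
have [E1 E2] := tf_act_inj f idxI tzE lzero.
split=> [i|j /E2]; rewrite /val0 (hom_tf _ _ _ kBM); last by move=> ->.
by rewrite E1 add0r.
Qed.

Lemma tf_twist_inj f g : tf v s f = tf v s g -> f = g.
Proof.
by move=> E; apply: calE_eq => i; rewrite -(tf_twist_val0 f).1 E (tf_twist_val0 g).1.
Qed.

End TwistedB.

Lemma subgen_seq (p : rpres) (S : seq rword) (T : set (grp p)) :
  is_subgroup T -> (forall w, w \in S -> T (ev p w)) ->
  subgen [set x | exists2 w, w \in S & x = ev p w] `<=` T.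
Proof. by move=> TS ST; apply: (subgen_min TS) => _ [w wS ->]; exact: ST. Qed.

Lemma mul_eq1 (G : groupType) (x y : G) : x^-1 * y = 1 <-> x = y.
Proof. by split=> [/mulg1_eq|->]; [rewrite invgK | rewrite mulVg]. Qed.

Lemma subgen0 (p : rpres) (x : grp p) :
  subgen [set x | exists2 w, w \in [::] & x = ev p w] x <-> x = 1.
Proof.
split=> [|->]; last exact: sg1 (subgenP _).
by apply: (subgen_min (@is_subgroup1 (grp p))) => y [w].
Qed.

Definition gt : rword := rgen 0.
Definition gs : rword := rgen 1.

Lemma ev_gt : ev pB gt = Bt. Proof. exact: evalw_gen. Qed.
Lemma ev_gs : ev pB gs = Bs. Proof. exact: evalw_gen. Qed.
Lemma ev_gsV : ev pB (rinv gs) = Bs^-1. Proof. by rewrite evalw_inv ev_gs. Qed.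

(** Replacing [s] by its inverse reflects the indices of [v_f]; with trivial [Lam] the relation is
    the equality [u_g = v_f]. *)
Lemma gadget_rho : inhabited (gadget (fun g f => forall i : int, f i = g (- i)%R)).
Proof.
have vE i : tz Bt Bs^-1 i = tz Bt Bs (- i)%R by rewrite /tz expzV expzN.
constructor; apply: (@Gadget _ pB gt gs gt (rinv gs) [::]) => //.
  by move=> f g; rewrite ev_gt ev_gsV; exact: (tf_twist_inj vE (@oppr_inj _)).
move=> g f; rewrite subgen0 ev_gt ev_gs ev_gsV mul_eq1.
have [E1 _] := tf_twist_val0 vE (@oppr_inj _) f; have Ev := tf_twist_EB vE f.
split=> [E|E i].
  apply: EB_eq (tB_EB g) Ev _ => i; rewrite val0_tB.
  by rewrite -[i in RHS]opprK E1 E opprK.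
by rewrite -E1 -E val0_tB.
Qed.

(** Conjugating [t] by the inverse of [s] lowers every index of [v_f] by one. *)
Lemma gadget_sigma : inhabited (gadget (fun g f => forall i : int, f i = g (i - 1)%R)).
Proof.
have vE i : tz (Bt ^ Bs^-1) Bs i = tz Bt Bs (i - 1)%R.
  by rewrite -tz_shift /tz /= expg1 -!conjgM; congr (_ ^ _); rewrite -(expzP Bs i) -(expzD Bs (-1)%R) addrC.
have sI : injective (fun i : int => i - 1)%R by exact: addIr.
constructor; apply: (@Gadget _ pB gt gs (wconj gt (rinv gs)) gs [::]) => //.
  by move=> f g; rewrite evalw_conj ev_gt ev_gsV ev_gs; exact: (tf_twist_inj vE sI).
move=> g f; rewrite subgen0 evalw_conj ev_gt ev_gsV ev_gs mul_eq1.
have [E1 _] := tf_twist_val0 vE sI f; have Ev := tf_twist_EB vE f.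
split=> [E|E i].
  apply: EB_eq (tB_EB g) Ev _ => i; rewrite val0_tB.
  by have := E1 (i + 1)%R; rewrite E addrK => ->.
by rewrite -E1 -E val0_tB.
Qed.

(** [Lam] is generated by [t], the coordinate at index 0, which its cosets forget. *)
Lemma gadget_zeta : inhabited (gadget (fun g f => forall i : int, i != 0%R -> f i = g i)).
Proof.
constructor; apply: (@Gadget _ pB gt gs gt gs [:: gt]) => //.
  by move=> f g; rewrite ev_gt ev_gs; exact: tB_inj.
move=> g f; rewrite ev_gt ev_gs -/(tB g) -/(tB f).
have -> : subgen [set x | exists2 w, w \in [:: gt] & x = ev pB w] = PB [set 0%R].
  congr subgen; apply/seteqP; split=> x.
    by move=> [w]; rewrite inE => /eqP -> ->; exists 0%R; rewrite // ev_gt /tz conjg1.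
  by move=> [_ -> <-]; exists gt; rewrite ?inE // ev_gt /tz conjg1.
have Ed := EB_diff g (tB_EB f).
have V i : val0 ((tB g)^-1 * tB f) i = (f i - g i)%R by rewrite val0_diff ?val0_tB //; exact: tB_EB.
split=> [E|].
  apply: EB_supp => // i; rewrite V; apply: contraTeq => /E ->.
  by rewrite subrr eqxx.
have [w Ew] := EB_tB Ed; rewrite Ew => /PB_supp wS i i0; apply/eqP; rewrite -subr_eq0 -V Ew val0_tB.
by apply: contraNT i0 => /wS ->.
Qed.

(** With [s ^ 2] for [s] the element [v_f] lives at even indices, and the odd ones are to be
    forgotten. The group of odd coordinates is not finitely generated, but with [s ^ 2] adjoined two
    generators suffice. *)
Lemma gadget_theta : inhabited (gadget (fun g f => forall i : int, f i = g (2 * i)%R)).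
Proof.
have vE i : tz Bt (Bs ^+ 2) i = tz Bt Bs (2 * i)%R by rewrite /tz expz_double.
have dI : injective (fun i : int => 2 * i)%R by move=> i j; lia.
have evss : ev pB (gs ++ gs) = Bs ^+ 2 by rewrite evalw_cat !ev_gs expg2.
have evt1 : ev pB (wconj gt gs) = Bt ^ Bs by rewrite evalw_conj ev_gt ev_gs.
constructor; apply: (@Gadget _ pB gt gs gt (gs ++ gs) [:: wconj gt gs; gs ++ gs]) => //.
  by move=> f g; rewrite ev_gt evss; exact: (tf_twist_inj vE dI).
move=> g f; rewrite ev_gt ev_gs evss -/(tB g).
set Lam := subgen _; have LS : is_subgroup Lam by exact: subgenP.
have [E1 E2] := tf_twist_val0 vE dI f; have Ev := tf_twist_EB vE f.
have V i := @val0_diff g _ i Ev; have Ed := EB_diff g Ev.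
set x := _ * _ in V Ed *.
have Lt : Lam (Bt ^ Bs) by apply: subgen_in; exists (wconj gt gs); rewrite ?inE.
have Ls : Lam (Bs ^+ 2) by apply: subgen_in; exists (gs ++ gs); rewrite ?inE ?eqxx ?orbT.
split=> [E|Lx i].
  have : PB [set i | exists j, i = (2 * j + 1)%R] x.
    apply: EB_supp => // i; rewrite V => vi; exists (i %/ 2)%Z.
    case: (eqVneq (i %% 2)%Z 0%R) => [i0|]; last by lia.
    have Ei : i = (2 * (i %/ 2)%Z)%R by lia.
    by move: vi; rewrite Ei E1 E subrr eqxx.
  apply: subgen_min => // _ [_ [j ->] <-].
  have -> : tz Bt Bs (2 * j + 1)%R = (Bt ^ Bs) ^ expz (Bs ^+ 2) j.
    by rewrite /tz addrC expzD conjgM expz_double.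
  by apply: (sgJ LS) => //; exact: (sgXz _ LS).
(* Adjoining [s ^ 2] does no harm: all of [Lam] preserves, in both directions, the series that
   vanish at even indices. *)
pose T : set (grp pB) := [set y | forall (h : lser), (forall i, h (2 * i)%R = 0%R) <->
  (forall i, kB y h (2 * i)%R = 0%R)].
have TS : is_subgroup T.
  apply: is_subgroupM => [h|y Ty h|y z Ty Tz h]; first by rewrite (hom1 kBM).
    have := Ty ((kB y)^-1 h); rewrite -permsME mulgV perms1E (homV kBM).
    exact: iff_sym.
  by rewrite kBM permsME; apply: iff_trans (Tz h) _; exact: Ty.
have : T x.
  apply: (subgen_seq TS _ Lx) => w; rewrite !inE => /orP[] /eqP -> h.
    rewrite evt1; have E j : kB (Bt ^ Bs) h (2 * j)%R = h (2 * j)%R.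
      rewrite -[Bt ^ Bs]/(tz Bt Bs 1%R) kB_tz; have -> : (2 * j == 1 :> int)%R = false by lia.
      exact: addr0.
    by split=> H j; move: (H j); rewrite E.
  rewrite evss; have E j : kB (Bs ^+ 2) h j = h (j + 2)%R.
    by rewrite (homX kBM) kBs -[ps ^+ 2]/(expz ps 2%R) expz_ps.
  split=> H j; first by rewrite E; have := H (j + 1)%R; congr (h _ = _); lia.
  by have := H (j - 1)%R; rewrite E; congr (h _ = _); lia.
move=> /(_ lzero) [/(_ (fun _ => erefl)) H _]; have := H i.
by rewrite -/(val0 x (2 * i)%R) V E1 => /eqP; rewrite subr_eq0 => /eqP.
Qed.

(** * Index sets such as half lines, and the operations [pi] and [tau] *)

Definition benign_in (G : groupType) (gg : seq G) (H : set G) : Prop :=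
  exists d : datum, exists2 f : G -> grp d.1, dfor gg f H & injective f.

Lemma Hset_neg_benign : benign_in gens3 (Hset negs).
Proof. by have [d _ [f D fI]] := Hset_neg_datum; exists d, f. Qed.

(** Reflections and translations of the indices are realised by maps [k] of [F3] with left inverse
    [k']; they transport one half line to another. *)
Lemma Hset_pull (I J : set int) (k k' : F3 -> F3) (ss : seq rword) :
  benign_in gens3 (Hset J) -> hom k -> (forall x, k' (k x) = x) ->
  (forall x, Hset I x -> Hset J (k x)) -> (forall x, Hset J x -> Hset I (k' x)) ->
  size ss = 3 -> (forall i, i < 3 -> wf 3 (nth [::] ss i) /\
    k (nth 1 gens3 i) = evalw (nth 1 gens3) (nth [::] ss i)) ->
  benign_in gens3 (Hset I).
Proof.
move=> [d [f D fI]] kM kK IJ JI sss kE.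
have D' := pulldP (gg' := gens3) D kM sss kE.
exists (pulld ss d), (f \o k).
  have -> : Hset I = k @^-1` Hset J by apply/seteqP; split=> x; [exact: IJ | move=> /JI; rewrite kK].
  exact: D'.
by apply: inj_comp => //; exact: can_inj kK.
Qed.

Lemma Hset_hom (I J : set int) (k : F3 -> F3) x : hom k -> k a3 = a3 ->
  (forall i, I i -> Hset J (k (bi i))) -> Hset I x -> Hset J (k x).
Proof.
move=> kM ka kb; apply: (hom_subgen kM (subgenP _)) => _ [->|[i Ii <-]]; last exact: kb.
by rewrite ka; exact: Hset_a.
Qed.

Lemma F3_hom_id (k : F3 -> F3) : hom k -> k a3 = a3 -> k b3 = b3 -> k c3 = c3 -> forall x, k x = x.
Proof.
move=> kM ka kb kc; apply: (@F3_ind [set x | k x = x]) => //.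
apply: is_subgroupM => /= [|x E|x y Ex Ey]; first exact: hom1.
  by rewrite (homV kM) E.
by rewrite kM Ex Ey.
Qed.

Definition poss : set int := [set i | (0 < i)%R].
Definition gt1s : set int := [set i | (1 < i)%R].
Definition not01 : set int := [set i | i != 0%R /\ i != 1%R].

Lemma Hset_pos_benign : benign_in gens3 (Hset poss).
Proof.
have [k [kM ka kb kc]] := F3_hom a3 b3 c3^-1.
have kbi i : k (bi i) = bi (- i)%R by rewrite /bi (homJ kM) (homXz kM) kb kc expzV expzN.
apply: (@Hset_pull _ _ k k [:: rgen 0; rgen 1; rinv (rgen 2)] Hset_neg_benign) => //.
- apply: F3_hom_id; [exact: hom_comp | by rewrite ka | by rewrite kb |].
  by rewrite kc (homV kM) kc invgK.
- by move=> x; apply: Hset_hom => // i i0; rewrite kbi; apply: Hset_b; move: i0; rewrite /negs /poss /=; lia.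
- by move=> x; apply: Hset_hom => // i i0; rewrite kbi; apply: Hset_b; move: i0; rewrite /negs /poss /=; lia.
- by case=> [|[|[|//]]] _; split=> //; rewrite ?[nth [::] _ _]/= ?evalw_inv evalw_gen ?ka ?kb ?kc.
Qed.

Lemma Hset_gt1_benign : benign_in gens3 (Hset gt1s).
Proof.
have [k [kM ka kb kc]] := F3_hom a3 (b3 ^ c3^-1) c3.
have [l [lM la lb lc]] := F3_hom a3 (b3 ^ c3) c3.
have kbi i : k (bi i) = bi (i - 1)%R.
  by rewrite /bi (homJ kM) (homXz kM) kb kc -conjgM addrC expzD.
have lbi i : l (bi i) = bi (i + 1)%R.
  by rewrite /bi (homJ lM) (homXz lM) lb lc -conjgM addrC expzD.
apply: (@Hset_pull _ _ k l [:: rgen 0; wconj (rgen 1) (rinv (rgen 2)); rgen 2] Hset_pos_benign) => //.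
- apply: (F3_hom_id (hom_comp kM lM)); first by rewrite /= ka la.
    by rewrite /= kb (homJ lM) (homV lM) lb lc conjgK.
  by rewrite /= kc lc.
- by move=> x; apply: Hset_hom => // i i0; rewrite kbi; apply: Hset_b; move: i0; rewrite /gt1s /poss /=; lia.
- by move=> x; apply: Hset_hom => // i i0; rewrite lbi; apply: Hset_b; move: i0; rewrite /gt1s /poss /=; lia.
- by case=> [|[|[|//]]] _; split=> //; rewrite ?[nth [::] _ _]/= ?evalw_conj ?evalw_inv !evalw_gen ?ka ?kb ?kc.
Qed.

Lemma Hset_not01_benign : benign_in gens3 (Hset not01).
Proof.
have [d1 [f1 D1 I1]] := Hset_neg_benign; have [d2 [f2 D2 I2]] := Hset_gt1_benign.
have [f D fI] := joindP gens3_generates D1 D2.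
exists (joind d1 d2), f; last by apply: fI; left.
have -> : Hset not01 = subgen (Hset negs `|` Hset gt1s); last exact: D.
apply/seteqP; split; apply: subgen_min; try exact: subgenP.
  move=> _ [->|[i [i0 i1] <-]]; first by apply: subgen_in; left; exact: Hset_a.
  apply: subgen_in; case: (ltrP i 0%R) => i00; first by left; apply: Hset_b.
  by right; apply: Hset_b; rewrite /gt1s /=; lia.
have sub (I : set int) : I `<=` not01 -> Hset I `<=` Hset not01.
  move=> IN; apply: subgenS => x [->|[i Ii <-]]; [by left | right; exists i => //; exact: IN].
move=> x [] ; apply: sub => i; rewrite /negs /gt1s /not01 /=; lia.
Qed.

(** The coordinates to be forgotten generate [PB poss], which is not finitely generated. It is
    benign in [pB] as the image of [Hset poss] under the map sending [a], [b], [c] to [1], [t],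
    [s]. *)
Lemma gadget_pi : inhabited (gadget (fun g f => forall i : int, (i <= 0)%R -> f i = g i)).
Proof.
have [d [f D _]] := Hset_pos_benign.
have [ch [chM cha chb chc]] := F3_hom (1 : grp pB) Bt Bs.
have [|||||f1 D1 f1I] := @ijdP F3 gens3 d f _ gens3_generates D pB [:: [::]; gt; gs] [::] ch wfp_pB.
- by [].
- by [].
- by [].
- exact: chM.
- by case=> [|[|[|//]]] _; rewrite ?[nth [::] _ _]/= ?evalw_nil ?ev_gt ?ev_gs.
set J := subgen _ in D1.
have chbi i : ch (bi i) = tz Bt Bs i by rewrite /bi (homJ chM) (homXz chM) chb chc.
have JE : J = PB poss.
  apply/seteqP; split; apply: subgen_min; try exact: subgenP.
    move=> _ [[y Hy <-]|[w]//]; apply: (hom_subgen chM (subgenP _) _ Hy) => _ [->|[i Ii <-]].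
      by rewrite cha; exact: sg1 (subgenP _).
    by rewrite chbi; apply: subgen_in; exists i.
  move=> _ [i Ii <-]; apply: subgen_in; left; exists (bi i) => //; exact: Hset_b.
apply: (gadget_of_datum (ub := gt) (uc := gs) (vb := gt) (vc := gs) wfp_pB _ D1 f1I) => //.
  by move=> h g; rewrite ev_gt ev_gs; exact: tB_inj.
move=> g h; rewrite JE ev_gt ev_gs -/(tB g) -/(tB h).
have Ed := EB_diff g (tB_EB h).
have V i : val0 ((tB g)^-1 * tB h) i = (h i - g i)%R by rewrite val0_diff ?val0_tB //; exact: tB_EB.
split=> [E|].
  apply: EB_supp => // i; rewrite V /poss /= ltNge; apply: contra => /E ->.
  by rewrite subrr.
have [w Ew] := EB_tB Ed; rewrite Ew => /PB_supp wS i i0; apply/eqP; rewrite -subr_eq0 -V Ew val0_tB.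
by apply: contraTT i0 => /wS; rewrite /poss /= ltNge.
Qed.

Lemma val0M x y i : EB x -> EB y -> val0 (x * y) i = (val0 x i + val0 y i)%R.
Proof.
by move=> /EB_tB[f ->] /EB_tB[g ->]; rewrite /val0 kBM permsME !kB_tB !add0r addrC.
Qed.

Lemma EBM x y : EB x -> EB y -> EB (x * y).
Proof. exact: (sgM (subgenP _)). Qed.

Lemma EBV x : EB x -> EB x^-1.
Proof. exact: (sgV (subgenP _)). Qed.

Lemma val01 i : val0 1 i = 0%R.
Proof. by rewrite /val0 (hom1 kBM). Qed.

Lemma val0V x i : EB x -> val0 x^-1 i = (- val0 x i)%R.
Proof.
move=> Ex; apply/eqP; rewrite -addr_eq0 -val0M ?mulVg ?val01 //; exact: EBV.
Qed.

Lemma EB_tz i : EB (tz Bt Bs i).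
Proof. by apply: subgen_in; exists i. Qed.

Lemma EB_expz x k : EB x -> EB (expz x k).
Proof. exact: (sgXz _ (subgenP _)). Qed.

Lemma val0_expz x k i : EB x -> val0 (expz x k) i = (k * val0 x i)%R.
Proof.
move=> Ex; elim/int_rect: k => [|n IHn|n IHn]; first by rewrite mul0r val01.
  by rewrite -addn1 PoszD expzS val0M ?IHn ?mulrDl ?mul1r //; exact: EB_expz.
by rewrite -addn1 PoszD opprD expzP val0M ?val0V ?IHn ?mulrDl ?mulN1r //; [exact: EB_expz | exact: EBV].
Qed.

Lemma val0_tz i j : val0 (tz Bt Bs i) j = (j == i)%:Z%R.
Proof. by rewrite /val0 kB_tz add0r. Qed.

Definition pBB : rpres := prodp pB pB.
Definition gt' : rword := shw 3 gt.
Definition gs' : rword := shw 3 gs.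

Lemma expz_pair p q (m : prod_maps p q) x y k :
  expz (pairm m x y) k = pairm m (expz x k) (expz y k).
Proof.
have prE z : prj1 m (expz z k) = expz (prj1 m z) k by rewrite (homXz (prj1M m)).
have prE' z : prj2 m (expz z k) = expz (prj2 m z) k by rewrite (homXz (prj2M m)).
by rewrite -[LHS](pairm_prj m) prE prE' prj1_pair prj2_pair.
Qed.

Lemma tf_pair p q (m : prod_maps p q) t s t' s' f :
  tf (pairm m t t') (pairm m s s') f = pairm m (tf t s f) (tf t' s' f).
Proof.
by rewrite -[LHS](pairm_prj m) (hom_tf _ _ _ (prj1M m)) (hom_tf _ _ _ (prj2M m)) !prj1_pair !prj2_pair.
Qed.

(** The inverse of an ordered product is the reversed one; since the conjugates commute, the
    comparison can be made on coefficients. *)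
Lemma tf_invB f : tf Bt^-1 Bs f = (tB f)^-1.
Proof.
have E i : tz Bt^-1 Bs i = (tz Bt Bs i)^-1 by rewrite /tz conjVg.
have [g gE] := @shiftE f 0%R.
have EN : EB (tf Bt^-1 Bs f).
  by apply: tf_in => [|i _]; [exact: subgenP | rewrite E; apply: EBV; exact: EB_tz].
apply: EB_eq EN (EBV (tB_EB f)) _ => i; rewrite val0V ?val0_tB; last exact: tB_EB.
have [N fN] := supp_window f.
rewrite (tf_window Bt^-1 Bs fN) -(val0_tB f i) /tB (tf_window Bt Bs fN).
elim: (zrange _ _) => [|k r IHr]; first by rewrite !big_nil val01 oppr0.
have prodEB (h : int -> grp pB) l : (forall i, EB (h i)) -> EB (\prod_(j <- l) h j).
  by move=> hE; exact: (sg_prod _ (subgenP _) hE).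
have E1 j : EB (expz (tz Bt Bs j) (f j)) by apply: EB_expz; exact: EB_tz.
have E2 j : EB (expz (tz Bt^-1 Bs j) (f j)).
  by apply: EB_expz; rewrite E; apply: EBV; exact: EB_tz.
rewrite !big_cons (val0M _ (E2 k) (prodEB _ r E2)) (val0M _ (E1 k) (prodEB _ r E1)) IHr opprD.
congr (_ + _)%R; rewrite E val0_expz ?val0V ?val0_expz ?mulrN //; try exact: EB_tz.
by apply: EBV; exact: EB_tz.
Qed.

Definition tau_rel (g f : calE) : Prop :=
  [/\ f 0%R = g 1%R, f 1%R = g 0%R & forall i : int, i != 0%R -> i != 1%R -> f i = g i].

(** In one copy with the same coordinates for [u] and [v] a coset relation sees only [f - g]. With
    [u_g] and [v_f] in different copies, [L] can be the group of all pairs of the inverse of [tB g]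
    and [tB f] with [tau_rel g f]. Two pairs exchange the indices 0 and 1, and the image of
    [Hset not01] treats the others. *)
Lemma gadget_tau : inhabited (gadget tau_rel).
Proof.
have [d [f D _]] := Hset_not01_benign.
have [m] := prod_mapsP wfp_pB wfp_pB; have bbw := wfp_prodp wfp_pB wfp_pB.
have [ch [chM cha chb chc]] := F3_hom (1 : grp pBB) (pairm m Bt^-1 Bt) (pairm m Bs Bs).
pose S := [:: rinv gt ++ shw 3 (wconj gt gs); rinv (wconj gt gs) ++ gt'].
have ev1 w : wf 3 w -> ev pBB w = inj1 m (ev pB w) by move=> ww; rewrite inj1_ev.
have ev2 w : wf 3 w -> ev pBB (shw 3 w) = inj2 m (ev pB w) by move=> ww; rewrite inj2_ev.
have [|||||f1 D1 f1I] := @ijdP F3 gens3 d f _ gens3_generates D pBB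
    [:: [::]; rinv gt ++ gt'; gs ++ gs'] S ch bbw.
- by [].
- by [].
- by [].
- exact: chM.
- case=> [|[|[|//]]] _.
  + by rewrite -[nth [::] _ _]/([::] : rword) evalw_nil.
  + rewrite -[nth [::] _ _]/(rinv gt ++ gt') -[nth 1 _ _]/b3 chb.
    by rewrite evalw_cat ev1 // ev2 // evalw_inv ev_gt.
  + rewrite -[nth [::] _ _]/(gs ++ gs') -[nth 1 _ _]/c3 chc.
    by rewrite evalw_cat ev1 // ev2 // ev_gs.
set J := subgen _ in D1; have JS : is_subgroup J by exact: subgenP.
have u0 : tz Bt Bs 0%R = Bt by rewrite /tz conjg1.
have u1 : tz Bt Bs 1%R = Bt ^ Bs by [].
have S1 : ev pBB (rinv gt ++ shw 3 (wconj gt gs)) = pairm m (tz Bt Bs 0%R)^-1 (tz Bt Bs 1%R).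
  by rewrite evalw_cat ev1 // ev2 // evalw_inv evalw_conj ev_gt ev_gs u0.
have S2 : ev pBB (rinv (wconj gt gs) ++ gt') = pairm m (tz Bt Bs 1%R)^-1 (tz Bt Bs 0%R).
  by rewrite evalw_cat ev1 // ev2 // evalw_inv evalw_conj ev_gt ev_gs u0.
have SS1 : J (pairm m (tz Bt Bs 0%R)^-1 (tz Bt Bs 1%R)).
  by rewrite -S1; apply: subgen_in; right; eexists; last by []; rewrite !inE eqxx.
have SS2 : J (pairm m (tz Bt Bs 1%R)^-1 (tz Bt Bs 0%R)).
  by rewrite -S2; apply: subgen_in; right; eexists; last by []; rewrite !inE eqxx orbT.
have xE g h : (tf (ev pBB gt) (ev pBB gs) g)^-1 * tf (ev pBB gt') (ev pBB gs') h
    = pairm m (tB g)^-1 (tB h).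
  rewrite ev1 // ev1 // ev2 // ev2 // ev_gt ev_gs -(hom_tf _ _ _ (inj1M m)) -(hom_tf _ _ _ (inj2M m)).
  by rewrite /pairm (homV (inj1M m)).
apply: (gadget_of_datum (ub := gt) (uc := gs) (vb := gt') (vc := gs') bbw _ D1 f1I) => //.
  move=> h g; rewrite ev2 // ev2 // ev_gt ev_gs -!(hom_tf _ _ _ (inj2M m)).
  by move=> /(congr1 (prj2 m)); rewrite !prj22; exact: tB_inj.
move=> g h; rewrite xE.
have tzd k : tz Bt Bs k = tB (delta k 1).
  by apply: esym; rewrite /tB (tf1 _ _ (deltaE k 1%R)).
split=> [[h0 h1 hE]|].
  pose g' := restrict g (fun i => (i != 0%R) && (i != 1%R)).
  have -> : pairm m (tB g)^-1 (tB h) = ch (bf g') *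
      (expz (pairm m (tz Bt Bs 0%R)^-1 (tz Bt Bs 1%R)) (g 0%R) *
       expz (pairm m (tz Bt Bs 1%R)^-1 (tz Bt Bs 0%R)) (g 1%R)).
    rewrite bfE (hom_tf _ _ _ chM) chb chc tf_pair tf_invB -/(tB g') !expz_pair !pairmM.
    have Ez := EB_tz; have Et := tB_EB.
    congr pairm; apply: EB_eq => [||i].
    - exact: EBV.
    - by apply: EBM; [exact: EBV | apply: EBM; apply: EB_expz; exact: EBV].
    - rewrite !val0M ?val0V ?val0_expz ?val0V ?val0_tB ?val0_tz //;
        rewrite ?restrictE; try (by apply: EBV); try (by apply: EB_expz; apply: EBV);
        last by apply: EBM; apply: EB_expz; apply: EBV.
      case: (eqVneq i 0%R) => [->|i0] /=; first by lia.
      by case: (eqVneq i 1%R) => [->|i1] /=; lia.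
    - exact: Et.
    - by apply: EBM; [exact: Et | apply: EBM; apply: EB_expz; exact: Ez].
    - rewrite !val0M ?val0_expz ?val0_tB ?val0_tz //; rewrite ?restrictE;
        try (by apply: EB_expz); last by apply: EBM; apply: EB_expz.
      case: (eqVneq i 0%R) => [->|i0]; first by rewrite h0 /=; lia.
      by case: (eqVneq i 1%R) => [->|i1] /=; [rewrite h1 | rewrite hE //]; lia.
  apply: (sgM JS); last by apply: (sgM JS); apply: (sgXz _ JS).
  apply: subgen_in; left; exists (bf g') => //.
  apply: tf_in; first exact: subgenP.
  move=> i; rewrite restrictE; case: ifP => [/andP i01 _|]; last by rewrite eqxx.
  exact: Hset_b.
pose T : set (grp pBB) := [set x | exists g f, tau_rel g f /\ x = pairm m (tB g)^-1 (tB f)].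
have TS : is_subgroup T.
  apply: is_subgroupM => [|_ [g1 [f2 [R1 ->]]]|_ _ [g1 [f2 [R1 ->]]] [g2 [f3 [R2 ->]]]].
  - exists (delta 0 0), (delta 0 0); split; first by split=> *; rewrite !deltaE ?if_same.
    have -> : tB (delta 0 0) = 1 by apply: tf0 => i; rewrite deltaE if_same.
    by rewrite invg1 /pairm (hom1 (inj1M m)) (hom1 (inj2M m)) mulg1.
  - have [N1 gN] := supp_bound g1; have [N2 fN] := supp_bound f2.
    have [|g2 gE] := @mkE (fun i => - g1 i)%R N1; first by move=> i; rewrite oppr_eq0 => /gN.
    have [|f3 fE] := @mkE (fun i => - f2 i)%R N2; first by move=> i; rewrite oppr_eq0 => /fN.
    exists g2, f3; split.
      by case: R1 => r1 r2 r3; split=> [||i i0 i1]; rewrite gE fE ?r1 ?r2 ?r3.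
    rewrite /tB (tfN B_tzC gE) (tfN B_tzC fE) -/(tB g1) -/(tB f2).
    apply: (@mulIg _ (pairm m (tB g1)^-1 (tB f2))); rewrite mulVg pairmM invgK mulgV mulVg.
    by rewrite /pairm (hom1 (inj1M m)) (hom1 (inj2M m)) mulg1.
  - have [g4 gE] := addE g2 g1; have [f4 fE] := addE f2 f3.
    exists g4, f4; split.
      case: R1 => r1 r2 r3; case: R2 => s1 s2 s3.
      by split=> [||i i0 i1]; rewrite gE fE addrC ?r1 ?r2 ?s1 ?s2 ?r3 ?s3.
    by rewrite pairmM /tB (tfD B_tzC gE) (tfD B_tzC fE) invgM.
have dR k l : (k, l) \in [:: (0, 1); (1, 0)]%R -> tau_rel (delta k 1) (delta l 1).
  by rewrite !inE => /orP[] /eqP[-> ->]; split=> [||i /negbTE i0 /negbTE i1]; rewrite !deltaE ?i0 ?i1.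
move=> Jx; have : T (pairm m (tB g)^-1 (tB h)).
  apply: (subgen_min TS _ Jx) => _ [[y Hy <-]|[w wS ->]].
    apply: (hom_subgen chM TS _ Hy) => _ [->|[i [i0 i1] <-]].
      by rewrite cha; exact: sg1 TS.
    exists (delta i 1), (delta i 1); split.
      by split=> // ; rewrite !deltaE ![_ == i]eq_sym (negbTE i0) (negbTE i1).
    rewrite /bi (homJ chM) (homXz chM) chb chc -tzd expz_pair.
    rewrite -[LHS](pairm_prj m) (homJ (prj1M m)) (homJ (prj2M m)) !prj1_pair !prj2_pair.
    by rewrite conjVg.
  move: wS; rewrite !inE => /orP[] /eqP ->.
    by rewrite S1 !tzd; exists (delta 0 1), (delta 1 1); split=> //; apply: dR; rewrite !inE eqxx.
  by rewrite S2 !tzd; exists (delta 1 1), (delta 0 1); split=> //; apply: dR; rewrite !inE eqxx orbT.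
move=> [g1 [f2 [R1 E]]].
have E1 := congr1 (prj1 m) E; have E2 := congr1 (prj2 m) E.
rewrite !prj1_pair in E1; rewrite !prj2_pair in E2.
by rewrite (tB_inj (invg_inj E1)) (tB_inj E2).
Qed.

(** * The operations [omega_m] *)

Lemma mBB_ex : exists m : prod_maps pB pB, True.
Proof. by have [m] := prod_mapsP wfp_pB wfp_pB; exists m. Qed.

Definition mBB : prod_maps pB pB := sval (cid mBB_ex).

Lemma wfp_pBB : wfp pBB. Proof. exact: wfp_prodp wfp_pB wfp_pB. Qed.

(** Generators 0, 1, 2 are [t], [s], [r] of the first copy of [pB]; 3, 4, 5 are those of the second;
    6 is the free generator [a]. *)
Definition pG : rpres := freep pBB.
Definition iotaQ : grp pBB -> grp pG := s2val (cid2 (freep_free wfp_pBB)).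
Definition aQ : grp pG := gn pG 6.

Lemma freeQ : free_with iotaQ aQ. Proof. exact: s2valP (cid2 (freep_free wfp_pBB)). Qed.
Lemma iotaQ_gn i : i < 6 -> iotaQ (gn pBB i) = gn pG i.
Proof. exact: (s2valP' (cid2 (freep_free wfp_pBB))). Qed.
Lemma iotaQM : hom iotaQ. Proof. exact: freeQ.1. Qed.
Lemma wfp_pG : wfp pG. Proof. exact: wfp_freep wfp_pBB. Qed.

Definition uQ (f : calE) : grp pBB := inj1 mBB (tB f).
Definition vQ (f : calE) : grp pBB := inj2 mBB (tB f).

Definition Vts : set (grp pB) := subgen [set` [:: Bt; Bs]].
Definition V1 : set (grp pBB) := inj1 mBB @` Vts.
Definition V2 : set (grp pBB) := inj2 mBB @` Vts.
Definition g1 : grp pBB := pairm mBB Bt Bt^-1.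
Definition g2 : grp pBB := pairm mBB Bs Bs.
(** Contained in the graph of a map inverting [t] and fixing [s]. Since it contains the quotients of
    [uQ f] by [vQ f], right multiplication by it can move a function from the second copy to the
    first. *)
Definition Gam : set (grp pBB) := subgen [set` [:: g1; g2]].
Definition nonnegs : set int := [set i | (0 <= i)%R].
(** Negative support in the first copy and nonnegative support in the second: being disjoint, they
    leave only a trivial intersection with [Gam]. *)
Definition Eplus : set (grp pBB) :=
  [set q | PB negs (prj1 mBB q) /\ PB nonnegs (prj2 mBB q)].

Lemma V1S : is_subgroup V1. Proof. exact: is_subgroup_im (inj1M mBB) (subgenP _). Qed.
Lemma V2S : is_subgroup V2. Proof. exact: is_subgroup_im (inj2M mBB) (subgenP _). Qed.
Lemma GamS : is_subgroup Gam. Proof. exact: subgenP. Qed.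
Lemma EplusS : is_subgroup Eplus.
Proof.
by apply: is_subgroupI; apply: is_subgroup_preim; try exact: subgenP; [exact: prj1M | exact: prj2M].
Qed.

Lemma Vts_t : Vts Bt. Proof. by apply: subgen_in; rewrite /= inE eqxx. Qed.
Lemma Vts_s : Vts Bs. Proof. by apply: subgen_in; rewrite /= !inE eqxx orbT. Qed.
Lemma Vts_tB f : Vts (tB f).
Proof.
apply: tf_in => [|i _]; first exact: subgenP.
apply: (sgJ (subgenP _)); [exact: Vts_t | apply: (sgXz _ (subgenP _)); exact: Vts_s].
Qed.
Lemma V1_uQ f : V1 (uQ f). Proof. by exists (tB f) => //; exact: Vts_tB. Qed.
Lemma V2_vQ f : V2 (vQ f). Proof. by exists (tB f) => //; exact: Vts_tB. Qed.

Lemma V1_prj2 q : V1 q -> prj2 mBB q = 1. Proof. by move=> [x _ <-]; exact: prj21. Qed.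
Lemma V2_prj1 q : V2 q -> prj1 mBB q = 1. Proof. by move=> [x _ <-]; exact: prj12. Qed.

Lemma prj1_u f : prj1 mBB (uQ f) = tB f. Proof. exact: prj11. Qed.
Lemma prj2_u f : prj2 mBB (uQ f) = 1. Proof. exact: prj21. Qed.
Lemma prj1_v f : prj1 mBB (vQ f) = 1. Proof. exact: prj12. Qed.
Lemma prj2_v f : prj2 mBB (vQ f) = tB f. Proof. exact: prj22. Qed.

Lemma prj_eq (x y : grp pBB) : prj1 mBB x = prj1 mBB y -> prj2 mBB x = prj2 mBB y -> x = y.
Proof. by move=> E1 E2; rewrite -(pairm_prj mBB x) -(pairm_prj mBB y) E1 E2. Qed.

Lemma V12 q : V1 q -> V2 q -> q = 1.
Proof.
move=> /V1_prj2 E2 /V2_prj1 E1.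
by apply: prj_eq; rewrite ?E1 ?E2 ?(hom1 (prj1M _)) ?(hom1 (prj2M _)).
Qed.

(** The relation for [r] survives the inversion of [t] because [t] commutes with its conjugate by
    [s]. *)
Lemma nuB_ex : exists2 nu : grp pB -> grp pB, hom nu & nu Bt = Bt^-1 /\ nu Bs = Bs.
Proof.
have [c1 c2 c3] : [/\ commute (gn pB 2) Bs, commute Bt (Bt ^ Bs) & Bt ^ gn pB 2 = Bt * Bt ^ Bs].
  by apply/(@pB_rels _ (gn pB)) => w wp; exact: ev_rel.
have [|||nu [nM n0 n1 _]] := @B_hom (grp pB) Bt^-1 Bs (gn pB 2) => //.
- by rewrite conjVg; apply: commute_sym; apply: commuteV; apply: commute_sym; exact: commuteV.
- by rewrite !conjVg c3 c2 invgM.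
- by exists nu.
Qed.

Lemma Gam_nu : exists nu : grp pB -> grp pB, [/\ hom nu, forall f, nu (tB f) = (tB f)^-1,
  forall q, Gam q -> prj2 mBB q = nu (prj1 mBB q) & forall q, Gam q -> prj1 mBB q = nu (prj2 mBB q)].
Proof.
have [nu nM [nt ns]] := nuB_ex; exists nu; split=> //.
- by move=> f; rewrite (hom_tf _ _ _ nM) nt ns tf_invB.
- apply: subgen_min => [|x]; last first.
    by rewrite /= !inE => /orP[] /eqP ->; rewrite /= prj1_pair prj2_pair ?nt ?ns.
  apply: is_subgroupM => [|x|x y] /=; first by rewrite (hom1 (prj1M _)) (hom1 (prj2M _)) (hom1 nM).
    by rewrite (homV (prj1M _)) (homV (prj2M _)) (homV nM) => ->.
  by rewrite (prj1M mBB) (prj2M mBB) nM => -> ->.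
- apply: subgen_min => [|x]; last first.
    by rewrite /= !inE => /orP[] /eqP ->; rewrite /= prj1_pair prj2_pair ?(homV nM) ?nt ?ns ?invgK.
  apply: is_subgroupM => [|x|x y] /=; first by rewrite (hom1 (prj1M _)) (hom1 (prj2M _)) (hom1 nM).
    by rewrite (homV (prj1M _)) (homV (prj2M _)) (homV nM) => ->.
  by rewrite (prj1M mBB) (prj2M mBB) nM => -> ->.
Qed.

Lemma Gam_uv f : Gam (uQ f * (vQ f)^-1).
Proof.
have -> : uQ f * (vQ f)^-1 = tf g1 g2 f.
  by rewrite /g1 /g2 tf_pair tf_invB /pairm (homV (inj2M _)).
apply: tf_in => [|i _]; first exact: subgenP.
have G1 : Gam g1 by apply: subgen_in; rewrite /= inE eqxx.
have G2 : Gam g2 by apply: subgen_in; rewrite /= !inE eqxx orbT.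
by apply: (sgJ GamS) => //; exact: (sgXz _ GamS).
Qed.

Lemma zsupp0 (f : calE) (I J : set int) : zsupp f I -> zsupp f J -> (forall i, I i -> J i -> False) ->
  forall i, f i = 0%R.
Proof. by move=> fI fJ IJ i; apply/eqP; apply: contraT => fi; case: (IJ i); [exact: fI | exact: fJ]. Qed.

Lemma tB1 (f : calE) : (forall i, f i = 0%R) -> tB f = 1.
Proof. exact: tf0. Qed.

Lemma uQ1 (f : calE) : (forall i, f i = 0%R) -> uQ f = 1.
Proof. by move=> f0; rewrite /uQ tB1 // (hom1 (inj1M _)). Qed.

Lemma tB_PB (f : calE) I : zsupp f I -> PB I (tB f).
Proof. by move=> fI; apply: EB_supp; [exact: tB_EB | move=> i; rewrite val0_tB; exact: fI]. Qed.

Lemma PB_EB I x : PB I x -> EB x.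
Proof. by apply: subgenS => _ [i _ <-]; exists i. Qed.

Lemma PB_tB I x : PB I x -> exists2 f, x = tB f & zsupp f I.
Proof.
move=> Px; have [f E] := EB_tB (PB_EB Px); exists f => //; apply: PB_supp; by rewrite -E.
Qed.

Lemma Gam_Eplus q : Gam q -> Eplus q -> q = 1.
Proof.
have [nu [nM nt n12 n21]] := Gam_nu.
move=> Gq [/PB_tB[f Ef fI] E2].
have Eq2 : prj2 mBB q = (tB f)^-1 by rewrite n12 // Ef nt.
have f0 : forall i, f i = 0%R.
  apply: (zsupp0 (I := negs) (J := nonnegs)) => //; last by rewrite /negs /nonnegs /=; lia.
  by apply: PB_supp; apply/(sgVE _ (subgenP _)); rewrite -Eq2.
have tf1 : tB f = 1 by exact: tB1.
apply: prj_eq; rewrite ?Ef ?Eq2 tf1 ?invg1 ?(hom1 (prj1M _)) ?(hom1 (prj2M _)) //.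
Qed.

Lemma Gam_prj2 q x : Gam q -> prj2 mBB q = (tB x)^-1 -> q = uQ x * (vQ x)^-1.
Proof.
have [nu [nM nt n12 n21]] := Gam_nu => Gq E.
apply: prj_eq; rewrite ?(prj1M mBB) ?(prj2M mBB) ?(homV (prj1M mBB)) ?(homV (prj2M mBB)).
  by rewrite prj1_u prj1_v invg1 mulg1 n21 // E (homV nM) nt invgK.
by rewrite prj2_u prj2_v mul1g.
Qed.

Lemma uvC f x : uQ f * vQ x = vQ x * uQ f. Proof. exact: inj_comm. Qed.

Lemma uQM (f g h : calE) : (forall i, h i = f i + g i)%R -> uQ h = uQ f * uQ g.
Proof. by move=> E; rewrite /uQ -(inj1M mBB) /tB (tfD B_tzC E). Qed.

Lemma uQ_inj f g : uQ f = uQ g -> f = g.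
Proof. by move=> /(congr1 (prj1 mBB)); rewrite !prj1_u; exact: tB_inj. Qed.

Definition Mpt (R L : set (grp pBB)) := Msub iotaQ aQ R L.

(** Conjugation by a power of [s] in the first copy alone, extended so as to fix [a]; thus it shifts
    the function inside a conjugate of [a]. *)
Definition is_sig (k : int) (sg : grp pG -> grp pG) : Prop :=
  [/\ hom sg, sg aQ = aQ & forall q, sg (iotaQ q) = iotaQ (inj1 mBB (prj1 mBB q ^ expz Bs k) * inj2 mBB (prj2 mBB q))].

Lemma sig_ex k : exists sg, is_sig k sg.
Proof.
have [|sg [sM sa si]] := freeQ.2 _
  (fun q => iotaQ (pairm mBB (prj1 mBB q ^ expz Bs k) (prj2 mBB q))) aQ.
  by move=> x y; rewrite (prj1M mBB) (prj2M mBB) conjMg -pairmM iotaQM.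
by exists sg.
Qed.

Lemma sig_inv k sg sg' : is_sig k sg -> is_sig (- k)%R sg' -> forall x, sg' (sg x) = x.
Proof.
move=> [sM sa si] [sM' sa' si'].
apply: grp_hom_eq => [||i]; [exact: hom_comp | exact: hom_id |].
rewrite ltnS leq_eqVlt => /orP[/eqP ->|i6]; first by rewrite /= -/aQ sa sa'.
rewrite -iotaQ_gn //= si si'; congr iotaQ; rewrite -/(pairm _ _ _).
by rewrite prj1_pair prj2_pair expzN conjgK; exact: (pairm_prj mBB).
Qed.

Lemma sig_au k sg (f g : calE) : is_sig k sg -> (forall i, f i = g (i - k)%R) ->
  sg (aQ ^ iotaQ (uQ g)) = aQ ^ iotaQ (uQ f).
Proof.
move=> [sM sa si] E; rewrite (homJ sM) sa si prj1_u prj2_u (hom1 (inj2M _)) mulg1.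
by rewrite /uQ /tB (tf_shift Bt Bs E).
Qed.

Lemma PB_benign I : benign_in gens3 (Hset I) -> benign_in (gens pB) (PB I).
Proof.
move=> [d [f D _]].
have [ch [chM cha chb chc]] := F3_hom (1 : grp pB) Bt Bs.
have [|||||f1 D1 f1I] := @ijdP F3 gens3 d f _ gens3_generates D pB [:: [::]; gt; gs] [::] ch wfp_pB.
- by [].
- by [].
- by [].
- exact: chM.
- by case=> [|[|[|//]]] _; rewrite ?[nth [::] _ _]/= ?evalw_nil ?ev_gt ?ev_gs.
set J := subgen _ in D1.
have chbi i : ch (bi i) = tz Bt Bs i by rewrite /bi (homJ chM) (homXz chM) chb chc.
suff JE : J = PB I by rewrite JE in D1; exists (ijd pB [:: [::]; gt; gs] [::] d), f1.
apply/seteqP; split; apply: subgen_min; try exact: subgenP.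
  move=> _ [[y Hy <-]|[w]//]; apply: (hom_subgen chM (subgenP _) _ Hy) => _ [->|[i Ii <-]].
    by rewrite cha; exact: sg1 (subgenP _).
  by rewrite chbi; apply: subgen_in; exists i.
move=> _ [i Ii <-]; apply: subgen_in; left; exists (bi i) => //; exact: Hset_b.
Qed.

Lemma Hset_nonneg_benign : benign_in gens3 (Hset nonnegs).
Proof.
have [k [kM ka kb kc]] := F3_hom a3 (b3 ^ c3) c3.
have [l [lM la lb lc]] := F3_hom a3 (b3 ^ c3^-1) c3.
have kbi i : k (bi i) = bi (i + 1)%R.
  by rewrite /bi (homJ kM) (homXz kM) kb kc -conjgM addrC expzD.
have lbi i : l (bi i) = bi (i - 1)%R.
  by rewrite /bi (homJ lM) (homXz lM) lb lc -conjgM addrC expzD.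
apply: (@Hset_pull _ _ k l [:: rgen 0; wconj (rgen 1) (rgen 2); rgen 2] Hset_pos_benign) => //.
- apply: (F3_hom_id (hom_comp kM lM)); first by rewrite /= ka la.
    by rewrite /= kb (homJ lM) lb lc conjgKV.
  by rewrite /= kc lc.
- by move=> x; apply: Hset_hom => // i i0; rewrite kbi; apply: Hset_b; move: i0; rewrite /nonnegs /poss /=; lia.
- by move=> x; apply: Hset_hom => // i i0; rewrite lbi; apply: Hset_b; move: i0; rewrite /nonnegs /poss /=; lia.
- by case=> [|[|[|//]]] _; split=> //; rewrite ?[nth [::] _ _]/= ?evalw_conj ?evalw_inv !evalw_gen ?ka ?kb ?kc.
Qed.

Definition Jplus : set (grp pG) := subgen ((iotaQ @` Eplus) `|` [set aQ]).

(** [Eplus] is an intersection of preimages under the two projections; [ijdP] carries it along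
    [iotaQ] and adds [a]. *)
Lemma Jplus_benign : benign_in (gens pG) Jplus.
Proof.
have [d1 [f1 D1 _]] := PB_benign Hset_neg_benign.
have [d2 [f2 D2 _]] := PB_benign Hset_nonneg_benign.
have pullw (k : grp pBB -> grp pB) (ss : seq rword) d (f : grp pB -> grp d.1) H :
    dfor (gens pB) f H -> hom k -> size ss = 6 ->
    (forall i, i < 6 -> wf 3 (nth [::] ss i) /\ k (gn pBB i) = ev pB (nth [::] ss i)) ->
    dfor (gens pBB) (d := pulld ss d) (f \o k) (k @^-1` H : set (grp pBB)).
  move=> D kM s6 kE; apply: (pulldP D kM); first by rewrite size_gens.
  rewrite !size_gens => i i6; have [wi E] := kE i i6.
  rewrite wi nth_gens // E; split=> //.
  by apply: eq_evalw wi => l l3; rewrite nth_gens.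
have g1E i : i < 3 -> gn pBB i = inj1 mBB (gn pB i) by move=> i3; rewrite inj1_gn.
have g2E i : i < 3 -> gn pBB (3 + i) = inj2 mBB (gn pB i) by move=> i3; rewrite (inj2_gn mBB).
have E1 := pullw (prj1 mBB) [:: rgen 0; rgen 1; rgen 2; [::]; [::]; [::]] _ _ _ D1 (prj1M mBB) erefl.
have E2 := pullw (prj2 mBB) [:: [::]; [::]; [::]; rgen 0; rgen 1; rgen 2] _ _ _ D2 (prj2M mBB) erefl.
have [||f3 D3 _] := interdP (E1 _) (E2 _).
- case=> [|[|[|[|[|[|//]]]]]] _; rewrite ?[nth [::] _ _]/=; split=> //;
    rewrite ?evalw_gen ?evalw_nil.
  1-3: by rewrite g1E // prj11.
  + by rewrite (g2E 0%N) // prj12.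
  + by rewrite (g2E 1%N) // prj12.
  + by rewrite (g2E 2%N) // prj12.
- case=> [|[|[|[|[|[|//]]]]]] _; rewrite ?[nth [::] _ _]/=; split=> //;
    rewrite ?evalw_gen ?evalw_nil.
  1-3: by rewrite g1E // prj21.
  + by rewrite (g2E 0%N) // prj22.
  + by rewrite (g2E 1%N) // prj22.
  + by rewrite (g2E 2%N) // prj22.
have [|||||f4 D4 f4I] := ijdP (@gens_generates pBB) D3 (q := pG) (phi := rgens 0 6) (S := [:: rgen 6])
  (h := iotaQ) wfp_pG.
- exact: wf_rgens.
- by [].
- by rewrite size_gens.
- exact: iotaQM.
- rewrite size_gens => i i6; rewrite nth_gens // (nth_map 0) ?size_iota // nth_iota // evalw_gen.
  exact: iotaQ_gn.
eexists; exists f4 => //.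
have -> // : Jplus = subgen (iotaQ @` Eplus `|` [set x | exists2 w, w \in [:: rgen 6] & x = ev pG w]).
rewrite /Jplus; congr (subgen (_ `|` _)); apply/seteqP; split=> x.
  by move=> ->; exists (rgen 6); rewrite ?inE // evalw_gen.
by move=> [w]; rewrite inE => /eqP -> ->; rewrite evalw_gen.
Qed.

(** * Building a function of [omega_m] block by block *)

Section Omega.
Variables (m : nat) (X : set calE).
Hypothesis m0 : 0 < m.

Definition omY : set calE := h_omega m X.
Definition omZ : set calE := [set f | omY f /\ zsupp f negs].
(** The sum of [z] and [x] translated by [- m]: when [z] is negative and [x] is a block at 0, the
    new block is placed just before 0. *)
Definition om_step (z x f : calE) : Prop := forall i, (f i = z (i + m%:Z) + x (i + m%:Z))%R.

Definition blk (f : calE) (i : int) : calE := etuple [seq f (m%:Z * i + k%:Z)%R | k <- iota 0 m].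

Lemma blkE f i (k : int) :
  blk f i k = if (0 <= k < m%:Z)%R then f (m%:Z * i + k)%R else 0%R.
Proof.
rewrite etupleE; case: k => k //=; rewrite ltz_nat; case: ltnP => km.
  by rewrite (nth_map 0%N) ?size_iota // nth_iota.
by rewrite nth_default // size_map size_iota.
Qed.

Lemma blk_eq (f g : calE) i j :
  (forall k : nat, k < m -> f (m%:Z * i + k%:Z)%R = g (m%:Z * j + k%:Z)%R) -> blk f i = blk g j.
Proof.
by move=> E; congr etuple; apply/eq_in_map => k; rewrite mem_iota => /andP[_ km]; exact: E.
Qed.

Lemma blk_id (f x : calE) i : zsupp x nonnegs -> (forall k : int, (m%:Z <= k)%R -> x k = 0%R) ->
  (forall k : nat, k < m -> f (m%:Z * i + k%:Z)%R = x k) -> blk f i = x.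
Proof.
move=> x0 xm E; apply: calE_eq => k; rewrite blkE; case: ifPn => [|nk].
  by case: k => // k /andP[_ km]; apply: E; lia.
apply/esym/eqP; apply: contraR nk => xk; have := x0 _ xk; rewrite /nonnegs /= => ->.
by rewrite ltNge; apply: contra xk => /xm ->.
Qed.

Lemma omY_shift (f g : calE) c : omY g -> (forall i, f i = g (i - m%:Z * c)%R) -> omY f.
Proof.
move=> Yg E i; suff -> : etuple [seq f (m%:Z * i + k%:Z)%R | k <- iota 0 m] = blk g (i - c) by exact: Yg.
by apply: blk_eq => k km; rewrite E; congr (g _); lia.
Qed.

Lemma negs0 (f : calE) i : zsupp f negs -> (0 <= i)%R -> f i = 0%R.
Proof. by move=> fn i0; apply/eqP; apply: contraT => /fn; rewrite /negs /=; lia. Qed.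
Lemma nonnegs0 (f : calE) i : zsupp f nonnegs -> (i < 0)%R -> f i = 0%R.
Proof. by move=> fn i0; apply/eqP; apply: contraT => /fn; rewrite /nonnegs /=; lia. Qed.

(** Negativity of [f] forces [x] to vanish from [m] on, so [x] is exactly block [-1] of [f]. Earlier
    blocks come from [z], and later ones are zero like block 0 of [z]. *)
Lemma omZ_step z x f : omZ z -> X x -> zsupp x nonnegs -> om_step z x f -> zsupp f negs -> omZ f.
Proof.
move=> [Yz zn] Xx xn E fn; split=> // i; rewrite -/(blk f i).
have xm k : (m%:Z <= k)%R -> x k = 0%R.
  move=> km; have := E (k - m%:Z)%R; rewrite subrK (negs0 fn); last by lia.
  by rewrite (negs0 zn) ?add0r //; lia.
case: (ltrgtP i (-1)%R) => [i1|i1|->].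
- suff -> : blk f i = blk z (i + 1)%R by exact: Yz.
  apply: blk_eq => k km; rewrite E (nonnegs0 xn) ?addr0; first by congr (z _); lia.
  by nia.
- suff -> : blk f i = blk z 0%R by exact: Yz.
  apply: blk_eq => k km; rewrite !negs0 //; nia.
- rewrite (blk_id xn xm) // => k km; rewrite E negs0 ?add0r //; last by lia.
  by congr (x _); lia.
Qed.

(** A block far from the support is zero, and it must belong to [X]. *)
Lemma omY_zero f : omY f -> exists2 x, X x & forall i, x i = 0%R.
Proof.
move=> Yf; have [N fN] := supp_bound f; exists (blk f N%:Z); first exact: Yf.
move=> i; rewrite blkE; case: ifPn => // ik; apply/eqP; apply: contraT => /fN; nia.
Qed.

Lemma X0_omZ x : X x -> (forall i, x i = 0%R) -> omZ x.
Proof.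
move=> Xx x0; split=> [i|i]; last by rewrite x0 eqxx.
suff -> : etuple [seq x (m%:Z * i + k%:Z)%R | k <- iota 0 m] = x by [].
by apply: (@blk_id x) => [k|k _|k _]; rewrite ?x0 ?eqxx.
Qed.

(** Block [-1] is split off; the bound on the support of what remains drops by [m], which drives the
    later induction. *)
Lemma omZ_unstep f : omZ f -> exists z x, [/\ omZ z, X x, zsupp x nonnegs, om_step z x f
  & forall n : nat, (forall i, f i != 0%R -> (- (m * n.+1)%:Z <= i)%R) ->
      forall i, z i != 0%R -> (- (m * n)%:Z <= i)%R].
Proof.
move=> [Yf fn]; have [g gE] := shiftE f m%:Z.
pose z := restrict g (fun i => i < 0)%R; pose x := blk f (-1)%R.
exists z, x; have xn : zsupp x nonnegs.
  by move=> i; rewrite blkE; case: ifP => [/andP[]|]; rewrite ?eqxx.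
have zE i : z i = if (i < 0)%R then f (i - m%:Z)%R else 0%R by rewrite restrictE gE.
split=> //.
- split=> [i|i]; last by rewrite zE; case: ifP => //; rewrite ?eqxx.
  rewrite -/(blk z i); case: (ltrP i 0%R) => i0.
    suff -> : blk z i = blk f (i - 1)%R by exact: Yf.
    apply: blk_eq => k km; rewrite zE ifT; last by nia.
    by congr (f _); lia.
  suff -> : blk z i = blk f 0%R by exact: Yf.
  apply: blk_eq => k km; rewrite zE ifF; last by nia.
  by rewrite negs0 //; lia.
- exact: Yf.
- move=> i; rewrite zE blkE addrK; case: ltrP => i0.
    by rewrite /= addr0.
  rewrite add0r /=; case: ltrP => im; first by congr (f _); lia.
  by rewrite negs0 //; lia.
- move=> n fN i; rewrite zE; case: ifP => [_ /fN|_]; last by rewrite eqxx.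
  by nia.
Qed.

Lemma omY_shift_neg f : omY f -> exists n : nat, exists2 z, omZ z & forall i, f i = z (i - m%:Z * n%:Z)%R.
Proof.
move=> Yf; have [N fN] := supp_bound f; exists N.
have [z zE] := shiftE f (- (m%:Z * N%:Z))%R; exists z; last by move=> i; rewrite zE; congr (f _); lia.
split; first by apply: (omY_shift (c := (- N%:Z)%R) Yf) => i; rewrite zE; congr (f _); lia.
by move=> i; rewrite zE => /fN; rewrite /negs /=; nia.
Qed.

End Omega.

Definition nuX (X : set calE) := exists2 x, X x & forall i, x i = 0%R.

Section OmegaLabels.
Variables (m : nat) (X : set calE).
Hypothesis m0 : 0 < m.

(* An element of [omZ] is built block by block: a pair of it with an element of the second
   copy of [EB] (sheet 4) is restricted to [X] (sheet 2), both are added up in the first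
   copy by means of [Gam], which contains all [u_x * v_x^-1] (sheet 6), and the sum is
   translated by [- m] (sheet 5) and compared with [omZ] (sheet 1). The translates of
   [omZ] by multiples of [m] exhaust [omY] (sheet 0). Sheets 7 and 8 give the start, the
   zero function, which is in [omY] only if it is in [X]. *)
Definition omR (i : nat) : set (grp pBB) :=
  match i with
  | 0 => uQ @` omY m X
  | 1 => uQ @` omZ m X
  | 2 => [set q | exists z x, [/\ omZ m X z, X x & q = uQ z * vQ x]]
  | 4 => [set q | exists z v, [/\ omZ m X z, V2 v & q = uQ z * v]]
  | 5 => uQ @` [set f | exists z x, [/\ omZ m X z, X x, zsupp x nonnegs & om_step m z x f]]
  | 6 => [set q | exists z x g, [/\ omZ m X z, X x, zsupp x nonnegs, Gam g & q = uQ z * vQ x * g]]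
  | 7 => [set q | q = 1 /\ nuX X]
  | _ => [set 1]
  end.

Definition omL (i : nat) : set (grp pBB) :=
  match i with 4 => V2 | 6 => Gam | _ => [set 1] end.

Definition omN (i : nat) : set (grp pG) := Mpt (omR i) (omL i).

Lemma omLS i : is_subgroup (omL i).
Proof.
by move: i => [|[|[|[|[|[|[|i]]]]]]]; try exact: is_subgroup1; [exact: V2S | exact: GamS].
Qed.

Lemma omNS i : is_subgroup (omN i).
Proof.
apply: (Msub_subgroup freeQ); first exact: omLS.
move: i => [|[|[|[|[|[|[|i]]]]]]] r q; try by move=> Rr /= ->; rewrite mulg1.
  move=> [z [v [Zz Vv ->]]] Vq; exists z, (v * q); rewrite mulgA; split=> //.
  exact: (sgM V2S).
move=> [z [x [g [Zz Xx x0 Gg ->]]]] Gq; exists z, x, (g * q); rewrite mulgA; split=> //.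
exact: (sgM GamS).
Qed.

(** Reduces each comparison of two sheets on [F] to inclusions of index sets: inside [F] these may
    be intersected with [R'] and [L']. *)
Lemma Mpt_cap (F : set (grp pG)) R L R' L' R2 L2 x :
  F `<=` Mpt R' L' -> R `&` R' `<=` R2 -> L `&` L' `<=` L2 -> F x -> Mpt R L x -> Mpt R2 L2 x.
Proof.
by move=> FM RR LL Fx Mx; apply: MsubS (MsubI freeQ Mx (FM _ Fx)).
Qed.

Definition FV : set (grp pG) := subgen [set` [:: aQ; iotaQ (inj1 mBB Bt); iotaQ (inj1 mBB Bs)]].

Lemma Mpt1 (R L : set (grp pBB)) : is_subgroup L -> (forall r q, R r -> L q -> R (r * q)) -> R 1 ->
  is_subgroup (Mpt R L) /\ Mpt R L aQ.
Proof.
move=> LS RL R1; split; first exact: (Msub_subgroup freeQ).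
apply: (Nsub_Msub freeQ); first exact: sg1 LS.
have E : aQ = aQ ^ iotaQ 1 by rewrite (hom1 iotaQM) conjg1.
by rewrite {2}E; exact: Nsub_in.
Qed.

Lemma FV_sub : FV `<=` Mpt V1 V1.
Proof.
have [|MS Ma] := Mpt1 V1S _ (sg1 V1S); first by move=> r q; exact: (sgM V1S).
apply: subgen_min => // x; rewrite /= !inE => /or3P[] /eqP -> //.
  by apply: Msub_lam; exists Bt => //; exact: Vts_t.
by apply: Msub_lam; exists Bs => //; exact: Vts_s.
Qed.

Lemma FV_a f : FV (aQ ^ iotaQ (uQ f)).
Proof.
have FS : is_subgroup FV by exact: subgenP.
apply: (sgJ FS); first by apply: subgen_in; rewrite /= !inE eqxx.
rewrite /uQ (hom_tf _ _ _ (inj1M _)) (hom_tf _ _ _ iotaQM).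
have Ft : FV (iotaQ (inj1 mBB Bt)) by apply: subgen_in; rewrite /= !inE eqxx orbT.
have Fs : FV (iotaQ (inj1 mBB Bs)) by apply: subgen_in; rewrite /= !inE eqxx !orbT.
by apply: tf_in => // i _; apply: (sgJ FS) => //; exact: (sgXz _ FS).
Qed.

Lemma Jplus_sub : Jplus `<=` Mpt Eplus Eplus.
Proof.
have [|MS Ma] := Mpt1 EplusS _ (sg1 EplusS); first by move=> r q; exact: (sgM EplusS).
by apply: subgen_min => // _ [[q Eq <-]|->//]; exact: Msub_lam.
Qed.

Lemma Jplus_a q : Eplus q -> Jplus (aQ ^ iotaQ q).
Proof.
move=> Eq; apply: (sgJ (subgenP _)); first by apply: subgen_in; right.
by apply: subgen_in; left; exists q.
Qed.

Definition Fa : set (grp pG) := subgen [set aQ].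

Lemma Fa_sub : Fa `<=` Mpt [set 1] [set 1].
Proof.
have [|//|MS Ma] := @Mpt1 [set 1] [set 1] (is_subgroup1 _); first by move=> r q /= -> ->; rewrite mulg1.
by apply: subgen_min => // x ->.
Qed.

Definition RH : set (grp pBB) := [set q | exists v x, [/\ V1 v, X x & q = v * vQ x]].

Section FH.
Variables (h : F3 -> grp pG).
Hypotheses (hM : hom h) (ha : h a3 = aQ) (hb : h b3 = iotaQ (inj2 mBB Bt))
  (hc : h c3 = iotaQ (inj2 mBB Bs)).

(** Carries the condition that the second coordinate is in [X]: [A_X] is placed over the second
    copy, while [t] and [s] of the first copy leave the first coordinate free. *)
Definition FH : set (grp pG) :=
  subgen ((h @` A_of X) `|` [set` [:: iotaQ (inj1 mBB Bt); iotaQ (inj1 mBB Bs)]]).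

Lemma h_af x : h (af x) = aQ ^ iotaQ (vQ x).
Proof. by rewrite (psi_af freeQ hM ha hb hc) /vQ (hom_tf _ _ _ (inj2M _)). Qed.

Lemma V1_v v x : V1 v -> v * vQ x = vQ x * v.
Proof. by move=> [w _ <-]; exact: inj_comm. Qed.

Lemma FH_sub : FH `<=` Mpt RH V1.
Proof.
apply: subgen_min => [|y].
  apply: (Msub_subgroup freeQ); first exact: V1S.
  move=> _ q [v [x [Vv Xx ->]]] Vq; exists (v * q), x; split=> //; first exact: (sgM V1S).
  by rewrite -mulgA -V1_v // mulgA.
move=> [[z Az <-]|]; last first.
  rewrite /= !inE => /orP[] /eqP ->.
    by apply: Msub_lam; exists Bt => //; exact: Vts_t.
  by apply: Msub_lam; exists Bs => //; exact: Vts_s.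
apply: (Nsub_Msub freeQ); first exact: sg1 V1S.
apply: (hom_subgen hM (subgenP _) _ Az) => _ [x Xx <-]; rewrite h_af; apply: Nsub_in.
by exists 1, x; rewrite mul1g; split=> //; exact: sg1 V1S.
Qed.

Lemma FH_a f x : X x -> FH (aQ ^ iotaQ (uQ f * vQ x)).
Proof.
move=> Xx; have FS : is_subgroup FH by exact: subgenP.
rewrite uvC iotaQM conjgM -h_af; apply: (sgJ FS).
  by apply: subgen_in; left; exists (af x) => //; exact: A_of_in.
rewrite /uQ (hom_tf _ _ _ (inj1M _)) (hom_tf _ _ _ iotaQM).
have Ft : FH (iotaQ (inj1 mBB Bt)) by apply: subgen_in; right; rewrite /= !inE eqxx.
have Fs : FH (iotaQ (inj1 mBB Bs)) by apply: subgen_in; right; rewrite /= !inE eqxx !orbT.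
by apply: tf_in => // i _; apply: (sgJ FS) => //; exact: (sgXz _ FS).
Qed.

Lemma uQ1f f : uQ f = 1 -> forall i, f i = 0%R.
Proof.
move=> E i; have := val0_tB f i; have := congr1 (prj1 mBB) E.
rewrite prj1_u (hom1 (prj1M _)) => ->; have [g gE] := @mkE (fun _ => 0%R) 0 (fun i => ltac:(by rewrite eqxx)).
by rewrite -(tB1 gE) val0_tB gE.
Qed.

Lemma tB1f f : tB f = 1 -> forall i, f i = 0%R.
Proof. by move=> E; apply: uQ1f; rewrite /uQ E (hom1 (inj1M _)). Qed.

Lemma vQ1 (f : calE) : (forall i, f i = 0%R) -> vQ f = 1.
Proof. by move=> f0; rewrite /vQ tB1 // (hom1 (inj2M _)). Qed.

Lemma omN01 x : Jplus x -> omN 0 x <-> omN 1 x.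
Proof.
move=> Jx; split; last first.
  by apply: MsubS => // _ [f [Yf _] <-]; exists f.
apply: (Mpt_cap Jplus_sub) Jx => [_ [[f Yf <-] [E1 _]]|_ [->]//].
by exists f => //; split=> //; apply: PB_supp; rewrite prj1_u in E1.
Qed.

Lemma V21 : V2 `&` V1 `<=` [set 1]. Proof. by move=> q [Vq V1q]; exact: V12. Qed.

Lemma omN14 x : FV x -> omN 1 x <-> omN 4 x.
Proof.
move=> Fx; split.
  apply: MsubS => [_ [z Zz <-]|_ ->]; last exact: sg1 V2S.
  by exists z, 1; rewrite mulg1; split=> //; exact: sg1 V2S.
apply: (Mpt_cap FV_sub) V21 Fx => _ [[z [v [Zz Vv ->]]] V].
exists z => //; rewrite [X in _ * X](V12 _ Vv) ?mulg1 //.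
by apply/(sgMl _ V1S (V1_uQ z)).
Qed.

Lemma omN24 x : FH x -> omN 2 x <-> omN 4 x.
Proof.
move=> Fx; split.
  apply: MsubS => [_ [z [y [Zz Xy ->]]]|_ ->]; last exact: sg1 V2S.
  by exists z, (vQ y); split=> //; exact: V2_vQ.
apply: (Mpt_cap FH_sub) V21 Fx => _ [[z [v [Zz Vv ->]]] [w [y [Vw Xy E]]]].
exists z, y; split=> //; congr (_ * _).
have := congr1 (prj2 mBB) E; rewrite !(prj2M mBB) prj2_u mul1g (V1_prj2 Vw) mul1g => E2.
by apply: prj_eq => //; rewrite (V2_prj1 Vv) prj1_v.
Qed.

Lemma Eplus_uv z x : zsupp z negs -> zsupp x nonnegs -> Eplus (uQ z * vQ x).
Proof.
move=> zn xn; split; rewrite /= ?(prj1M mBB) ?(prj2M mBB).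
  by rewrite prj1_u prj1_v mulg1; exact: tB_PB.
by rewrite prj2_u prj2_v mul1g; exact: tB_PB.
Qed.

(** The intersection with [Jplus] makes [x] nonnegative and, as [Eplus] meets [Gam] trivially,
    removes the factor from [Gam]. *)
Lemma omN26 x : Jplus x -> omN 2 x <-> omN 6 x.
Proof.
move=> Jx; split; apply: (Mpt_cap Jplus_sub) Jx.
- move=> _ [[z [y [Zz Xy ->]]] [E1 E2]].
  exists z, y, 1; rewrite mulg1; split=> //; last exact: sg1 GamS.
  by apply: PB_supp; move: E2; rewrite /= (prj2M mBB) prj2_u prj2_v mul1g.
- by move=> _ [-> _]; exact: sg1 GamS.
- move=> _ [[z [y [g [Zz Xy yn Gg ->]]]] E]; exists z, y; split=> //.
  rewrite [X in _ * X](Gam_Eplus Gg) ?mulg1 //.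
  by apply/(sgMl _ EplusS (Eplus_uv Zz.2 yn)).
- by move=> q [Gq Eq]; exact: Gam_Eplus.
Qed.

(** An element [uQ z * vQ y * g] that lies in the first copy has its factor [g] determined by
    [Gam_prj2]. It equals [uQ z * uQ y], the sum that [sg] translates. *)
Lemma omN65 sg x : is_sig (- m%:Z)%R sg -> FV x -> omN 6 x <-> omN 5 (sg x).
Proof.
move=> sgP Fx.
have [sg' sgP'] := sig_ex m%:Z.
pose R : set (grp pBB) := [set q | exists z y, [/\ omZ m X z, X y, zsupp y nonnegs & q = uQ z * uQ y]].
have sR z y f : om_step m z y f -> sg (aQ ^ iotaQ (uQ z * uQ y)) = aQ ^ iotaQ (uQ f).
  move=> E; have [g gE] := addE z y; rewrite -(uQM gE); apply: sig_au sgP _ => i.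
  by rewrite E gE opprK.
split.
  move=> Nx; have : Mpt R [set 1] x.
    apply: (Mpt_cap FV_sub) Fx Nx.
      move=> _ [[z [y [g [Zz Xy yn Gg ->]]]] V]; exists z, y; split=> //.
      have /(Gam_prj2 Gg) -> : prj2 mBB g = (tB y)^-1.
        have := V1_prj2 V; rewrite !(prj2M mBB) prj2_u prj2_v mul1g => E.
        by rewrite -[LHS](mulKg (tB y)) E mulg1.
      by rewrite -mulgA; congr (_ * _); rewrite mulgA -uvC mulgK.
    move=> q [Gq Vq]; have := V1_prj2 Vq.
    have [y yE] := @mkE (fun _ => 0%R) 0 (fun i => ltac:(by rewrite eqxx)).
    move=> E; rewrite /= (@Gam_prj2 q y Gq) ?E ?(tB1 yE) ?invg1 // vQ1 // uQ1 // invg1; exact: mulg1.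
  rewrite /omN /Mpt [omL _]/= !(Msub1 freeQ) => Rx.
  have [sM sa si] := sgP.
  apply: (hom_subgen sM (subgenP _) _ Rx) => _ [_ [z [y [Zz Xy yn ->]]] <-].
  have [g gE] := addE z y; have [f fE] := shiftE g (- m%:Z)%R.
  have E : om_step m z y f by move=> i; rewrite fE gE opprK.
  by rewrite (sR _ _ _ E); apply: Nsub_in; exists f => //; exists z, y.
rewrite /omN /Mpt [omL _]/= !(Msub1 freeQ) => Nx.
have sK u : sg' (sg u) = u by apply: sig_inv sgP _ _; rewrite opprK.
rewrite -[x]sK; have [sM sa si] := sgP'.
apply: (hom_subgen sM (omNS 6) _ Nx) => _ [_ [f [z [y [Zz Xy yn E]]] <-] <-].
rewrite -(sR _ _ _ E) sK; apply: (Nsub_Msub freeQ); first exact: sg1 GamS.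
apply: Nsub_in; exists z, y, (uQ y * (vQ y)^-1); split=> //; first exact: Gam_uv.
by rewrite -mulgA [vQ y * _]mulgA -uvC mulgK.
Qed.

Lemma omN51 x : Jplus x -> omN 5 x <-> omN 1 x.
Proof.
move=> Jx; split; apply: (Mpt_cap Jplus_sub) Jx; try by move=> _ [-> _].
  move=> _ [[f [z [y [Zz Xy yn E]]] <-] [E1 _]]; exists f => //.
  by apply: (omZ_step m0 Zz Xy yn E); apply: PB_supp; rewrite prj1_u in E1.
move=> _ [[f /(omZ_unstep m0)[z [y [Zz Xy yn E _]]] <-] _].
by exists f => //; exists z, y.
Qed.

Lemma omN17 x : Fa x -> omN 1 x <-> omN 7 x.
Proof.
move=> Fx; split; apply: (Mpt_cap Fa_sub) Fx; try by move=> _ [-> _].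
  by move=> _ [[f [Yf _] <-] E]; split=> //; exact: omY_zero Yf.
move=> _ [[-> [y Xy y0]] _]; exists y; last exact: uQ1.
exact: X0_omZ.
Qed.

(** [FH] lies in [Mpt RH V1], and [RH] contains 1 only if the zero function is in [X]. As [a]
    belongs to sheet 8 in any case, the start can be written down without deciding whether it is. *)
Lemma omN78 x : FH x -> omN 7 x <-> omN 8 x.
Proof.
move=> Fx; split; first by apply: MsubS => // q [->].
apply: (Mpt_cap FH_sub) Fx => [_ [-> [v [y [Vv Xy E]]]]|_ [-> _]//]; split=> //.
exists y => //; apply: tB1f; have := congr1 (prj2 mBB) E.
by rewrite (hom1 (prj2M _)) (prj2M mBB) (V1_prj2 Vv) mul1g prj2_v.
Qed.

Lemma omN00 sg x : is_sig m%:Z sg -> omN 0 x <-> omN 0 (sg x).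
Proof.
move=> sgP; have [sg' sgP'] := sig_ex (- m%:Z)%R.
have sK u : sg' (sg u) = u by exact: (sig_inv sgP sgP').
rewrite /omN /Mpt [omL _]/= !(Msub1 freeQ); split=> Nx.
  have [sM _ _] := sgP; apply: (hom_subgen sM (subgenP _) _ Nx) => _ [_ [f Yf <-] <-].
  have [g gE] := shiftE f m%:Z; rewrite (sig_au sgP gE); apply: Nsub_in; exists g => //.
  by apply: (omY_shift m0 (c := 1%R) Yf) => i; rewrite mulr1.
rewrite -[x]sK; have [sM _ _] := sgP'.
apply: (hom_subgen sM (subgenP _) _ Nx) => _ [_ [f Yf <-] <-].
have [g gE] := shiftE f (- m%:Z)%R; rewrite (sig_au sgP' gE); apply: Nsub_in; exists g => //.
by apply: (omY_shift m0 (c := (-1)%R) Yf) => i; rewrite mulrN1.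
Qed.

End FH.
End OmegaLabels.

(** * The presentation for [omega_m] *)

Definition evs p (s : seq rword) : set (grp p) := subgen [set x | exists2 w, w \in s & x = ev p w].
Arguments evs : clear implicits.

(** Generators of [L1 * K2], and below of [K1 * L2], in the product of the groups of two data. On
    the diagonal they cut out the two benign subgroups, so a letter can be made to commute with
    either by finitely many relators. *)
Definition filt1 (d1 d2 : datum) : seq rword := d1.2.2 ++ rgens d1.1.1 d2.1.1.
Definition filt2 (d1 d2 : datum) : seq rword := rgens 0 d1.1.1 ++ map (shw d1.1.1) d2.2.2.

Section Filters.
Variables (d1 d2 : datum) (mp : prod_maps d1.1 d2.1).
Hypotheses (w1 : all (wf d1.1.1) d1.2.2) (w2 : all (wf d2.1.1) d2.2.2).

Lemma wf_filt1 : all (wf (prodp d1.1 d2.1).1) (filt1 d1 d2).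
Proof. by rewrite all_cat (all_wf_leq (leq_addr _ _) w1) wf_rgens. Qed.

Lemma wf_filt2 : all (wf (prodp d1.1 d2.1).1) (filt2 d1 d2).
Proof. by rewrite all_cat all_wf_shw // andbT; apply: wf_rgens; rewrite leq_addr. Qed.

Lemma evs_filt1 g : evs (prodp d1.1 d2.1) (filt1 d1 d2) g <-> dsub (prj1 mp g).
Proof.
split.
  apply: (hom_subgen (prj1M mp) (subgenP _)) => _ [w + ->]; rewrite mem_cat => /orP[wL|/mem_rgens[i i2 ->]].
    by rewrite -(inj1_ev mp) ?(allP w1) // prj11; apply: subgen_in; exists w.
  by rewrite evalw_gen -(inj2_gn mp) // prj12; exact: sg1 (subgenP _).
move=> Dg; rewrite (prodE mp g); apply: (sgM (subgenP _)).
  apply: (hom_subgen (inj1M mp) (subgenP _) _ Dg) => _ [w wL ->].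
  by apply: subgen_in; exists w; rewrite ?mem_cat ?wL // inj1_ev // (allP w1).
apply: (grp_ind (T := inj2 mp @^-1` evs (prodp d1.1 d2.1) (filt1 d1 d2))) => [|i i2].
  by apply: is_subgroup_preim; [exact: inj2M | exact: subgenP].
rewrite /preimage /= inj2_gn //; apply: subgen_in; exists (rgen (d1.1.1 + i)); last by rewrite evalw_gen.
by rewrite mem_cat; apply/orP; right; apply/mem_rgens; exists i.
Qed.

Lemma evs_filt2 g : evs (prodp d1.1 d2.1) (filt2 d1 d2) g <-> dsub (prj2 mp g).
Proof.
split.
  apply: (hom_subgen (prj2M mp) (subgenP _)) => _ [w + ->].
  rewrite mem_cat => /orP[/mem_rgens[i i1 ->]|/mapP[v vL ->]].
    by rewrite evalw_gen add0n -(inj1_gn mp) // prj21; exact: sg1 (subgenP _).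
  by rewrite -(inj2_ev mp) ?(allP w2) // prj22; apply: subgen_in; exists v.
move=> Dg; rewrite (prodE mp g); apply: (sgM (subgenP _)).
  apply: (grp_ind (T := inj1 mp @^-1` evs (prodp d1.1 d2.1) (filt2 d1 d2))) => [|i i1].
    by apply: is_subgroup_preim; [exact: inj1M | exact: subgenP].
  rewrite /preimage /= inj1_gn //; apply: subgen_in; exists (rgen i); last by rewrite evalw_gen.
  by rewrite mem_cat; apply/orP; left; apply/mem_rgens; exists i.
apply: (hom_subgen (inj2M mp) (subgenP _) _ Dg) => _ [w wL ->].
apply: subgen_in; exists (shw d1.1.1 w); first by rewrite mem_cat map_f ?orbT.
by rewrite inj2_ev // (allP w2).
Qed.

End Filters.

Definition wpow (w : rword) m : rword := flatten (nseq m w).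

Lemma evalw_pow (G : groupType) (nu : nat -> G) w m : evalw nu (wpow w m) = evalw nu w ^+ m.
Proof. by elim: m => [|m IHm]; rewrite ?evalw_nil // /wpow /= evalw_cat expgS -IHm. Qed.

Lemma wf_pow n w m : wf n w -> wf n (wpow w m).
Proof. by move=> ww; elim: m => [//|m IHm]; rewrite /wpow /= wf_cat ww IHm. Qed.

Definition cwd (u e : rword) : rword := rinv e ++ u ++ e.
Definition shiftp (wa wt ws wk : rword) : seq (rword * rword) :=
  [:: (wa, wa); (wt, wconj wt wk); (ws, ws)].

Definition omW (d3 dc : datum) : seq rword := zipw d3.1.1 d3.2.1 dc.2.1.

(** [m] occurs only in the power [k] of [s]; the number of letters does not depend on it. *)
Definition om_letters m (d3 dc : datum) : seq (seq (rword * rword)) :=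
  let w := nth [::] (omW d3 dc) in
  let f1 := diagp (filt1 d3 dc) in let f2 := diagp (filt2 d3 dc) in
  let k := wpow (w 1%N) m in
  [:: shiftp (w 6) (w 0%N) (w 1%N) k; f2; diagp [:: w 6; w 0%N; w 1%N]; f1; f2;
      shiftp (w 6) (w 0%N) (w 1%N) (rinv k); f2; diagp [:: w 6]; f1].

Definition om_lab k := nth (0%N, 0%N)
  [:: (0, 0); (1, 0); (1, 4); (2, 4); (2, 6); (6, 5); (5, 1); (1, 7); (7, 8)]%N k.

(* The words [e_i] lead from the sheet of label 0 to the sheet of label [i]. *)
Definition om_path n : seq rword :=
  let t k := rgen (n + k) in
  let e1 := rinv (t 1%N) in let e4 := t 2 ++ e1 in let e2 := rinv (t 3) ++ e4 in
  let e6 := t 4 ++ e2 in let e5 := t 5 ++ e6 in let e7 := t 7 ++ e1 in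
  [:: [::]; e1; e2; [::]; e4; e5; e6; e7; t 8 ++ e7].

(** In order: the translation of sheet 0, two generators of the second copy at sheet 4, two of [Gam]
    at sheet 6, the passage from sheet 5 to sheet 1, and [a] at sheet 8. *)
Definition om_L (d3 dc : datum) : seq rword :=
  let w := nth [::] (omW d3 dc) in let n := (prodp d3.1 dc.1).1 in
  let e := nth [::] (om_path n) in
  [:: rgen n; cwd (w 3) (e 4); cwd (w 4) (e 4); cwd (w 0%N ++ rinv (w 3)) (e 6);
      cwd (w 1%N ++ w 4) (e 6); rinv (e 1%N) ++ rgen (n + 6) ++ e 5; cwd (w 6) (e 8)].

Definition omd m (d3 dc : datum) : datum :=
  (hnnp (prodp d3.1 dc.1) (om_letters m d3 dc), (omW d3 dc, om_L d3 dc)).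

Local Arguments wfps : simpl never.

Section OmegaDatum.
Variables (m : nat) (X : set calE) (h : F3 -> grp pG).
Hypothesis m0 : 0 < m.
Hypotheses (hM : hom h) (ha : h a3 = aQ) (hb : h b3 = iotaQ (inj2 mBB Bt))
  (hc : h c3 = iotaQ (inj2 mBB Bs)).
Variables (d3 dc : datum) (f3 : grp pG -> grp d3.1) (fc : grp pG -> grp dc.1).
Hypotheses (D3 : dfor (gens pG) f3 (FH X h)) (DC : dfor (gens pG) fc Jplus).
Hypothesis f3I : injective f3.

Let b := prodp d3.1 dc.1.
Let bw : wfp b. Proof. exact: wfp_prodp (dfor_wfp D3) (dfor_wfp DC). Qed.
Let w := nth [::] (omW d3 dc).
Let ut := iotaQ (inj1 mBB Bt).
Let us := iotaQ (inj1 mBB Bs).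
Let vt := iotaQ (inj2 mBB Bt).
Let vs := iotaQ (inj2 mBB Bs).

Lemma omd_ex : exists2 f' : grp pG -> grp (omd m d3 dc).1,
  dfor (gens pG) f' (omN m X 0) & injective f'.
Proof.
have [mp] := prod_mapsP (dfor_wfp D3) (dfor_wfp DC).
pose ga x := pairm mp (f3 x) (fc x).
have gaM : hom ga by apply: pair_hom; [exact: dforM D3 | exact: dforM DC].
have gaI : injective ga.
  by move=> x y /(congr1 (prj1 mp)); rewrite !prj1_pair; exact: f3I.
have s3 := dfor_size D3; have sc := dfor_size DC; rewrite size_gens in s3 sc.
have wE i : i < 7 -> ev b (w i) = ga (gn pG i).
  move=> i7; have gE : nth 1 (gens pG) i = gn pG i by rewrite nth_gens.
  have := zipw_ev mp (dfor_size D3) (dfor_size DC) (dfor_wfg D3) (dfor_wfg DC)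
    (dfor_gen D3) (dfor_gen DC) (i := i).
  by rewrite size_gens gE => /(_ i7) E; exact/esym/E.
have gE : [/\ gn pG 0 = ut, gn pG 1 = us, gn pG 3 = vt & gn pG 4 = vs].
  by split; rewrite -iotaQ_gn //; congr iotaQ; rewrite ?(inj1_gn mBB) // (inj2_gn mBB _).
have [w0 w1 w3 w4] : [/\ ev b (w 0%N) = ga ut, ev b (w 1%N) = ga us, ev b (w 3) = ga vt & ev b (w 4) = ga vs].
  by have [<- <- <- <-] := gE; split; exact: wE.
have w6 : ev b (w 6) = ga aQ by exact: wE.
have Ww : all (wf b.1) (omW d3 dc) by apply: wf_zipw; [exact: dfor_wfg D3 | exact: dfor_wfg DC].
have ww i : i < 7 -> wf b.1 (w i).
  by move=> i7; apply: (allP Ww); rewrite mem_nth // size_zipw ?s3 // sc.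
(* [F k] is the part of [pG] on which letter [k] is compared; for a commuting letter, [S k]
   generates the subgroup of the base that cuts it out. *)
pose F k : set (grp pG) := nth setT [:: FV; Jplus; FV; FH X h; Jplus; FV; Jplus; Fa; FH X h] k.
pose S k : seq rword := nth [::] [:: [::]; filt2 d3 dc; [:: w 6; w 0%N; w 1%N]; filt1 d3 dc;
  filt2 d3 dc; [::]; filt2 d3 dc; [:: w 6]; filt1 d3 dc] k.
have imS s T : (forall x, (exists2 v, v \in s & x = ev b v) <-> (exists2 y, T y & x = ga y)) ->
    forall x, evs b s (ga x) <-> subgen T x.
  move=> E x; split=> [|Tx]; last first.
    by apply: (hom_subgen gaM (subgenP _) _ Tx) => y Ty; apply: subgen_in; apply/E; exists y.
  suff sub : evs b s `<=` ga @` subgen T by move=> /sub[y Ty /gaI <-].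
  apply: subgen_min; first exact: (is_subgroup_im gaM (subgenP _)).
  by move=> _ /E[y Ty ->]; exists y => //; exact: subgen_in.
have SF k : k \in [:: 1; 2; 3; 4; 6; 7; 8]%N -> forall x, evs b (S k) (ga x) <-> F k x.
  have c1 x : evs b (filt1 d3 dc) (ga x) <-> FH X h x.
    by rewrite (evs_filt1 mp (dfor_wfL D3)) prj1_pair; exact: dfor_sub D3 x.
  have c2 x : evs b (filt2 d3 dc) (ga x) <-> Jplus x.
    by rewrite (evs_filt2 mp (dfor_wfL DC)) prj2_pair; exact: dfor_sub DC x.
  case: k => [|[|[|[|[|[|[|[|[|]]]]]]]]] // _.
    apply: imS => x; split=> [[v]|[y]]; rewrite /= !inE => /or3P[] /eqP -> ->.
    - by exists aQ; rewrite /= ?inE ?eqxx.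
    - by exists ut; rewrite /= ?inE ?eqxx ?orbT.
    - by exists us; rewrite /= ?inE ?eqxx ?orbT.
    - by exists (w 6); rewrite /= ?inE ?eqxx.
    - by exists (w 0%N); rewrite /= ?inE ?eqxx ?orbT.
    - by exists (w 1%N); rewrite /= ?inE ?eqxx ?orbT.
  apply: imS => x; split=> [[v]|[y ->]->].
    by rewrite inE => /eqP -> ->; exists aQ.
  by exists (w 6); rewrite ?inE.
have [sg sgP] := sig_ex m%:Z; have [sg' sgP'] := sig_ex (- m%:Z)%R.
pose M i : set (grp b) := ga @` omN m X i.
have MS i : is_subgroup (M i) by exact: (is_subgroup_im gaM (omNS m X i)).
have Mf i z : M i (ga z) <-> omN m X i z by split=> [[z' Sz /gaI <-]//|Sz]; exists z.
have kw : wf b.1 (wpow (w 1%N) m) by exact/wf_pow/ww.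
have shw' k : wf b.1 k -> wfps b.1 (shiftp (w 6) (w 0%N) (w 1%N) k).
  by move=> kw'; rewrite /wfps /= /wconj !wf_cat wf_rinv !ww // kw'.
have f1w := wf_filt1 dc (dfor_wfL D3).
have f2w := wf_filt2 d3 (dfor_wfL DC).
pose ls := om_letters m d3 dc.
have lsw : all (wfps b.1) ls.
  by rewrite /ls /om_letters -/w /= !shw' ?wf_rinv // !wfps_diagp f1w f2w /wfps /= !ww.
have sgus k sk : is_sig k sk -> sk us = us /\ sk ut = ut ^ expz us k.
  move=> [sM sa si]; rewrite /us /ut !si !prj11 !prj21 !(hom1 (inj2M _)) !mulg1; split.
    by congr iotaQ; congr (inj1 _ _); apply/conjg_fixP/commgP/commute_expz.
  by rewrite (homJ (inj1M _)) (homJ iotaQM) (homXz (inj1M _)) (homXz iotaQM).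
have shE k sk kwd : is_sig k sk -> ev b kwd = ga (expz us k) ->
    forall xy, xy \in shiftp (w 6) (w 0%N) (w 1%N) kwd ->
    exists z, [/\ FV z, ev b xy.1 = ga z & ev b xy.2 = ga (sk z)].
  move=> sP kE xy; have [sus sut] := sgus _ _ sP; have [sM sa _] := sP.
  rewrite !inE => /or3P[] /eqP ->.
  - by exists aQ; rewrite sa; split=> //; apply: subgen_in; rewrite /= !inE eqxx.
  - exists ut; rewrite evalw_conj w0 kE sut (homJ gaM); split=> //.
    by apply: subgen_in; rewrite /= !inE eqxx orbT.
  - by exists us; rewrite sus; split=> //; apply: subgen_in; rewrite /= !inE eqxx !orbT.
have k1 : ev b (wpow (w 1%N) m) = ga (expz us m%:Z).
  by rewrite evalw_pow w1 -(homX gaM).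
have k2 : ev b (rinv (wpow (w 1%N) m)) = ga (expz us (- m%:Z)%R).
  by rewrite evalw_inv k1 -(homV gaM) expzN.
have sK u : sg' (sg u) = u by exact: (sig_inv sgP sgP').
have sK' u : sg (sg' u) = u by apply: (sig_inv sgP'); rewrite opprK.
have idP i j k : k \in [:: 1; 2; 3; 4; 6; 7; 8]%N ->
    (forall z, F k z -> omN m X i z <-> omN m X j z) ->
    matching M i j (fun x y => x = y /\ evs b (S k) x).
  move=> kk H; apply: matching_id; first exact: subgenP.
  move=> x Dx; split=> -[z Sz E]; rewrite -E in Dx *; have Hz := proj1 (SF k kk z) Dx.
    by apply/Mf/(H z Hz).
  by apply/Mf/(H z Hz).
have idE k xy : xy \in diagp (S k) -> ev b xy.1 = ev b xy.2 /\ evs b (S k) (ev b xy.1).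
  by move=> /mem_diagp[xL ->]; split=> //; apply: subgen_in; exists xy.1.
have homP th i j : hom th -> injective th -> (forall z, FV z -> omN m X i z <-> omN m X j (th z)) ->
    matching M i j (fun x y => exists z, [/\ FV z, x = ga z & y = ga (th z)]).
  move=> thM thI H; apply: matching_hom => //; first exact: subgenP.
  - exact: hom_comp thM gaM.
  - by move=> z; rewrite (hom_inj1 gaM gaI) -(hom_inj1 thM thI) -(hom_inj1 gaM gaI) //.
  - by move=> z Fz; rewrite !Mf; exact: H.
have [k kl|mo] := @hnn_modelP b ls M om_lab bw lsw MS.
  case: k kl => [|[|[|[|[|[|[|[|[|//]]]]]]]]] _.
  - exists (fun x y => exists z, [/\ FV z, x = ga z & y = ga (sg z)]); last exact: shE sgP k1.
    apply: homP; [by case: sgP | exact: can_inj sK |].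
    by move=> z _; exact: omN00.
  - by exists (fun x y => x = y /\ evs b (S 1%N) x); [apply: idP => // z Fz; split=> /(omN01 m X Fz) | move=> xy; exact: (@idE 1%N xy)].
  - by exists (fun x y => x = y /\ evs b (S 2%N) x); [apply: idP => // z; exact: omN14 | move=> xy; exact: (@idE 2%N xy)].
  - by exists (fun x y => x = y /\ evs b (S 3%N) x); [apply: idP => // z; exact: omN24 | move=> xy; exact: (@idE 3%N xy)].
  - by exists (fun x y => x = y /\ evs b (S 4%N) x); [apply: idP => // z; exact: omN26 | move=> xy; exact: (@idE 4%N xy)].
  - exists (fun x y => exists z, [/\ FV z, x = ga z & y = ga (sg' z)]); last exact: shE sgP' k2.
    apply: homP; [by case: sgP' | exact: can_inj sK' |].
    by move=> z Fz; exact: omN65.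
  - by exists (fun x y => x = y /\ evs b (S 6%N) x); [apply: idP => // z; exact: omN51 | move=> xy; exact: (@idE 6%N xy)].
  - by exists (fun x y => x = y /\ evs b (S 7%N) x); [apply: idP => // z; exact: omN17 | move=> xy; exact: (@idE 7%N xy)].
  - by exists (fun x y => x = y /\ evs b (S 8%N) x); [apply: idP => // z; exact: omN78 | move=> xy; exact: (@idE 8%N xy)].
pose q := hnnp b ls; pose j := hbase mo; have jM : hom j by exact: hbaseM.
have jE u : wf b.1 u -> ev q u = j (ev b u) by move=> uw; rewrite /j hbase_ev.
pose t k := gn q (b.1 + k).
have tE k : ev q (rgen (b.1 + k)) = t k by rewrite evalw_gen.
pose e1 := (t 1%N)^-1; pose e4 := t 2 * e1; pose e2 := (t 3)^-1 * e4; pose e6 := t 4 * e2.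
pose e5 := t 5 * e6; pose e7 := t 7 * e1; pose e8 := t 8 * e7.
pose r k := rgen (b.1 + k).
pose p1 := rinv (r 1%N); pose p4 := r 2 ++ p1; pose p2 := rinv (r 3) ++ p4.
pose p6 := r 4 ++ p2; pose p5 := r 5 ++ p6; pose p7 := r 7 ++ p1; pose p8 := r 8 ++ p7.
have P1 : ev q p1 = e1 by rewrite evalw_inv tE.
have P4 : ev q p4 = e4 by rewrite evalw_cat tE P1.
have P2 : ev q p2 = e2 by rewrite evalw_cat evalw_inv tE P4.
have P6 : ev q p6 = e6 by rewrite evalw_cat tE P2.
have P5 : ev q p5 = e5 by rewrite evalw_cat tE P6.
have P7 : ev q p7 = e7 by rewrite evalw_cat tE P1.
have P8 : ev q p8 = e8 by rewrite evalw_cat tE P7.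
have cwdE u e : ev q (cwd u e) = (ev q e)^-1 * (ev q u * ev q e).
  by rewrite !evalw_cat evalw_inv.
pose d : datum := omd m d3 dc.
pose T := @dsub d; have TS : is_subgroup T by exact: subgenP.
have LE : om_L d3 dc = [:: rgen b.1; cwd (w 3) p4; cwd (w 4) p4;
    cwd (w 0%N ++ rinv (w 3)) p6; cwd (w 1%N ++ w 4) p6;
    rinv p1 ++ r 6 ++ p5; cwd (w 6) p8] by [].
have Tw u : u \in om_L d3 dc -> T (ev q u) by move=> uL; apply: subgen_in; exists u.
pose f' x := j (ga x); have f'M : hom f' by exact: hom_comp gaM jM.
have gt k : k < 9 -> goes mo (om_lab k).1 (om_lab k).2 (t k) by exact: (goes_letter mo (k := k)).
have o1 : goes mo 0 1 e1 by exact: goesV (gt 1%N isT).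
have o4 : goes mo 0 4 e4 by exact: goesM (gt 2 isT) o1.
have o2 : goes mo 0 2 e2 by exact: goesM (goesV (gt 3 isT)) o4.
have o6 : goes mo 0 6 e6 by exact: goesM (gt 4 isT) o2.
have o5 : goes mo 0 5 e5 by exact: goesM (gt 5 isT) o6.
have o7 : goes mo 0 7 e7 by exact: goesM (gt 7 isT) o1.
have o8 : goes mo 0 8 e8 by exact: goesM (gt 8 isT) o7.
have gb i x : omN m X i x -> goes mo i i (f' x) by move=> Nx; apply/goes_base => //; apply/Mf.
have wj i x : i < 7 -> ev b (w i) = ga x -> ev q (w i) = f' x.
  by move=> i7 E; rewrite jE ?ww // E.
have wt : ev q (w 0%N) = f' ut by exact: wj.
have ws : ev q (w 1%N) = f' us by exact: wj.
have wvt : ev q (w 3) = f' vt by exact: wj.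
have wvs : ev q (w 4) = f' vs by exact: wj.
have wa : ev q (w 6) = f' aQ by exact: wj.
have G1 : ev q (w 0%N ++ rinv (w 3)) = f' (iotaQ g1).
  by rewrite evalw_cat evalw_inv wt wvt -(homV f'M) -f'M -(homV iotaQM) -iotaQM -(homV (inj2M _)).
have G2 : ev q (w 1%N ++ w 4) = f' (iotaQ g2) by rewrite evalw_cat ws wvs -f'M -iotaQM.
have Gg1 : Gam g1 by apply: subgen_in; rewrite /= inE eqxx.
have Gg2 : Gam g2 by apply: subgen_in; rewrite /= !inE eqxx orbT.
have Vt2 : V2 (inj2 mBB Bt) by exists Bt => //; exact: Vts_t.
have Vs2 : V2 (inj2 mBB Bs) by exists Bs => //; exact: Vts_s.
have upper u : u \in om_L d3 dc -> goes mo 0 0 (ev q u).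
  rewrite LE !inE; do 5?[case/orP]; last case/orP; move=> /eqP ->; rewrite ?cwdE.
  - by rewrite -[b.1]addn0 tE; exact: (gt 0%N isT).
  - by rewrite P4 wvt; apply: goesJ o4; apply: gb; exact: Msub_lam.
  - by rewrite P4 wvs; apply: goesJ o4; apply: gb; exact: Msub_lam.
  - by rewrite P6 G1; apply: goesJ o6; apply: gb; exact: Msub_lam.
  - by rewrite P6 G2; apply: goesJ o6; apply: gb; exact: Msub_lam.
  - rewrite evalw_cat evalw_inv evalw_cat tE P1 P5.
    exact: goesM (goesV o1) (goesM (gt 6 isT) o5).
  - rewrite P8 wa; apply: goesJ o8; apply: gb; apply: (Nsub_Msub freeQ) => //.
    have E : aQ = aQ ^ iotaQ 1 by rewrite (hom1 iotaQM) conjg1.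
    by rewrite {2}E; exact: Nsub_in.
have f'I : injective f' by move=> x y /hbase_inj; exact: gaI.
exists f' => //; split=> //.
- have rw k : k < 9 -> wf q.1 (r k) by move=> k9; rewrite /wf /= ltn_add2l k9.
  have ww' i : i < 7 -> wf q.1 (w i) by move=> i7; apply: (wf_leq (leq_addr _ _)); exact: ww.
  apply/and3P; split; first exact: wfp_hnnp.
    by apply: (all_wf_leq (leq_addr _ _)).
  rewrite -[_.2.2]/(om_L d3 dc) LE /cwd -[rgen b.1]/(rgen (0 + b.1)) [(0 + b.1)%N]addnC -/(r 0%N) /p8 /p7 /p5 /p6 /p2 /p4 /p1.
  by rewrite /all !(wf_cat, wf_rinv) !ww' // !rw.
- by rewrite size_gens /= size_zipw ?s3 // sc.
- move=> i; rewrite size_gens => i7; rewrite nth_gens //.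
  by rewrite -[nth [::] _ _]/(w i) (wj i (gn pG i) i7) // wE.
move=> x; split=> [Tx|Nx].
  apply/(Mf 0)/(goes_base MS mo 0); apply: (subgen_min (goes_loops mo 0) _ Tx).
  by move=> _ [u uL ->]; exact: upper.
(* [Q e] is [T] as seen from the end of the path [e]; prolonging the path by a letter replaces [y]
   by its partner. *)
pose Q e y := T (e^-1 * (f' y * e)).
have QM e : is_subgroup (Q e).
  apply: (is_subgroup_preim (f := fun y => e^-1 * (f' y * e))) => // y z.
  by rewrite f'M -!mulgA [e * (e^-1 * _)]mulVKg.
have stepQ s e y y' : s * f' y = f' y' * s -> Q e y <-> Q (s * e) y'.
  move=> E; rewrite /Q; have -> // : e^-1 * (f' y * e) = (s * e)^-1 * (f' y' * (s * e)).
  by rewrite [f' y' * _]mulgA -E invgM -!mulgA mulKg.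
have Fcom k y : k \in [:: 1; 2; 3; 4; 6; 7; 8]%N -> F k y -> t k * f' y = f' y * t k.
  move=> kk /(SF k kk) Sy.
  apply: (@hletter_gen b ls M om_lab mo k _ _ id id _ (@hom_id _) (@hom_id _) _ _ Sy).
    by case: k kk {Sy} => [|[|[|[|[|[|[|[|[|]]]]]]]]].
  move=> v [u uL ->]; exists (u, u) => //; have -> : nth [::] ls k = diagp (S k).
    by case: k kk {Sy uL} => [|[|[|[|[|[|[|[|[|]]]]]]]]].
  exact: diag_mem.
have comV s (u v : grp q) : s * u = v * s -> s^-1 * v = u * s^-1.
  by move=> E; rewrite -[v](mulgK s) -E -!mulgA mulKg.
have Q14 y : FV y -> Q e1 y <-> Q e4 y by move=> Fy; apply: stepQ; exact: Fcom.
have Q42 y : FH X h y -> Q e4 y <-> Q e2 y.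
  by move=> Fy; apply: stepQ; apply: comV; exact: Fcom.
have Q26 y : Jplus y -> Q e2 y <-> Q e6 y by move=> Fy; apply: stepQ; exact: Fcom.
have Q17 y : Fa y -> Q e1 y <-> Q e7 y by move=> Fy; apply: stepQ; exact: Fcom.
have Q78 y : FH X h y -> Q e7 y <-> Q e8 y by move=> Fy; apply: stepQ; exact: Fcom.
have Q01 y : Jplus y -> Q 1 y <-> Q e1 y.
  by move=> Fy; rewrite -[e1]mulg1; apply: stepQ; apply: comV; exact: Fcom.
have shC k sk y : k \in [:: 0; 5]%N -> hom sk ->
    (forall z, z \in [:: aQ; ut; us] -> exists2 xy, xy \in nth [::] ls k & ga z = ev b xy.1 /\ ga (sk z) = ev b xy.2) ->
    FV y -> t k * f' y = f' (sk y) * t k.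
  move=> kk skM skP Fy.
  apply: (@hletter_gen b ls M om_lab mo k (grp pG) [set` [:: aQ; ut; us]] ga (ga \o sk)) => //.
    by case: k kk {skP} => [|[|[|[|[|[|]]]]]].
  exact: hom_comp skM gaM.
have shP sk k kwd : is_sig k sk -> ev b kwd = ga (expz us k) -> forall z, z \in [:: aQ; ut; us] ->
    exists2 xy, xy \in shiftp (w 6) (w 0%N) (w 1%N) kwd & ga z = ev b xy.1 /\ ga (sk z) = ev b xy.2.
  move=> sP kE z; have [sus sut] := sgus _ _ sP; have [sM sa _] := sP.
  rewrite !inE => /or3P[] /eqP ->.
  - by exists (w 6, w 6); rewrite ?inE ?eqxx //= sa w6.
  - by exists (w 0%N, wconj (w 0%N) kwd); rewrite ?inE ?eqxx ?orbT //= evalw_conj w0 kE sut (homJ gaM).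
  - by exists (w 1%N, w 1%N); rewrite ?inE ?eqxx ?orbT //= sus w1.
have C0 y : FV y -> t 0 * f' y = f' (sg y) * t 0.
  by apply: shC => //; [by case: sgP | exact: shP sgP k1].
have C5 y : FV y -> t 5 * f' y = f' (sg' y) * t 5.
  by apply: shC => //; [by case: sgP' | exact: shP sgP' k2].
have Q65 y : FV y -> Q e6 y <-> Q e5 (sg' y) by move=> Fy; apply: stepQ; exact: C5.
have Q51 y : Jplus y -> Q e5 y -> Q e1 y.
  move=> Jy; rewrite /Q => Ty.
  (* A round ends on sheet 1 along [t 6 * e5] instead of [e1]; this generator compares the two paths
     and so closes the round. *)
  have Tg : T (e1^-1 * (t 6 * e5)).
    have := @Tw (rinv p1 ++ r 6 ++ p5); rewrite evalw_cat evalw_inv evalw_cat tE P1 P5; apply.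
    by rewrite LE !inE eqxx !orbT.
  have cj (e e' s v : grp q) :
      (e^-1 * (v * e)) ^ (e'^-1 * (s * e))^-1 = e'^-1 * (s * v * s^-1 * e').
    by rewrite conjgE invgK !invgM invgK -!mulgA !mulVKg.
  by have := sgJ TS Ty (sgV TS Tg); rewrite cj Fcom ?mulgK.
have QJ e y z : Q e y -> Q e z -> Q e (y ^ z) by move=> Qy Qz; exact: (sgJ (QM e)).
have Qw u e y e' : cwd u e \in om_L d3 dc -> ev q u = f' y -> ev q e = e' -> Q e' y.
  by move=> uL uE eE; have := Tw _ uL; rewrite cwdE uE eE.
have Q4V f : Q e4 (iotaQ (vQ f)).
  rewrite /vQ (hom_tf _ _ _ (inj2M _)) (hom_tf _ _ _ iotaQM).
  have Qt : Q e4 vt by apply: Qw wvt P4; rewrite LE !inE eqxx ?orbT.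
  have Qs : Q e4 vs by apply: Qw wvs P4; rewrite LE !inE eqxx ?orbT.
  by apply: tf_in => // i _; apply: QJ => //; exact: (sgXz _ (QM e4)).
have Q6G g : Gam g -> Q e6 (iotaQ g).
  apply: (hom_subgen iotaQM (QM e6)) => v; rewrite /= !inE => /orP[] /eqP ->.
    by apply: Qw G1 P6; rewrite LE !inE eqxx ?orbT.
  by apply: Qw G2 P6; rewrite LE !inE eqxx ?orbT.
(* One round through the sheets 1, 4, 2, 6, 5, 1 adds a block; the base case takes [a] from sheet 8
   by way of sheet 7. *)
have QZ n : forall f, omZ m X f -> (forall i, f i != 0%R -> (- (m * n)%:Z <= i)%R) ->
    Q e1 (aQ ^ iotaQ (uQ f)).
  elim: n => [|n IHn] f Zf fn.
    have f0 i : f i = 0%R.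
      by apply/eqP; apply: contraT => fi; have := fn _ fi; have := Zf.2 _ fi; rewrite /negs /=; lia.
    rewrite (uQ1 f0) (hom1 iotaQM) conjg1.
    have Fa1 : Fa aQ by exact: subgen_in.
    have [x0 Xx x00] := omY_zero m0 Zf.1.
    have FH1 : FH X h aQ.
      by have := FH_a hM ha hb hc x0 Xx; rewrite (uQ1 x00) (vQ1 x00) mulg1 (hom1 iotaQM) conjg1.
    apply/(Q17 _ Fa1)/(Q78 _ FH1).
    by apply: Qw wa P8; rewrite LE !inE eqxx ?orbT.
  have [z [y [Zz Xy yn E zb]]] := omZ_unstep m0 Zf.
  have [g gzy] := addE z y.
  have := IHn z Zz (zb n fn); move=> /(Q14 _ (FV_a z)) Q4.
  have := QJ _ _ _ Q4 (Q4V y); rewrite -conjgM -iotaQM.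
  move=> /(Q42 _ (FH_a hM ha hb hc z Xy)).
  move=> /(Q26 _ (Jplus_a (Eplus_uv Zz.2 yn))) Q6.
  have := QJ _ _ _ Q6 (Q6G _ (Gam_uv y)); rewrite -conjgM -iotaQM.
  have -> : uQ z * vQ y * (uQ y / vQ y) = uQ g.
    by rewrite -mulgA [vQ y * _]mulgA -uvC mulgK -(uQM gzy).
  move=> /(Q65 _ (FV_a g)); rewrite (@sig_au _ _ f g sgP').
    apply: Q51; apply: Jplus_a; split; rewrite /= ?prj1_u ?prj2_u; last exact: sg1 (subgenP _).
    by apply: tB_PB; exact: Zf.2.
  by move=> i; rewrite E gzy opprK.
have TZ f : omZ m X f -> T (f' (aQ ^ iotaQ (uQ f))).
  move=> Zf; have [N fN] := supp_bound f.
  have : Q 1 (aQ ^ iotaQ (uQ f)).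
    have Jf : Jplus (aQ ^ iotaQ (uQ f)).
      apply: Jplus_a; split; rewrite /= ?prj1_u ?prj2_u; last exact: sg1 (subgenP _).
      by apply: tB_PB; exact: Zf.2.
    by apply/(Q01 _ Jf); apply: (QZ N _ Zf) => i /fN; nia.
  by rewrite /Q invg1 mul1g mulg1.
have T0 : T (t 0) by rewrite -tE addn0; apply: Tw; rewrite LE !inE eqxx.
have TY n : forall f z : calE, omZ m X z -> (forall i, f i = z (i - m%:Z * n%:Z)%R) -> T (f' (aQ ^ iotaQ (uQ f))).
  elim: n => [|n IHn] f z Zz E.
    have -> : f = z by apply: calE_eq => i; rewrite E; congr (z _); lia.
    exact: TZ.
  have [g gz] := shiftE z (m%:Z * n%:Z)%R.
  rewrite -(@sig_au _ _ f g sgP) => [|i]; last by rewrite E gz; congr (z _); lia.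
  have := IHn g z Zz gz => Tg.
  rewrite -[f' _](mulgK (t 0)) -C0; last exact: FV_a.
  by apply: (sgM TS); [exact: (sgM TS) | exact: (sgV TS)].
move: Nx; rewrite /omN /Mpt [omL _]/= (Msub1 freeQ) => Nx.
apply: (hom_subgen f'M TS _ Nx) => _ [_ [f Yf <-] <-].
by have [n [z Zz E]] := omY_shift_neg m0 Yf; exact: (TY n f z Zz E).
Qed.

End OmegaDatum.

Definition omegad (dE dc : datum) m (d : datum) : datum :=
  interd (pulld [:: rgen 6; gt; gs]
    (omd m (ijd pG [:: rgen 6; gt'; gs'] [:: gt; gs] d) dc)) dE.

Section OmegadP.
Variables (dE dc : datum) (fE : F3 -> grp dE.1) (fc : grp pG -> grp dc.1).
Hypotheses (DE : dfor gens3 fE (A_of setT)) (fEI : injective fE) (DC : dfor (gens pG) fc Jplus).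

(** As for the gadgets, [psi] sends [b] and [c] into the first copy, and [pull_back] returns from
    sheet 0 to [F3]. *)
Lemma omegadP m X d (f : F3 -> grp d.1) : 0 < m -> dfor gens3 f (A_of X) ->
  exists2 f' : F3 -> grp (omegad dE dc m d).1, dfor gens3 f' (A_of (h_omega m X)) & injective f'.
Proof.
move=> m0 D; have gw := wfp_pG.
have E1 : gn pG 0 = iotaQ (inj1 mBB Bt) by rewrite -iotaQ_gn // -(inj1_gn mBB).
have E2 : gn pG 1 = iotaQ (inj1 mBB Bs) by rewrite -iotaQ_gn // -(inj1_gn mBB).
have E3 : gn pG 3 = iotaQ (inj2 mBB Bt) by rewrite -iotaQ_gn // (inj2_gn mBB (i := 0)).
have E4 : gn pG 4 = iotaQ (inj2 mBB Bs) by rewrite -iotaQ_gn // (inj2_gn mBB (i := 1)).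
have [h [hM ha hb hc]] := F3_hom aQ (iotaQ (inj2 mBB Bt)) (iotaQ (inj2 mBB Bs)).
have [|||||f3 D3 f3I] := @ijdP F3 gens3 d f (A_of X) gens3_generates D pG
    [:: rgen 6; gt'; gs'] [:: gt; gs] h gw.
- by [].
- by [].
- by [].
- exact: hM.
- by case=> [|[|[|//]]] _; rewrite ?[nth _ _ _]/= ?ha ?hb ?hc ?evalw_gen.
have {}D3 : dfor (gens pG) f3 (FH X h).
  have -> // : FH X h = subgen (h @` A_of X `|` [set x | exists2 w, w \in [:: gt; gs] & x = ev pG w]).
  rewrite /FH; congr (subgen (_ `|` _)); apply/seteqP; split=> x.
    by rewrite /= !inE => /orP[] /eqP ->; [exists gt | exists gs]; rewrite ?inE ?eqxx ?orbT // evalw_gen.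
  by move=> [w]; rewrite !inE => /orP[] /eqP -> ->; rewrite evalw_gen /= !inE ?E1 ?E2 eqxx ?orbT.
have [f4 D4 _] := omd_ex m0 hM ha hb hc D3 DC f3I.
have [psi [psM psa psb psc]] := F3_hom aQ (iotaQ (inj1 mBB Bt)) (iotaQ (inj1 mBB Bs)).
have [|i ig|w1 s1 M1 g1' S1] := @pulldP _ F3 _ gens3 psi [:: rgen 6; gt; gs] _ f4 _ D4 psM.
- by [].
- by case: i ig => [|[|[|//]]] _; rewrite ?[nth _ _ _]/= ?psa ?psb ?psc ?evalw_gen ?nth_gens //= -?E1 -?E2.
have D5 := Dfor w1 s1 M1 g1' S1.
have [f6 D6 f6I] := interdP D5 DE; exists f6; last by apply: f6I; right.
have utf g : tf (inj1 mBB Bt) (inj1 mBB Bs) g = uQ g by rewrite /uQ (hom_tf _ _ _ (inj1M _)).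
have psE g : psi (af g) = aQ ^ iotaQ (uQ g) by rewrite (psi_af freeQ psM psa psb psc) utf.
have NE : omN m X 0 = Nsub iotaQ aQ (uQ @` h_omega m X) by exact: (Msub1 freeQ).
have -> : A_of (h_omega m X) = psi @^-1` omN m X 0 `&` A_of setT; last exact: D6.
apply/seteqP; split=> x.
  move=> Yx; split; last by apply: A_ofS Yx.
  rewrite /preimage /= NE; apply: (hom_subgen psM (subgenP _) _ Yx) => _ [g Yg <-].
  by rewrite psE; apply: Nsub_in; exists g.
move=> [Nx Ax]; apply: (pull_back freeQ psM psa psb psc) => // [g g'|].
  by rewrite !utf; exact: uQ_inj.
rewrite /preimage /= NE in Nx.
have -> // : [set tf (inj1 mBB Bt) (inj1 mBB Bs) g | g in h_omega m X] = uQ @` h_omega m X.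
by apply/seteqP; split=> _ [g Yg <-]; exists g.
Qed.

End OmegadP.

(** * Programs *)

Definition tleft (t : tree) : tree := if t is Node l r then l else Leaf.
Definition tright (t : tree) : tree := if t is Node l r then r else Leaf.
(** The function computed by [PRec] when its two arguments compute total functions. *)
Fixpoint trec (G H : tree -> tree) (x t : tree) : tree :=
  match t with
  | Leaf => G x
  | Node l r => H (Node x (Node (Node l r) (Node (trec G H x l) (trec G H x r))))
  end.

Definition tfun (F : tree -> tree) : Prop := exists p, forall t, eval p t (F t).

Lemma tfun_id : tfun id. Proof. by exists PId => t; exact: eval_id. Qed.

Lemma tfun_const u : tfun (fun=> u).
Proof.
elim: u => [|l [p pP] r [q qP]]; first by exists PLeaf => t; exact: eval_leaf.
by exists (PPair p q) => t; exact: eval_pair.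
Qed.

Lemma tfun_pair F G : tfun F -> tfun G -> tfun (fun t => Node (F t) (G t)).
Proof. by move=> [p pP] [q qP]; exists (PPair p q) => t; exact: eval_pair. Qed.

Lemma tfun_comp F G : tfun F -> tfun G -> tfun (fun t => F (G t)).
Proof. by move=> [p pP] [q qP]; exists (PComp p q) => t; exact: eval_comp. Qed.

(* [PLeft] and [PRight] are undefined on leaves; recursion makes them total. *)
Lemma tfun_proj (p : prog) (F : tree -> tree) : F Leaf = Leaf ->
  (forall l r, eval p (Node l r) (F (Node l r))) -> tfun F.
Proof.
move=> F0 FE; exists (PComp (PRec PLeaf (PComp p (PComp PLeft PRight))) (PPair PLeaf PId)) => t.
apply: (eval_comp (y := Node Leaf t)).
  by apply: eval_pair; [exact: eval_leaf | exact: eval_id].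
elim: t => [|l IHl r IHr]; first by rewrite F0; apply: eval_rec_leaf; exact: eval_leaf.
apply: eval_rec_node IHl IHr _; apply: eval_comp (FE l r).
by apply: eval_comp (eval_right _ _) _; exact: eval_left.
Qed.

Lemma tfun_left F : tfun F -> tfun (fun t => tleft (F t)).
Proof. by apply: tfun_comp; apply: (tfun_proj (p := PLeft)) => // l r; exact: eval_left. Qed.

Lemma tfun_right F : tfun F -> tfun (fun t => tright (F t)).
Proof. by apply: tfun_comp; apply: (tfun_proj (p := PRight)) => // l r; exact: eval_right. Qed.

Lemma tfun_rec G H X T : tfun G -> tfun H -> tfun X -> tfun T ->
  tfun (fun t => trec G H (X t) (T t)).
Proof.
move=> [p pP] [q qP] [px xP] [pt tP]; exists (PComp (PRec p q) (PPair px pt)) => t.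
apply: (eval_comp (y := Node (X t) (T t))); first exact: eval_pair.
elim: (T t) => [|l IHl r IHr]; first exact: eval_rec_leaf.
exact: eval_rec_node IHl IHr _.
Qed.

(** * Encodings and closure properties of computable functions *)

Class enc (A : Type) := encode : A -> tree.
Global Hint Mode enc + : typeclass_instances.
Global Instance enc_N : enc nat := enc_nat.
Global Instance enc_B : enc bool := enc_bool.
Global Instance enc_P A B {ea : enc A} {eb : enc B} : enc (A * B) :=
  fun x => Node (encode x.1) (encode x.2).
Global Instance enc_S A {ea : enc A} : enc (seq A) := enc_seq ea.

(** Trees that encode nothing may have any value. *)
Definition comp A B {ea : enc A} {eb : enc B} (f : A -> B) : Prop :=
  exists2 F, tfun F & forall x, F (encode x) = encode (f x).

Section Comp.
Context {A : Type} {ea : enc A}.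

Lemma comp_id : comp (fun x : A => x).
Proof. by exists id; first exact: tfun_id. Qed.

Lemma comp_const B {eb : enc B} (y : B) : comp (fun _ : A => y).
Proof. by exists (fun=> encode y); first exact: tfun_const. Qed.

Lemma comp_pair B C {eb : enc B} {ec : enc C} (f : A -> B) (g : A -> C) :
  comp f -> comp g -> comp (fun x => (f x, g x)).
Proof.
move=> [F Ft FE] [G Gt GE]; exists (fun t => Node (F t) (G t)); first exact: tfun_pair.
by move=> x; rewrite FE GE.
Qed.

Lemma comp_fst B C {eb : enc B} {ec : enc C} (f : A -> B * C) : comp f -> comp (fun x => (f x).1).
Proof. by move=> [F Ft FE]; exists (fun t => tleft (F t)) => [|x]; [exact: tfun_left | rewrite FE]. Qed.

Lemma comp_snd B C {eb : enc B} {ec : enc C} (f : A -> B * C) : comp f -> comp (fun x => (f x).2).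
Proof. by move=> [F Ft FE]; exists (fun t => tright (F t)) => [|x]; [exact: tfun_right | rewrite FE]. Qed.

Lemma comp_app B C {eb : enc B} {ec : enc C} (g : B -> C) (f : A -> B) :
  comp g -> comp f -> comp (fun x => g (f x)).
Proof.
move=> [G Gt GE] [F Ft FE]; exists (fun t => G (F t)); first exact: tfun_comp.
by move=> x; rewrite FE GE.
Qed.

Lemma comp_nil B {eb : enc B} : comp (fun _ : A => [::] : seq B).
Proof. exact: comp_const. Qed.

Lemma comp_cons B {eb : enc B} (f : A -> B) (s : A -> seq B) :
  comp f -> comp s -> comp (fun x => f x :: s x).
Proof.
move=> [F Ft FE] [G Gt GE]; exists (fun t => Node (F t) (G t)); first exact: tfun_pair.
by move=> x; rewrite FE GE.
Qed.

Lemma comp_succ (f : A -> nat) : comp f -> comp (fun x => (f x).+1).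
Proof.
move=> [F Ft FE]; exists (fun t => Node Leaf (F t)); first by apply: tfun_pair => //; exact: tfun_const.
by move=> x; rewrite FE.
Qed.

Lemma comp_behead B {eb : enc B} (s : A -> seq B) : comp s -> comp (fun x => behead (s x)).
Proof.
move=> [F Ft FE]; exists (fun t => tright (F t)) => [|x]; first exact: tfun_right.
by rewrite FE; case: (s x).
Qed.

(** A list is encoded as a right comb; the value that [PRec] also computes on the left subtree, the
    head, is dropped here. *)
Let sel (F : tree -> tree) := fun u => F (Node (tleft u) (Node (tleft (tleft (tright u)))
  (Node (tright (tleft (tright u))) (tright (tright (tright u)))))).

Let tfun_sel F : tfun F -> tfun (sel F).
Proof.
move=> Ft; apply: (tfun_comp Ft).
by do ![apply: tfun_pair]; do ?[exact: tfun_id | apply: tfun_left | apply: tfun_right].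
Qed.

Lemma comp_fold B C {eb : enc B} {ec : enc C} (h : A -> B -> seq B -> C -> C) (z : A -> C) (s : A -> seq B) :
  comp (fun u : A * (B * (seq B * C)) => h u.1 u.2.1 u.2.2.1 u.2.2.2) -> comp z -> comp s ->
  comp (fun x => (fix loop t := if t is b :: t' then h x b t' (loop t') else z x) (s x)).
Proof.
move=> [H Ht HE] [Z Zt ZE] [S St SE].
exists (fun t => trec Z (sel H) t (S t)).
  by apply: tfun_rec => //; [exact: tfun_sel | exact: tfun_id].
move=> x; rewrite SE; elim: (s x) => [|b t IHt]; first exact: ZE.
by rewrite -(HE (x, (b, (t, _)))) /= {2}/sel /= IHt.
Qed.

Lemma comp_iter B {eb : enc B} (h : A -> B -> B) (z : A -> B) (n : A -> nat) :
  comp (fun u : A * B => h u.1 u.2) -> comp z -> comp n -> comp (fun x => iter (n x) (h x) (z x)).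
Proof.
move=> [H Ht HE] [Z Zt ZE] [N Nt NE].
exists (fun t => trec Z (fun u => H (Node (tleft u) (tright (tright (tright u))))) t (N t)).
  apply: tfun_rec => //; last exact: tfun_id.
  apply: (tfun_comp Ht); apply: tfun_pair; first by apply: tfun_left; exact: tfun_id.
  by do 3!apply: tfun_right; exact: tfun_id.
move=> x; rewrite NE; elim: (n x) => [|k IHk]; first exact: ZE.
by rewrite [iter _ _ _]/= -(HE (x, iter k (h x) (z x))) -[encode (x, _)]/(Node (encode x) (encode _)) -IHk.
Qed.

Lemma comp_if B {eb : enc B} (c : A -> bool) (f g : A -> B) :
  comp c -> comp f -> comp g -> comp (fun x => if c x then f x else g x).
Proof.
move=> [C Ct CE] [F Ft FE] [G Gt GE].
exists (fun t => trec G (fun u => F (tleft u)) t (C t)).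
  apply: tfun_rec => //; last exact: tfun_id.
  by apply: (tfun_comp Ft); apply: tfun_left; exact: tfun_id.
by move=> x; rewrite CE; case: (c x) => /=.
Qed.

End Comp.

Lemma comp_ext A B {ea : enc A} {eb : enc B} (f g : A -> B) : f =1 g -> comp f -> comp g.
Proof. by move=> E [F Ft FE]; exists F => // x; rewrite FE E. Qed.

Lemma comp_foldr A {ea : enc A} B C {eb : enc B} {ec : enc C} (h : A -> B -> C -> C) (z : A -> C) (s : A -> seq B) :
  comp (fun u : A * (B * (seq B * C)) => h u.1 u.2.1 u.2.2.2) -> comp z -> comp s ->
  comp (fun x => foldr (h x) (z x) (s x)).
Proof. exact: (comp_fold (h := fun x b _ => h x b)). Qed.

Lemma comp_map A {ea : enc A} B C {eb : enc B} {ec : enc C} (h : A -> B -> C) (s : A -> seq B) :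
  comp (fun u : A * (B * (seq B * seq C)) => h u.1 u.2.1) -> comp s -> comp (fun x => map (h x) (s x)).
Proof.
move=> hP; apply: (comp_foldr (h := fun x b t => h x b :: t) (z := fun=> [::])) (comp_const _).
by apply: comp_cons hP _; do 3!apply: comp_snd; exact: comp_id.
Qed.

Lemma comp_cat A {ea : enc A} B {eb : enc B} (s t : A -> seq B) : comp s -> comp t -> comp (fun x => s x ++ t x).
Proof.
move=> sP tP; apply: (comp_ext (f := fun x => foldr cons (t x) (s x))).
  by move=> x; elim: (s x) => //= b u ->.
apply: (comp_foldr (h := fun=> cons)) tP sP; apply: comp_cons.
  by apply: comp_fst; apply: comp_snd; exact: comp_id.
by do 3!apply: comp_snd; exact: comp_id.
Qed.

Lemma comp_size A {ea : enc A} B {eb : enc B} (s : A -> seq B) : comp s -> comp (fun x => size (s x)).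
Proof.
apply: (comp_foldr (h := fun _ _ n => n.+1) (z := fun=> 0%N)) (comp_const _).
by apply: comp_succ; do 3!apply: comp_snd; exact: comp_id.
Qed.

Lemma comp_add A {ea : enc A} (m n : A -> nat) : comp m -> comp n -> comp (fun x => m x + n x)%N.
Proof.
move=> mP nP; apply: (comp_ext (f := fun x => iter (m x) succn (n x))).
  by move=> x; elim: (m x) => //= k ->.
by apply: (comp_iter (h := fun=> succn)) => //; apply: comp_succ; apply: comp_snd; exact: comp_id.
Qed.

(** The entry is the head after [n] tails; a fold that ignores its accumulator extracts the head or
    the default. *)
Lemma comp_nth A {ea : enc A} B {eb : enc B} (d : B) (s : A -> seq B) (n : A -> nat) :
  comp s -> comp n -> comp (fun x => nth d (s x) (n x)).
Proof.
move=> sP nP.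
apply: (comp_ext (f := fun x => foldr (fun b (_ : B) => b) d (iter (n x) behead (s x)))).
  move=> x; elim: (n x) (s x) => [|k IHk] [|b t] //; last by rewrite iterSr IHk.
  by rewrite nth_nil -[RHS](nth_nil d k) -IHk iterSr.
apply: (comp_foldr (h := fun _ b _ => b) (z := fun=> d)).
- by apply: comp_fst; apply: comp_snd; exact: comp_id.
- exact: comp_const.
by apply: (comp_iter (h := fun=> behead)) => //; apply: comp_behead; apply: comp_snd; exact: comp_id.
Qed.

Lemma comp_iota A {ea : enc A} (m n : A -> nat) : comp m -> comp n -> comp (fun x => iota (m x) (n x)).
Proof.
move=> mP nP.
apply: (comp_ext (f := fun x => (iter (n x) (fun u => (u.1.+1, u.2 ++ [:: u.1])) (m x, [::])).2)).
  move=> x; suff -> : iter (n x) (fun u => (u.1.+1, u.2 ++ [:: u.1])) (m x, [::])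
    = (m x + n x, iota (m x) (n x))%N by [].
  elim: (n x) => [|k IHk]; rewrite ?addn0 //.
  have -> : iota (m x) k.+1 = iota (m x) k ++ [:: (m x + k)%N] by rewrite -[k.+1]addn1 iotaD.
  by rewrite iterS IHk addnS.
apply: comp_snd; apply: (comp_iter (h := fun _ u => (u.1.+1, u.2 ++ [:: u.1]))) => //.
  have i1 : comp (fun u : A * (nat * seq nat) => u.2.1) by apply: comp_fst; apply: comp_snd; exact: comp_id.
  apply: comp_pair; first exact: comp_succ.
  apply: comp_cat; first by do 2!apply: comp_snd; exact: comp_id.
  by apply: comp_cons => //; exact: comp_nil.
by apply: comp_pair => //; exact: comp_nil.
Qed.

Lemma comp_flatten A {ea : enc A} B {eb : enc B} (s : A -> seq (seq B)) : comp s -> comp (fun x => flatten (s x)).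
Proof.
apply: (comp_foldr (h := fun _ => cat) (z := fun=> [::])) (comp_const _).
by apply: comp_cat; [apply: comp_fst; apply: comp_snd; exact: comp_id | do 3!apply: comp_snd; exact: comp_id].
Qed.

Lemma comp_nseq A {ea : enc A} B {eb : enc B} (b : A -> B) (n : A -> nat) :
  comp b -> comp n -> comp (fun x => nseq (n x) (b x)).
Proof.
move=> bP nP; apply: (comp_iter (h := fun x => cons (b x)) (z := fun=> [::])) => //; last exact: comp_const.
apply: comp_cons; last by apply: comp_snd; exact: comp_id.
by apply: (comp_app (g := b)) => //; apply: comp_fst; exact: comp_id.
Qed.

Lemma comp_rev A {ea : enc A} B {eb : enc B} (s : A -> seq B) : comp s -> comp (fun x => rev (s x)).
Proof.
move=> sP; apply: (comp_ext (f := fun x => foldr (fun b t => t ++ [:: b]) [::] (s x))).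
  by move=> x; elim: (s x) => //= b t ->; rewrite rev_cons cats1.
apply: (comp_foldr (h := fun _ b t => t ++ [:: b])) => //; last exact: comp_const.
apply: comp_cat; first by do 3!apply: comp_snd; exact: comp_id.
by apply: comp_cons; [apply: comp_fst; apply: comp_snd; exact: comp_id | exact: comp_nil].
Qed.

Lemma comp_negb A {ea : enc A} (c : A -> bool) : comp c -> comp (fun x => ~~ c x).
Proof. by move=> cP; apply: comp_if => //; exact: comp_const. Qed.

Ltac comp_step := first
  [ exact: comp_const | exact: comp_id | assumption
  | match goal with H : @comp _ _ _ _ ?g |- @comp _ _ _ _ (fun x => ?g (@?f x)) =>
      apply: (comp_app (g := g) (f := f)) end
  | apply: comp_fst | apply: comp_snd
  | apply: comp_pair | apply: comp_cat
  | apply: comp_map | apply: comp_add | apply: comp_succ | apply: comp_iota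
  | apply: comp_flatten | apply: comp_nseq | apply: comp_rev | apply: comp_negb
  | apply: comp_nth | apply: comp_if | apply: comp_size | apply: comp_cons ].
Ltac comp_auto := repeat (cbv beta; comp_step).

Lemma comp_rinv A {ea : enc A} (w : A -> rword) : comp w -> comp (fun x => rinv (w x)).
Proof. by move=> wP; rewrite /rinv; comp_auto. Qed.

Lemma comp_shw A {ea : enc A} (n : A -> nat) (w : A -> rword) : comp n -> comp w -> comp (fun x => shw (n x) (w x)).
Proof. by move=> nP wP; rewrite /shw; comp_auto. Qed.

Lemma comp_rgen A {ea : enc A} (n : A -> nat) : comp n -> comp (fun x => rgen (n x)).
Proof. by move=> nP; rewrite /rgen; comp_auto. Qed.

Lemma comp_rgens A {ea : enc A} (n k : A -> nat) : comp n -> comp k -> comp (fun x => rgens (n x) (k x)).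
Proof. by move=> nP kP; rewrite /rgens /rgen; comp_auto. Qed.

Lemma comp_zipw A {ea : enc A} (n : A -> nat) (u v : A -> seq rword) : comp n -> comp u -> comp v ->
  comp (fun x => zipw (n x) (u x) (v x)).
Proof. by move=> nP uP vP; rewrite /zipw; comp_auto; apply: comp_shw; comp_auto. Qed.

(** The recursion of [hrels] changes its parameter [n], while the recursion schemes above keep
    parameters fixed; the indexed form avoids this. *)
Lemma hrelsE n ls : hrels n ls =
  flatten [seq map (hrel (n + i)) (nth [::] ls i) | i <- iota 0 (size ls)].
Proof.
elim: ls n => //= ps ls IHls n; rewrite addn0 IHls (iotaDl 1 0) -map_comp; congr (_ ++ flatten _).
by apply: eq_map => i /=; rewrite add1n addnS.
Qed.

Ltac comp_op := match goal with
  | |- @comp _ _ _ _ (fun x => shw _ _) => apply: comp_shw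
  | |- @comp _ _ _ _ (fun x => rinv _) => apply: comp_rinv
  | |- @comp _ _ _ _ (fun x => rgens _ _) => apply: comp_rgens
  | |- @comp _ _ _ _ (fun x => rgen _) => apply: comp_rgen
  | |- @comp _ _ _ _ (fun x => zipw _ _ _) => apply: comp_zipw
  end.
Ltac comp_auto1 := repeat (cbv beta zeta; first [exact: comp_const | comp_op | comp_step]).

Lemma comp_prodp A {ea : enc A} (p q : A -> rpres) : comp p -> comp q -> comp (fun x => prodp (p x) (q x)).
Proof. by move=> pP qP; rewrite /prodp /comm_rel; comp_auto1. Qed.

Lemma comp_diagp A {ea : enc A} (s : A -> seq rword) : comp s -> comp (fun x => diagp (s x)).
Proof. by move=> sP; rewrite /diagp; comp_auto1. Qed.

Lemma comp_hnnp A {ea : enc A} (p : A -> rpres) (ls : A -> seq (seq (rword * rword))) :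
  comp p -> comp ls -> comp (fun x => hnnp (p x) (ls x)).
Proof.
move=> pP lsP; apply: (comp_ext (f := fun x => ((p x).1 + size (ls x), (p x).2 ++
    flatten [seq map (hrel ((p x).1 + i)) (nth [::] (ls x) i) | i <- iota 0 (size (ls x))])%N)).
  by move=> x; rewrite /hnnp hrelsE.
by rewrite /hrel; comp_auto1.
Qed.

Lemma comp_substw A {ea : enc A} (gs : A -> seq rword) (w : A -> rword) :
  comp gs -> comp w -> comp (fun x => substw (gs x) (w x)).
Proof. by move=> gsP wP; rewrite /substw; comp_auto1. Qed.

Ltac comp_op ::= match goal with
  | |- @comp _ _ _ _ (fun x => shw _ _) => apply: comp_shw
  | |- @comp _ _ _ _ (fun x => rinv _) => apply: comp_rinv
  | |- @comp _ _ _ _ (fun x => rgens _ _) => apply: comp_rgens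
  | |- @comp _ _ _ _ (fun x => rgen _) => apply: comp_rgen
  | |- @comp _ _ _ _ (fun x => zipw _ _ _) => apply: comp_zipw
  | |- @comp _ _ _ _ (fun x => prodp _ _) => apply: comp_prodp
  | |- @comp _ _ _ _ (fun x => diagp _) => apply: comp_diagp
  | |- @comp _ _ _ _ (fun x => hnnp _ _) => apply: comp_hnnp
  | |- @comp _ _ _ _ (fun x => substw _ _) => apply: comp_substw
  end.

Lemma comp_interd A {ea : enc A} (d1 d2 : A -> datum) :
  comp d1 -> comp d2 -> comp (fun x => interd (d1 x) (d2 x)).
Proof. by move=> P1 P2; rewrite /interd; comp_auto1. Qed.

Lemma comp_pulld A {ea : enc A} ss (d : A -> datum) : comp d -> comp (fun x => pulld ss (d x)).
Proof. by move=> dP; rewrite /pulld; comp_auto1. Qed.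

Lemma comp_joind A {ea : enc A} (d1 d2 : A -> datum) :
  comp d1 -> comp d2 -> comp (fun x => joind (d1 x) (d2 x)).
Proof. by move=> P1 P2; rewrite /joind; comp_auto1. Qed.

Lemma comp_ijd A {ea : enc A} q phi S (d : A -> datum) : comp d -> comp (fun x => ijd q phi S (d x)).
Proof. by move=> dP; rewrite /ijd; comp_auto1. Qed.

Lemma comp_linop A {ea : enc A} q ub uc vb vc S dE (d : A -> datum) :
  comp d -> comp (fun x => linop q ub uc vb vc S dE (d x)).
Proof.
move=> dP; rewrite /linop; apply: comp_interd; last exact: comp_const.
by apply: comp_pulld; exact: comp_ijd.
Qed.

Lemma comp_om_letters A {ea : enc A} (m : A -> nat) (d3 dc : A -> datum) : comp m -> comp d3 -> comp dc ->
  comp (fun x => om_letters (m x) (d3 x) (dc x)).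
Proof.
move=> mP P3 Pc; rewrite /om_letters /omW /filt1 /filt2 /shiftp /wconj /wpow; comp_auto1.
Qed.

Lemma comp_om_L A {ea : enc A} (d3 dc : A -> datum) : comp d3 -> comp dc ->
  comp (fun x => om_L (d3 x) (dc x)).
Proof.
move=> P3 Pc; rewrite /om_L /omW /om_path /cwd; comp_auto1.
Qed.

Lemma comp_omegad A {ea : enc A} dE dc (m : A -> nat) (d : A -> datum) :
  comp m -> comp d -> comp (fun x => omegad dE dc (m x) (d x)).
Proof.
move=> mP dP; rewrite /omegad; apply: comp_interd; last exact: comp_const.
apply: comp_pulld; rewrite /omd; have iP := comp_ijd pG [:: rgen 6; gt'; gs'] [:: gt; gs] dP.
apply: comp_pair; first apply: comp_hnnp.
- by apply: comp_prodp; [exact: comp_fst | exact: comp_const].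
- by apply: comp_om_letters => //; exact: comp_const.
apply: comp_pair; last by apply: comp_om_L => //; exact: comp_const.
by rewrite /omW; comp_auto1.
Qed.

Lemma hom_multiplicative (G H : groupType) (f : G -> H) : hom f ->
  exists F : {multiplicative G -> H}, F =1 f.
Proof.
move=> fM; pose mix := isMultiplicative.Build G H f fM.
by exists (HB.pack_for {multiplicative G -> H} f mix).
Qed.

Lemma multiplicative_hom (G H : groupType) (f : {multiplicative G -> H}) : hom f.
Proof. exact: gmulfM. Qed.

(** * Explicit pairs and untyped data *)

(** The nesting of pairs repeats that of [enc_bdata], so that the two encodings agree. *)
Definition braw := (rpres * ((rword * (rword * rword)) * seq rword))%type.

Definition rawb (D : bdata) : braw :=
  let r n := map (@rlet n) in
  ((ngens (dpres D), map (r _) (relators (dpres D))),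
   ((r _ (d_a D), (r _ (d_b D), r _ (d_c D))), map (r _) (d_L D))).

Definition bdata_of (r : braw) : bdata :=
  @BData (mkP r.1) (unw r.1.1 r.2.1.1) (unw r.1.1 r.2.1.2.1) (unw r.1.1 r.2.1.2.2)
    (map (unw r.1.1) r.2.2).

Definition dat_of (r : braw) : datum := (r.1, ([:: r.2.1.1; r.2.1.2.1; r.2.1.2.2], r.2.2)).
Definition raw_of (d : datum) : braw :=
  let g := nth [::] d.2.1 in (d.1, ((g 0%N, (g 1%N, g 2)), d.2.2)).

Lemma rawbK D : bdata_of (rawb D) = D.
Proof.
have E n (s : seq (word n)) : map (unw n) (map (map (@rlet n)) s) = s.
  by rewrite -map_comp map_id_in // => w _ /=; rewrite unw_raw.
case: D => -[n rels] a b c L; rewrite /bdata_of /rawb /=.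
by rewrite /mkP /= E; congr BData; rewrite ?unw_raw ?E.
Qed.

Lemma enc_word_raw n (w : word n) : enc_word w = encode (map (@rlet n) w).
Proof. by elim: w => // l w IHw; rewrite -[LHS]/(Node (enc_letter l) (enc_word w)) IHw. Qed.

Lemma enc_bdata_raw D : enc_bdata D = encode (rawb D).
Proof.
have E n (s : seq (word n)) : enc_seq (@enc_word n) s = encode (map (map (@rlet n)) s).
  elim: s => // w s IHs.
  by rewrite -[LHS]/(Node (enc_word w) (enc_seq (@enc_word n) s)) IHs enc_word_raw.
by rewrite /enc_bdata !E !enc_word_raw.
Qed.

Lemma bdata_ofK r : dwf (dat_of r) -> rawb (bdata_of r) = r.
Proof.
case: r => -[n rels] [[a [b c]] L] /and3P[/= rw /and4P[aw bw cw _] Lw]; rewrite /rawb /=.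
have E s : all (wf n) s -> map (map (@rlet n)) (map (unw n) s) = s.
  by move=> /allP sw; rewrite -map_comp map_id_in // => w ws; rewrite /= raw_unw // sw.
by rewrite !E ?raw_unw.
Qed.

Lemma dwf_rawb D : dwf (dat_of (rawb D)).
Proof.
have E n (s : seq (word n)) : all (wf n) (map (map (@rlet n)) s).
  by rewrite all_map; apply/allP => w _; exact: wf_raw.
by apply/and3P; split=> /=; rewrite ?wf_raw /wfp /= ?E.
Qed.

Lemma explicit_dat r X : dwf (dat_of r) -> explicit_for (bdata_of r) X <->
  exists2 f : F3 -> grp (dat_of r).1, dfor gens3 f (A_of X) & injective f.
Proof.
case: r => -[n rels] [[a [b c]] L] rw; have /and3P[/= pw /and4P[aw bw cw _] Lw] := rw.
set p := (n, rels); have sE : subgen [set` map (@wclass (mkP p)) (map (unw n) L)] =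
    @dsub (dat_of (p, ((a, (b, c)), L))).
  congr subgen; apply/seteqP; split=> x /=.
    by move=> /mapP[_ /mapP[w wL ->] ->]; exists w; rewrite // (@ev_wclass p) // (allP Lw).
  by move=> [w wL ->]; rewrite (@ev_wclass p) ?(allP Lw) // !map_f.
split=> [[f [fa fb fc fI fL]]|[f D fI]].
  exists (f : F3 -> grp p) => //; split=> //.
  - exact: multiplicative_hom.
  - by case=> [|[|[|//]]] _; rewrite ?[nth _ _ _]/= ?fa ?fb ?fc (@ev_wclass p).
  - by move=> x; rewrite -fL -sE.
have [F FE] := hom_multiplicative (dforM D); exists F; split.
- by rewrite FE (dfor_gen D (i := 0)) // ev_wclass.
- by rewrite FE (dfor_gen D (i := 1)) // ev_wclass.
- by rewrite FE (dfor_gen D (i := 2)) // ev_wclass.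
- by move=> x y; rewrite !FE; exact: fI.
- by rewrite [subgen _]sE; apply/seteqP; split=> x; rewrite /preimage /= FE => /(dfor_sub D).
Qed.

Lemma dat_raw_of d : size d.2.1 = 3 -> dat_of (raw_of d) = d.
Proof. by case: d => p [[|a [|b [|c [|]]]] L]. Qed.

Lemma dfor_explicit d f X : dfor gens3 (d := d) f (A_of X) -> injective f ->
  dwf (dat_of (raw_of d)) /\ explicit_for (bdata_of (raw_of d)) X.
Proof.
move=> D fI; have E := dat_raw_of (dfor_size D); have w := dfor_wf D.
rewrite E; split=> //; apply/explicit_dat; rewrite E //.
by exists f.
Qed.

Lemma explicit_benign D X : explicit_for D X -> benign (A_of X).
Proof.
move=> [f [_ _ _ fI fL]].
exists (presented (dpres D)), f, (subgen [set` map (@wclass (dpres D)) (d_L D)]); split=> //.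
  have [F FE] := hom_multiplicative (@hom_id (presented (dpres D))).
  by exists (dpres D), F; exists id => x; rewrite FE.
by exists (map (@wclass (dpres D)) (d_L D)).
Qed.

(** Representing words are merely chosen, without any effectivity; this lets plain benignness follow
    from the effective statements. *)
Lemma benign_explicit X : benign (A_of X) -> exists D, explicit_for D X.
Proof.
move=> [K [f [L [[P [g [g' gK g'K]]] fI [s Ls] fL]]]].
have gM := multiplicative_hom g; have fM := multiplicative_hom f.
have g'M : hom g' by move=> x y; apply: (can_inj gK); rewrite gM !g'K.
have [F FE] := hom_multiplicative (hom_comp fM g'M).
exists (@BData P (repr (g' (f a3))) (repr (g' (f b3))) (repr (g' (f c3))) [seq repr (g' x) | x <- s]).
exists F; split; rewrite ?FE ?wclass_repr //.
  by move=> x y; rewrite !FE => /(can_inj g'K) /fI.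
rewrite -fL Ls; apply/seteqP; split=> x; rewrite /preimage /= FE /=.
  rewrite -[f x]g'K => /(hom_subgen gM (subgenP _)); rewrite !g'K; apply=> _ /mapP[_ /mapP[y ys ->] ->].
  by rewrite wclass_repr g'K; apply: subgen_in.
apply: (hom_subgen g'M (subgenP _)) => y ys; apply: subgen_in.
by apply/mapP; exists (repr (g' y)); rewrite ?map_f // wclass_repr.
Qed.

(** * From computable constructions to programs *)

Lemma comp_dat_of A {ea : enc A} (r : A -> braw) : comp r -> comp (fun x => dat_of (r x)).
Proof. by move=> rP; rewrite /dat_of; comp_auto1. Qed.

Lemma comp_raw_of A {ea : enc A} (d : A -> datum) : comp d -> comp (fun x => raw_of (d x)).
Proof. by move=> dP; rewrite /raw_of; comp_auto1. Qed.

Lemma comp_prog A B {ea : enc A} {eb : enc B} (f : A -> B) : comp f ->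
  exists p, forall x, eval p (encode x) (encode (f x)).
Proof. by move=> [F [p pF] FE]; exists p => x; rewrite -FE; exact: pF. Qed.

(** The program computes [F] between the two raw formats; well-formedness of the result, a part of
    [dfor], makes the output the encoding of a [bdata]. *)
Lemma effective1_of (op : set calE -> set calE) (F : datum -> datum) : comp F ->
  (forall X d (f : F3 -> grp d.1), dfor gens3 f (A_of X) -> injective f ->
     exists2 f' : F3 -> grp (F d).1, dfor gens3 f' (A_of (op X)) & injective f') ->
  effective1 op.
Proof.
move=> Fc FP; have rC : comp (fun r : braw => raw_of (F (dat_of r))).
  by apply: comp_raw_of; apply: (comp_app Fc); apply: comp_dat_of; exact: comp_id.
have [p pP] := comp_prog rC; exists p => X D.
rewrite -{1}[D]rawbK => /(explicit_dat _ (dwf_rawb D))[f Df fI].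
have [f' Df' fI'] := FP _ _ _ Df fI; have [w ex] := dfor_explicit Df' fI'.
exists (bdata_of (raw_of (F (dat_of (rawb D))))) => //.
by rewrite !enc_bdata_raw bdata_ofK //; exact: pP.
Qed.

Lemma effective2_of (op : set calE -> set calE -> set calE) (F : datum * datum -> datum) : comp F ->
  (forall X1 X2 d1 d2 (f1 : F3 -> grp d1.1) (f2 : F3 -> grp d2.1),
     dfor gens3 f1 (A_of X1) -> injective f1 -> dfor gens3 f2 (A_of X2) -> injective f2 ->
     exists2 f' : F3 -> grp (F (d1, d2)).1, dfor gens3 f' (A_of (op X1 X2)) & injective f') ->
  effective2 op.
Proof.
move=> Fc FP; have rC : comp (fun r : braw * braw => raw_of (F (dat_of r.1, dat_of r.2))).
  apply: comp_raw_of; apply: (comp_app Fc); apply: comp_pair; apply: comp_dat_of.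
    by apply: comp_fst; exact: comp_id.
  by apply: comp_snd; exact: comp_id.
have [p pP] := comp_prog rC; exists p => X1 X2 D1 D2.
rewrite -{1}[D1]rawbK -{1}[D2]rawbK => /(explicit_dat _ (dwf_rawb D1))[f1 Df1 fI1].
move=> /(explicit_dat _ (dwf_rawb D2))[f2 Df2 fI2].
have [f' Df' fI'] := FP _ _ _ _ _ _ Df1 fI1 Df2 fI2; have [w ex] := dfor_explicit Df' fI'.
exists (bdata_of (raw_of (F (dat_of (rawb D1), dat_of (rawb D2))))) => //.
by rewrite !enc_bdata_raw bdata_ofK //; exact: (pP (rawb D1, rawb D2)).
Qed.

Lemma effective_family_of (op : nat -> set calE -> set calE) (F : nat * datum -> datum) : comp F ->
  (forall m X d (f : F3 -> grp d.1), 0 < m -> dfor gens3 f (A_of X) -> injective f ->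
     exists2 f' : F3 -> grp (F (m, d)).1, dfor gens3 f' (A_of (op m X)) & injective f') ->
  effective1_family op.
Proof.
move=> Fc FP; have rC : comp (fun r : nat * braw => raw_of (F (r.1, dat_of r.2))).
  apply: comp_raw_of; apply: (comp_app Fc); apply: comp_pair; first by apply: comp_fst; exact: comp_id.
  by apply: comp_dat_of; apply: comp_snd; exact: comp_id.
have [p pP] := comp_prog rC; exists p => m X D m0.
rewrite -{1}[D]rawbK => /(explicit_dat _ (dwf_rawb D))[f Df fI].
have [f' Df' fI'] := FP _ _ _ _ m0 Df fI; have [w ex] := dfor_explicit Df' fI'.
exists (bdata_of (raw_of (F (m, dat_of (rawb D))))) => //.
by rewrite !enc_bdata_raw bdata_ofK //; exact: (pP (m, rawb D)).
Qed.

(** The gadget and [dE] are constants of the program, so their mere existence is enough. *)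
Lemma effective_gadget R : inhabited (gadget R) ->
  effective1 (fun X => [set f | exists2 g, X g & R g f]).
Proof.
move=> [gd]; have [dE _ [fE DE fEI]] := A_E_datum.
apply: (effective1_of (comp_linop _ _ _ _ _ _ dE comp_id)) => X d f D _.
exact: (linopP gd DE fEI D).
Qed.

Lemma effective_iota : effective2 h_iota.
Proof.
have c : comp (fun x : datum * datum => interd x.1 x.2).
  by apply: comp_interd; [apply: comp_fst | apply: comp_snd]; exact: comp_id.
apply: (effective2_of c) => X1 X2 d1 d2 f1 f2 D1 I1 D2 I2.
have [f D fI] := interdP D1 D2; exists f; last by apply: fI; left.
by rewrite /h_iota A_ofI.
Qed.

Lemma effective_upsilon : effective2 h_upsilon.
Proof.
have c : comp (fun x : datum * datum => joind x.1 x.2).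
  by apply: comp_joind; [apply: comp_fst | apply: comp_snd]; exact: comp_id.
apply: (effective2_of c) => X1 X2 d1 d2 f1 f2 D1 I1 D2 I2.
have [f D fI] := joindP gens3_generates D1 D2; exists f; last by apply: fI; left.
by rewrite /h_upsilon A_ofU.
Qed.

Lemma effective_omega : effective1_family h_omega.
Proof.
have [dE _ [fE DE fEI]] := A_E_datum; have [dc [fc DC _]] := Jplus_benign.
have c : comp (fun x : nat * datum => omegad dE dc x.1 x.2).
  by apply: comp_omegad; [apply: comp_fst | apply: comp_snd]; exact: comp_id.
apply: (effective_family_of c) => m X d f m0 D _.
exact: (omegadP DE fEI DC m0 D).
Qed.

Lemma benign_in_explicit X : benign_in gens3 (A_of X) -> exists D, explicit_for D X.
Proof.
by move=> [d [f D fI]]; exists (bdata_of (raw_of d)); have [_] := dfor_explicit D fI.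
Qed.

(** * The sets [Zset] and [Sset] *)

Lemma cyclic_benign f w : wf 3 w -> ev (3, [::]) w = af f -> benign_in gens3 (A_of [set f]).
Proof.
move=> ww E; have [ga gb gc] := gn_F3.
(* The subgroup is cyclic, so [F3] serves as its own overgroup. *)
exists ((3, [::]), ([:: rgen 0; rgen 1; rgen 2], [:: w])); exists (id : F3 -> grp (3, [::])) => //.
split=> //; first by rewrite /dwf /= ww.
- by case=> [|[|[|//]]] _; rewrite ?[nth _ _ _]/= evalw_gen ?ga ?gb ?gc.
- move=> x; rewrite /dsub /A_of; have -> // : [set af g | g in [set f]] =
    [set y | exists2 v, v \in [:: w] & y = ev (3, [::]) v].
  apply/seteqP; split=> y; first by move=> [_ -> <-]; exists w; rewrite ?inE.
  by move=> [v]; rewrite inE => /eqP -> ->; exists f.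
Qed.

Lemma Zset_explicit : exists D, explicit_for D Zset.
Proof.
have [ga _ _] := gn_F3; apply: benign_in_explicit; apply: (@cyclic_benign _ (rgen 0)) => //.
rewrite evalw_gen ga /af bfE tf0 ?conjg1 // => i; rewrite etupleE.
by case: ifP => //; case: i => // -[|n] _ //=; rewrite nth_nil.
Qed.

Lemma subgen1_expz (G : groupType) (x y : G) : subgen [set x] y <-> exists n, y = expz x n.
Proof.
split=> [|[n ->]]; last by apply: (sgXz _ (subgenP _)); exact: subgen_in.
apply: (subgen_min (H := [set y | exists n, y = expz x n])); last by move=> _ ->; exists 1%R.
apply: is_subgroupM => [|_ [n ->]|_ _ [n ->] [k ->]]; first by exists 0%R.
  by exists (- n)%R; rewrite expzN.
by exists (n + k)%R; rewrite expzD.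
Qed.

(** [(n, n + 1)] is [(0, 1)] plus [n] times [(1, 1)]; thus [Sset] arises from a single function by a
    relation of the same kind as the unary operations. *)
Definition diag_rel (g f : calE) : Prop := exists n : int,
  forall i, f i = (g i + n * ((i == 0%R) + (i == 1%R))%N%:Z)%R.

Lemma gadget_diag : inhabited (gadget diag_rel).
Proof.
constructor; apply: (@Gadget _ pB gt gs gt gs [:: gt ++ wconj gt gs]) => //.
  by move=> f g; rewrite ev_gt ev_gs; exact: tB_inj.
move=> g f; rewrite ev_gt ev_gs -/(tB g) -/(tB f); set z := tz Bt Bs 0%R * tz Bt Bs 1%R.
have -> : subgen [set x | exists2 w, w \in [:: gt ++ wconj gt gs] & x = ev pB w] = subgen [set z].
  have zE : ev pB (gt ++ wconj gt gs) = z by rewrite evalw_cat evalw_conj ev_gt ev_gs /z /tz conjg1.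
  congr subgen; apply/seteqP; split=> x; first by move=> [w]; rewrite inE => /eqP -> ->.
  by move=> ->; exists (gt ++ wconj gt gs); rewrite ?inE.
have Ez : EB z by apply: EBM; exact: EB_tz.
have zi i : val0 z i = (((i == 0%R) + (i == 1%R))%N%:Z)%R by rewrite val0M ?val0_tz //; exact: EB_tz.
have Ed := EB_diff g (tB_EB f).
have V i : val0 ((tB g)^-1 * tB f) i = (f i - g i)%R by rewrite val0_diff ?val0_tB //; exact: tB_EB.
rewrite subgen1_expz; split=> -[n E]; exists n.
  apply: EB_eq => // [|i]; first exact: EB_expz.
  by rewrite V val0_expz // zi E addrAC subrr add0r.
by move=> i; rewrite -zi -(val0_expz n i Ez) -E V addrC subrK.
Qed.

Lemma Sset_explicit : exists D, explicit_for D Sset.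
Proof.
have [ga gb gc] := gn_F3; pose e1 := etuple [:: 0%R; 1%R].
have [|D0 ex0] := @benign_in_explicit [set e1].
  apply: (@cyclic_benign _ (wconj (rgen 0) (wconj (rgen 1) (rgen 2)))) => //.
  rewrite !evalw_conj !evalw_gen ga gb gc.
  have -> : b3 ^ c3 = expz (bi 1%R) 1%R by rewrite /= /bi !expg1.
  rewrite -af0; apply/esym/af_delta => i; first by rewrite deltaE if_same eqxx.
  rewrite etupleE !deltaE if_same add0r.
  by case: i => [[|[|n]]|n] //=; rewrite nth_nil.
have [p pP] := effective_gadget gadget_diag; have [D ex _] := pP _ _ ex0.
exists D; suff <- : [set f | exists2 g, [set e1] g & diag_rel g f] = Sset by [].
have eE n i : etuple [:: n; (n + 1)%R] i = (e1 i + n * ((i == 0%R) + (i == 1%R))%N%:Z)%R.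
  rewrite !etupleE; case: i => [[|[|k]]|k] //=; rewrite ?nth_nil; lia.
apply/seteqP; split=> f.
  by move=> [_ -> [n E]]; exists n => //; apply: calE_eq => i; rewrite E eE.
by move=> [n _ <-]; exists e1 => //; exists n => i; exact: eE.
Qed.

Lemma benign_effective1 op X : effective1 op -> benign (A_of X) -> benign (A_of (op X)).
Proof.
by move=> [p pP] /benign_explicit[D ex]; have [D' ex' _] := pP _ _ ex; exact: explicit_benign ex'.
Qed.

Lemma benign_effective2 op X1 X2 : effective2 op ->
  benign (A_of X1) -> benign (A_of X2) -> benign (A_of (op X1 X2)).
Proof.
move=> [p pP] /benign_explicit[D1 ex1] /benign_explicit[D2 ex2].
by have [D' ex' _] := pP _ _ _ _ ex1 ex2; exact: explicit_benign ex'.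
Qed.

Theorem theoremA :
  (forall Y : set calE,
     [\/ Y = Zset \/ Y = Sset,
         exists X1 X2 : set calE,
           [/\ benign (A_of X1), benign (A_of X2)
             & Y = h_iota X1 X2 \/ Y = h_upsilon X1 X2]
       | exists X : set calE,
           benign (A_of X) /\
           (Y = h_rho X \/ Y = h_sigma X \/ Y = h_tau X \/ Y = h_theta X \/
            Y = h_zeta X \/ Y = h_pi X \/
            exists m : nat, (0 < m)%N /\ Y = h_omega m X)] ->
     benign (A_of Y)) /\
  [/\ (exists D : bdata, explicit_for D Zset) /\
      (exists D : bdata, explicit_for D Sset),
      effective2 h_iota /\ effective2 h_upsilon
    & [/\ effective1 h_rho, effective1 h_sigma, effective1 h_tau
        & [/\ effective1 h_theta, effective1 h_zeta, effective1 h_pi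
            & effective1_family h_omega]]].
Proof.
have [eZ eS] := (Zset_explicit, Sset_explicit).
have e_rho : effective1 h_rho := effective_gadget gadget_rho.
have e_sigma : effective1 h_sigma := effective_gadget gadget_sigma.
have e_tau : effective1 h_tau := effective_gadget gadget_tau.
have e_theta : effective1 h_theta := effective_gadget gadget_theta.
have e_zeta : effective1 h_zeta := effective_gadget gadget_zeta.
have e_pi : effective1 h_pi := effective_gadget gadget_pi.
have e_om := effective_omega; have [e_i e_u] := (effective_iota, effective_upsilon).
split=> // Y [[->|->]|[X1 [X2 [b1 b2 [->|->]]]]|[X [bX]]].
- by have [D /explicit_benign] := eZ.
- by have [D /explicit_benign] := eS.
- exact: benign_effective2.
- exact: benign_effective2.
move=> [->|[->|[->|[->|[->|[->|[m [m0 ->]]]]]]]]; try exact: benign_effective1.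
have [p pP] := e_om; have [D ex] := benign_explicit bX.
by have [D' ex' _] := pP _ _ _ m0 ex; exact: explicit_benign ex'.
Qed.
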